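(* Let $G$ be a discrete group, and let $H\leq G$ be a subgroup. The following are equivalent. (i) $(G,H)$ is quasi-symmetric. (ii) $(G,H)$ is quasi-Hermitian. (iii) For all $f=f^*\in \mathbb{C}G$, we have $r([f],PF^*_1(G:H)) = \|\lambda_{G/H}(f)\|$. (iv) For all $f=f^*\in \mathbb{C}G$, $r([f],PF^*_p(G:H))$ is independent of $p\in [1,2]$. (v) For all $f\in \mathbb{C}G$, we have $\mathrm{Sp}([f],PF^*_1(G:H)) = \mathrm{Sp}([f],C^*_{\lambda_{G/H}}(G))$. (vi) For all $f\in \mathbb{C}G$, $\mathrm{Sp}([f],PF^*_p(G:H))$ is independent of $p\in [1,2]$.
   Context: Let $G$ be a discrete group and $H\leq G$ a subgroup. $\ell^1(G)$ is the convolution Banach $*$-algebra with involution $f^*(x)=\overline{f(x^{-1})}$, and $\mathbb{C}G\subseteq \ell^1(G)$ is the $*$-subalgebra of finitely supported functions. For $1\leq p\leq\infty$ define the representation $\lambda^p_{G/H}:\ell^1(G)\to \mathcal{B}(\ell^p(G/H))$ by $\lambda^p_{G/H}(f)g(xH)=\sum_{y\in G} f(y)g(y^{-1}xH)$, and write $\lambda_{G/H}=\lambda^2_{G/H}$. The kernel $\mathrm{Ker}$ of $\lambda^p_{G/H}$ does not depend on $p$: it is the set of $g\in\ell^1(G)$ with $\sum_{h\in H}g(xhy)=0$ for all $x,y\in G$. Put $\ell^1(G:H)=\ell^1(G)/\mathrm{Ker}$ (a Banach $*$-algebra with the quotient norm), write $[f]$ for the class of $f\in\ell^1(G)$, and $[\mathbb{C}G]=\{[f]: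 f\in\mathbb{C}G\}$. For $1\leq p\leq 2$ with conjugate exponent $q$ ($p^{-1}+q^{-1}=1$), set $\|f\|_{PF_p^*}=\max\{\|\lambda^p_{G/H}(f)\|,\|\lambda^q_{G/H}(f)\|\}$. $PF_p^*(G:H)$ is the completion of $\ell^1(G:H)$ in this norm; it is a unital Banach $*$-algebra. $C^*_{\lambda_{G/H}}(G)$ is the norm closure of $\lambda_{G/H}(\ell^1(G))$ in $\mathcal{B}(\ell^2(G/H))$, in which $[f]$ is identified with $\lambda_{G/H}(f)$; it is canonically isomorphic to $PF_2^*(G:H)$. $\mathrm{Sp}(a,A)$ and $r(a,A)$ denote the spectrum and the spectral radius of $a$ in $A$. For a $*$-subalgebra $S$ of a Banach $*$-algebra $A$: $S$ is quasi-Hermitian in $A$ if $\mathrm{Sp}(a,A)\subseteq\mathbb{R}$ for every self-adjoint $a\in S$; $S$ is quasi-symmetric in $A$ if $\mathrm{Sp}(a^*a,A)\subseteq\mathbb{R}_+=[0,\infty)$ for every $a\in S$. The pair $(G,H)$ is quasi-Hermitian (resp. quasi-symmetric) if $[\mathbb{C}G]$ is quasi-Hermitian (resp. quasi-symmetric) in $PF_1^*(G:H)$. *)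

(* Defs.v *)
From HB Require Import structures.
From mathcomp Require Import all_boot all_order all_algebra generic_quotient.
From mathcomp Require Import complex.
From mathcomp Require Import all_classical all_reals all_analysis.

Set Implicit Arguments.
Unset Strict Implicit.
Unset Printing Implicit Defensive.

Import Order.TTheory GRing.Theory Num.Theory.

Local Open Scope classical_set_scope.
Local Open Scope ring_scope.
Local Open Scope quotient_scope.

Section spectrum.
Variable R : realType.
Local Notation C := R[i].

(** A unital complex algebra given as a subquotient of an ambient type of
    representatives: its elements are the representatives satisfying [alg_elt],
    two of them being equal in the algebra when they are related by [alg_eq];
    [alg_scalar z] represents z.1. *)
Record calgebra := CAlgebra {
  alg_carrier :> zmodType;
  alg_elt : set alg_carrier;
  alg_eq : alg_carrier -> alg_carrier -> Prop;
  alg_scalar : C -> alg_carrier;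
  alg_mul : alg_carrier -> alg_carrier -> alg_carrier }.

Definition inverse_in (A : calgebra) (a b : A) : Prop :=
  alg_eq (alg_mul a b) (alg_scalar A 1) /\ alg_eq (alg_mul b a) (alg_scalar A 1).

Definition Sp (A : calgebra) (a : A) : set C :=
  [set z | ~ exists2 b : A, alg_elt b & inverse_in (alg_scalar A z - a) b].

Definition spectral_radius (A : calgebra) (a : A) : \bar R :=
  ereal_sup [set (Normc.normc z)%:E | z in Sp a].

(** [star] is the involution of [A], on representatives. *)
Definition quasi_hermitian (A : calgebra) (star : A -> A) (S : set A) : Prop :=
  forall a, S a -> alg_eq (star a) a -> Sp a `<=` [set z | z \is Num.real].

(** In [R[i]], [0 <= z] means that z is real and nonnegative. *)
Definition quasi_symmetric (A : calgebra) (star : A -> A) (S : set A) : Prop :=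
  forall a, S a -> Sp (alg_mul (star a) a) `<=` [set z | 0 <= z].

End spectrum.

Section lp.
Variables (R : realType) (T : choiceType).
Local Notation C := R[i].

(** Only meaningful for absolutely summable families. *)
Definition rsum (f : T -> R) : R :=
  fine (\esum_(x in [set: T]) (Num.max (f x) 0)%:E)
  - fine (\esum_(x in [set: T]) (Num.max (- f x) 0)%:E).

Definition csum (f : T -> C) : C :=
  Complex (rsum (fun x => complex.Re (f x))) (rsum (fun x => complex.Im (f x))).

(** Meant for 1 <= p <= +oo; the value at -oo is irrelevant. *)
Definition lnorm (p : \bar R) (g : T -> C) : \bar R :=
  match p with
  | r%:E => ((\esum_(x in [set: T]) (Normc.normc (g x) `^ r)%:E) `^ r^-1)%E
  | +oo%E => ereal_sup (range (fun x => (Normc.normc (g x))%:E))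
  | -oo%E => 0%E
  end.

Definition lp (p : \bar R) : set (T -> C) := [set g | (lnorm p g < +oo)%E].

(** Operator norm on l^p; operators are given as maps on all functions, and
    only their restriction to l^p matters. *)
Definition opnorm (p : \bar R) (S : (T -> C) -> (T -> C)) : \bar R :=
  ereal_sup [set lnorm p (S g) | g in [set g | (lnorm p g <= 1)%E]].

Definition bounded_operator (p : \bar R) : set ((T -> C) -> (T -> C)) :=
  [set S | (forall (a : C) (g h : T -> C), lp p g -> lp p h ->
              S (fun x => a * g x + h x) = (fun x => a * S g x + S h x))
           /\ (opnorm p S < +oo)%E].

End lp.

Section group_algebra.
Variables (R : realType) (G : groupType).
Local Notation C := R[i].

Definition ell1 : set (G -> C) := lp 1%E.

Definition finitely_supported : set (G -> C) :=
  [set f | finite_set [set x | f x != 0]].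

Definition delta1 : G -> C := fun x => (x == 1%g)%:R.

Definition convolution (f g : G -> C) : G -> C :=
  fun x => csum (fun y => f y * g (y^-1 * x)%g).

Definition involution (f : G -> C) : G -> C := fun x => (f x^-1%g)^*.

End group_algebra.

Section cosets.
Variables (G : groupType) (H : groupClosed G).

Definition same_coset : rel G := fun x y => (x^-1 * y)%g \in H.

Fact same_coset_equiv : equiv_class_of same_coset.
Proof.
split=> [x|x y|y x z]; rewrite /same_coset.
- by rewrite mulVg gpred1.
- by rewrite -[RHS]gpredV invgM invgK.
- move=> xy yz.
  have -> : (x^-1 * z = (x^-1 * y) * (y^-1 * z))%g.
    by rewrite -mulgA mulVKg.
  exact: gpredM.
Qed.

Canonical same_coset_equivRel := EquivRelPack same_coset_equiv.

(** G/H; the coset xH is [\pi_(cosets) x]. *)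
Definition cosets := {eq_quot same_coset}.

HB.instance Definition _ := Choice.on cosets.
HB.instance Definition _ := EqQuotient.on cosets.

End cosets.

Section pseudofunctions.
Variables (R : realType) (G : groupType) (H : groupClosed G).
Local Notation C := R[i].

(** lambda^p_{G/H}(f); the formula does not depend on p, which only enters
    through the norm. *)
Definition lambda (f : G -> C) (g : cosets H -> C) : cosets H -> C :=
  fun c => csum (fun y => f y * g (\pi_(cosets H) (y^-1 * repr c)%g)).

Definition PFnorm (p : R) (f : G -> C) : \bar R :=
  Order.max (opnorm p%:E (lambda f)) (opnorm (hoelder_conjugate p%:E) (lambda f)).

Definition PF_cauchy (p : R) : set (nat -> G -> C) :=
  [set u | (forall n, ell1 (u n)) /\
     forall e : R, 0 < e -> exists k : nat, forall m n : nat,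
       (k <= m)%N -> (k <= n)%N -> (PFnorm p (u m - u n)%R < e%:E)%E].

Definition PF_null (p : R) : set (nat -> G -> C) :=
  [set u | PFnorm p (u n) @[n --> \oo] --> (0 : \bar R)%E].

(** The completion of l^1(G:H): Cauchy sequences modulo null sequences. On
    l^1(G), [PFnorm p] is a seminorm that vanishes exactly on the kernel of
    [lambda], so that sequences in l^1(G) represent the sequences in the
    quotient l^1(G:H), and the null ones represent 0. *)
Definition PF (p : R) : calgebra R :=
  {| alg_carrier := nat -> G -> C;
     alg_elt := PF_cauchy p;
     alg_eq := fun u v => PF_null p (u - v);
     alg_scalar := fun z _ x => z * delta1 R x;
     alg_mul := fun u v n => convolution (u n) (v n) |}.

Definition PF_star (p : R) : PF p -> PF p := fun u n => involution (u n).

Definition PF_class (p : R) (f : G -> C) : PF p := fun _ => f.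

Definition PF_CG (p : R) : set (PF p) :=
  [set PF_class p f | f in @finitely_supported R G].

(** The norm closure of lambda(l^1(G)) in B(l^2(G/H)). *)
Definition Cstar_elt : set ((cosets H -> C) -> (cosets H -> C)) :=
  [set S | bounded_operator 2%:E S /\
     forall e : R, 0 < e ->
       exists2 f, @ell1 R G f & (opnorm 2%:E (S - lambda f)%R < e%:E)%E].

Definition Cstar : calgebra R :=
  {| alg_carrier := (cosets H -> C) -> (cosets H -> C);
     alg_elt := Cstar_elt;
     alg_eq := fun S T => forall g, lp 2%:E g -> S g = T g;
     alg_scalar := fun z g x => z * g x;
     alg_mul := fun S T => S \o T |}.

Definition Cstar_class (f : G -> C) : Cstar := lambda f.

Definition pair_quasi_hermitian : Prop :=
  quasi_hermitian (@PF_star 1) (@PF_CG 1).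

Definition pair_quasi_symmetric : Prop :=
  quasi_symmetric (@PF_star 1) (@PF_CG 1).

End pseudofunctions.

Arguments lambda {R G} H f g.
Arguments Cstar_class {R G} H f.

(* Main.v *)
Require Import Defs.
From HB Require Import structures.
From mathcomp Require Import all_boot all_order all_algebra.
From mathcomp Require Import finmap cyclic separable cyclotomic complex.
From mathcomp Require Import all_classical all_reals all_analysis.
From mathcomp Require Import ring lra.

(** Spectra in a completion are read off the seminorm itself: by the Neumann
    series, [x] is invertible in the completion of [CG] if and only if it has an
    inverse in [CG] up to errors of seminorm less than 1. As
    [n_2 <= n_p <= n_1], where [n_p] is the [PF_p^*] norm, invertibility for
    [n_1] implies it for [n_p], and then for [n_2].

    (ii) => (iii): let [a = a^*] in [CG] be supported in [S], with real spectrum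
    for [n_1], and let [N_th] be a submultiplicative seminorm that interpolates
    between [n_1] and [n_2]. For real [z] beyond [n_2 a],
    [q = 1 - eta (z - a)^2] has [n_2 q < 1] for small [eta > 0] and, the spectrum
    of [a] being real, no spectrum outside the unit disc for [n_1]; so its powers
    grow subexponentially for [n_1], hence decay for [N_th], and [z] is not in
    the [N_th]-spectrum of [a]. Thus [a] has [N_th]-spectral radius at most
    [n_2 a]. The powers of [a] have support of size at most [#|S|^n], which gives
    [n_1 (a^n) <= #|S|^(n th / 2) N_th (a^n)]; let [th] tend to 0.

    (iv) => (v): if [x] is invertible for [n_2], then [n_2 (r - x^* x) < r] for
    some [r > 0], so that equality of spectral radii makes [x^* x], and likewise
    [x x^*], invertible for [n_1]. The implication (i) => (ii) is the factorization
    [z^2 - a^2 = (z - a)(z + a)], and (vi) => (i) is the positivity of [x^* x] in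
    the C*-algebra. *)

Set Implicit Arguments.
Unset Strict Implicit.
Unset Printing Implicit Defensive.

Import Order.TTheory GRing.Theory Num.Theory.
Import numFieldNormedType.Exports.

Local Open Scope classical_set_scope.
Local Open Scope ring_scope.

(** * Complex moduli *)

(** The logarithmic mean n_1^(1 - th) n_2^th is submultiplicative, so subexponential growth of the
    powers of q for n_1 and geometric decay for n_2 combine into decay. It need not be subadditive,
    so N_th is an infimum over finite decompositions. The pieces of a decomposition of a^n have no
    controlled support; the factor [#|S|^(n th / 2)] survives because only the columns of the matrix
    of a^n are estimated, each carried by at most [#|S|^n] cosets, where the l^1 norm is at most
    [#|S|^(n / 2)] times the l^2 norm. Self-adjointness turns the resulting l^1 bound into an l^oo
    bound.

    The quadratic q serves both norms: eta (z - a)^2 is positive and bounded below for n_2, which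
    pushes n_2 q under 1, while w - q factors into two linear terms in a, which are controlled by
    the n_1-spectrum of a.

    The comparison n_2 <= n_p <= n_1 needs no complex interpolation. The right half is the Schur
    test. The left half reduces to [star f * f], and for self-adjoint elements it follows from the
    log-convexity of the l^2 norms of a^m u. *)

Section real_facts.
Variable R : realType.
Implicit Types q e C : R.

Lemma expr_lt_eps q e : 0 <= q < 1 -> 0 < e -> exists n, q ^+ n < e.
Proof.
move=> /andP[q0 q1] e0.
have /cvgrPdist_lt/(_ e e0)[n _ /(_ n (leqnn n))] : q ^+ n @[n --> \oo] --> 0.
  by apply: cvg_expr; rewrite ger0_norm.
by rewrite sub0r normrN ger0_norm ?exprn_ge0// => ?; exists n.
Qed.

Lemma le_of_expr_bound q c C : 0 <= q -> 0 < c -> (forall n, c * q ^+ n <= C) ->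
  q <= 1.
Proof.
move=> q0 c0 H; rewrite leNgt; apply/negP => q1.
have C0 : 0 < C by have := H 0; rewrite expr0 mulr1; apply: lt_le_trans.
have [|n] := @expr_lt_eps q^-1 (c / C) _ (divr_gt0 c0 C0).
  by rewrite invr_ge0 q0 invf_lt1// (lt_trans ltr01).
have qn : 0 < q ^+ n by rewrite exprn_gt0// (lt_trans ltr01).
rewrite exprVn ltr_pdivlMr// mulrC ltr_pdivrMr// ltNge => /negP; exact.
Qed.

End real_facts.

Notation normc := Normc.normc.
Arguments Normc.normc : simpl never.

Section normc_facts.
Variable R : realType.
Implicit Types z w : R[i].

Lemma normcE_norm z : `|z| = (normc z)%:C%C.
Proof. by []. Qed.

Lemma normc_ge0 z : 0 <= normc z.
Proof. by have := normr_ge0 z; rewrite normcE_norm ler0c. Qed.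

Lemma normc_eq0 z : (normc z == 0) = (z == 0).
Proof.
apply/eqP/eqP => [/Normc.eq0_normc//|->]; exact: Normc.normc0.
Qed.

Lemma normc_gt0 z : (0 < normc z) = (z != 0).
Proof. by rewrite lt_def normc_ge0 andbT normc_eq0. Qed.

Lemma normcX z n : normc (z ^+ n) = normc z ^+ n.
Proof.
by elim: n => [|n IH]; rewrite ?Normc.normc1// !exprS Normc.normcM IH.
Qed.

Lemma normc_real (x : R) : normc x%:C%C = `|x|.
Proof. by rewrite /Normc.normc /= expr0n addr0 sqrtr_sqr. Qed.

Lemma realC_eq0 (x : R) : (x%:C%C == 0 :> R[i]) = (x == 0).
Proof. by rewrite -normc_eq0 normc_real normr_eq0. Qed.

Lemma conj_realC (x : R) : (x%:C%C : R[i])^* = x%:C%C.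
Proof. by apply: conj_Creal; rewrite complex_real. Qed.

Lemma normc_conj z : normc z^* = normc z.
Proof. by apply: (@complexI R); rewrite -!normcE_norm norm_conjC. Qed.

Lemma mul_conj z : z * z^* = (normc z ^+ 2)%:C%C.
Proof. by rewrite -normCK normcE_norm rmorphXn. Qed.

Lemma normc_sum (I : Type) (s : seq I) (F : I -> R[i]) :
  normc (\sum_(i <- s) F i) <= \sum_(i <- s) normc (F i).
Proof.
elim/big_ind2 : _ => [|x1 x2 y1 y2 h1 h2|//]; first by rewrite Normc.normc0.
by apply: le_trans (le_normcD _ _) _; exact: lerD.
Qed.

End normc_facts.

(** * Approximate inverses in a seminormed algebra *)

Section seminormed_algebras.
Variables (R : realType) (E : algType R[i]).
Implicit Types (N : E -> R) (x y b : E).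

Record algebra_seminorm N : Prop := AlgebraSeminorm {
  snD : forall x y, N (x + y) <= N x + N y;
  snZ : forall (z : R[i]) x, N (z *: x) = normc z * N x;
  snM : forall x y, N (x * y) <= N x * N y }.

(** A seminorm is only a presentation of the Banach algebra obtained by
    completion: by density and the Neumann series, [x] is invertible in the
    completion if and only if [near_inv N x]. *)
Definition near_inv N x := exists b, N (x * b - 1) < 1 /\ N (b * x - 1) < 1.

Definition power_bounded N x (t : R) := exists C, forall n, N (x ^+ n) <= C * t ^+ n.

Section seminorm_theory.
Variable N : E -> R.
Hypothesis sN : algebra_seminorm N.

Lemma sn0 : N 0 = 0.
Proof. by rewrite -[X in N X](scale0r 0) (snZ sN) Normc.normc0 mul0r. Qed.

Lemma snN x : N (- x) = N x.
Proof. by rewrite -scaleN1r (snZ sN) normcN Normc.normc1 mul1r. Qed.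

Lemma sn_ge0 x : 0 <= N x.
Proof.
have := snD sN x (- x); rewrite subrr sn0 snN.
by lra.
Qed.
Hint Resolve sn_ge0 : core.

Lemma snB x y : N (x - y) <= N x + N y.
Proof. by rewrite -(snN y); exact: (snD sN). Qed.

Lemma snBC x y : N (x - y) = N (y - x).
Proof. by rewrite -snN opprB. Qed.

Lemma sn_trans y x z : N (x - z) <= N (x - y) + N (y - z).
Proof. by apply: le_trans (snD sN _ _); rewrite subrKA. Qed.

Lemma sn_sum (I : Type) (s : seq I) (P : pred I) (F : I -> E) :
  N (\sum_(i <- s | P i) F i) <= \sum_(i <- s | P i) N (F i).
Proof.
elim/big_ind2 : _ => [|x1 x2 y1 y2 h1 h2|//]; first by rewrite sn0.
by apply: le_trans (snD sN _ _) _; exact: lerD.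
Qed.

Lemma sn_mulX y x n : N (y * x ^+ n) <= N y * N x ^+ n.
Proof.
elim: n => [|n IH]; first by rewrite !expr0 !mulr1.
rewrite exprSr mulrA; apply: le_trans (snM sN _ _) _.
by rewrite exprSr mulrA ler_wpM2r.
Qed.

Lemma sn_mulXl y x n : N (x ^+ n * y) <= N x ^+ n * N y.
Proof.
elim: n => [|n IH]; first by rewrite !expr0 !mul1r.
rewrite exprS -mulrA; apply: le_trans (snM sN _ _) _.
by rewrite exprS -mulrA ler_wpM2l.
Qed.

Lemma sn_expr x n : N (x ^+ n.+1) <= N x ^+ n.+1.
Proof. by rewrite !exprS; exact: sn_mulX. Qed.

Lemma geometric_sum_le (c q : R) n : 0 <= c -> 0 <= q < 1 ->
  \sum_(i < n) c * q ^+ i <= c / (1 - q).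
Proof.
move=> c0 /andP[q0 q1]; rewrite -mulr_sumr ler_wpM2l//.
have q1' : 0 < 1 - q by rewrite subr_gt0.
rewrite -[leRHS]mul1r ler_pdivlMr// mulrC -[X in X <= _]opprK -mulNr opprB.
by rewrite -subrX1 opprB gerBl exprn_ge0.
Qed.

Lemma geom_r (u : E) n : (1 - u) * (\sum_(i < n) u ^+ i) = 1 - u ^+ n.
Proof. by rewrite -[1 - u]opprB mulNr -subrX1 opprB. Qed.

Lemma geom_l (u : E) n : (\sum_(i < n) u ^+ i) * (1 - u) = 1 - u ^+ n.
Proof.
rewrite -geom_r; apply: commr_sym; apply: commr_sum => i _.
by apply: commrX; apply: commr_sym; apply: commrB => //; exact: commr1.
Qed.

Lemma left_refine l x q e : N (l * x - 1) <= q -> q < 1 -> 0 < e ->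
  exists b, N b <= N l / (1 - q) /\ N (b * x - 1) <= e.
Proof.
move=> lq q1 e0; have q0 : 0 <= q := le_trans (sn_ge0 _) lq.
(* The exponent has to be positive for [sn_expr], as N 1 may exceed 1. *)
have [n qn] : exists n, q ^+ n.+1 < e.
  have [n qn] := expr_lt_eps (introT andP (conj q0 q1)) e0; exists n.
  by apply: le_lt_trans qn; rewrite exprS ler_piMl ?exprn_ge0// ltW.
exists ((\sum_(i < n.+1) (1 - l * x) ^+ i) * l); split.
  rewrite mulr_suml; apply: le_trans (sn_sum _ _ _) _.
  apply: le_trans (geometric_sum_le n.+1 (sn_ge0 l) (introT andP (conj q0 q1))).
  apply: ler_sum => i _; apply: le_trans (sn_mulXl _ _ _) _.
  by rewrite mulrC ler_wpM2l// lerXn2r ?nnegrE// snBC.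
(* The truncated Neumann series telescopes, and the error is a power of 1 - l x. *)
have -> : (\sum_(i < n.+1) (1 - l * x) ^+ i) * l * x - 1 = - (1 - l * x) ^+ n.+1.
  by rewrite -mulrA -{2}[l * x](subKr 1) geom_l addrAC subrr sub0r.
rewrite snN; apply: (le_trans (sn_expr _ _)); apply: le_trans (ltW qn).
by rewrite lerXn2r ?nnegrE// snBC.
Qed.

Lemma right_refine r x q e : N (x * r - 1) <= q -> q < 1 -> 0 < e ->
  exists b, N b <= N r / (1 - q) /\ N (x * b - 1) <= e.
Proof.
move=> rq q1 e0; have q0 : 0 <= q := le_trans (sn_ge0 _) rq.
have [n qn] : exists n, q ^+ n.+1 < e.
  have [n qn] := expr_lt_eps (introT andP (conj q0 q1)) e0; exists n.
  by apply: le_lt_trans qn; rewrite exprS ler_piMl ?exprn_ge0// ltW.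
exists (r * (\sum_(i < n.+1) (1 - x * r) ^+ i)); split.
  rewrite mulr_sumr; apply: le_trans (sn_sum _ _ _) _.
  apply: le_trans (geometric_sum_le n.+1 (sn_ge0 r) (introT andP (conj q0 q1))).
  apply: ler_sum => i _; apply: le_trans (sn_mulX _ _ _) _.
  by rewrite ler_wpM2l// lerXn2r ?nnegrE// snBC.
have -> : x * (r * (\sum_(i < n.+1) (1 - x * r) ^+ i)) - 1 = - (1 - x * r) ^+ n.+1.
  by rewrite mulrA -{1}[x * r](subKr 1) geom_r addrAC subrr sub0r.
rewrite snN; apply: (le_trans (sn_expr _ _)); apply: le_trans (ltW qn).
by rewrite lerXn2r ?nnegrE// snBC.
Qed.

(** An approximate left inverse b and an approximate right inverse r' are close to each other, since
    b is nearly b x r', which is nearly r'. Hence b serves on both sides. The bound on N b does not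
    depend on e. *)
Lemma refine l r x q e : N (l * x - 1) <= q -> N (x * r - 1) <= q -> q < 1 ->
  0 < e ->
  exists b, [/\ N b <= N l / (1 - q), N (x * b - 1) <= e & N (b * x - 1) <= e].
Proof.
move=> lq rq q1 e0.
pose M := N l / (1 - q); pose M' := N r / (1 - q).
have M0 : 0 <= M by rewrite divr_ge0 ?subr_ge0// ltW.
have M'0 : 0 <= M' by rewrite divr_ge0 ?subr_ge0// ltW.
(* D adds up the factors by which errors of size e / D are multiplied in x b - 1. *)
pose D := N x * M + N x * M' + 1.
have D1 : 1 <= D by rewrite lerDr addr_ge0// mulr_ge0.
have D0 : 0 < D by exact: lt_le_trans D1.
have eD0 : 0 < e / D by rewrite divr_gt0.
have eDe : e / D <= e by rewrite ler_pdivrMr// ler_peMr// ltW.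
have [b [bM bx]] := left_refine lq q1 eD0.
have [r' [rM xr]] := right_refine rq q1 eD0.
exists b; split => //; last exact: le_trans eDe.
have -> : x * b - 1 = x * b * (1 - x * r') + x * (b * x - 1) * r' + (x * r' - 1).
  rewrite !mulrBr !mulrBl !mulr1 !mulrA addrA; congr (_ - 1).
  by rewrite subrKA subrK.
have -> : e = (N x * M * (e / D) + N x * (e / D) * M') + e / D.
  have {1}-> : e = e / D * D by rewrite divfK// gt_eqF.
  by move: (e / D) => w; rewrite /D; ring.
apply: le_trans (snD sN _ _) _; apply: lerD => //.
apply: le_trans (snD sN _ _) _; apply: lerD.
  apply: le_trans (snM sN _ _) _; apply: ler_pM => //; last by rewrite snBC.
  by apply: le_trans (snM sN _ _) _; exact: ler_wpM2l.
apply: le_trans (snM sN _ _) _; apply: ler_pM => //.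
by apply: le_trans (snM sN _ _) _; exact: ler_wpM2l.
Qed.

Lemma near_inv_two_sided l r x : N (l * x - 1) < 1 -> N (x * r - 1) < 1 ->
  near_inv N x.
Proof.
move=> l1 r1; pose q := Num.max (N (l * x - 1)) (N (x * r - 1)).
have q1 : q < 1 by rewrite gt_max l1.
have lq : N (l * x - 1) <= q by rewrite le_max lexx.
have rq : N (x * r - 1) <= q by rewrite le_max lexx orbT.
have h0 : (0 : R) < 1 / 2 by lra.
have [b [_ xb bx]] := refine lq rq q1 h0.
by exists b; split; [apply: le_lt_trans xb _|apply: le_lt_trans bx _]; lra.
Qed.

(** The bound M is uniform in e; this is what later makes approximate inverses a Cauchy sequence and
    lets products of them be controlled. *)
Lemma near_inv_refine x : near_inv N x -> exists2 M, 0 <= M & forall e, 0 < e ->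
  exists b, [/\ N b <= M, N (x * b - 1) <= e & N (b * x - 1) <= e].
Proof.
move=> [b [xb bx]]; pose q := Num.max (N (x * b - 1)) (N (b * x - 1)).
have q1 : q < 1 by rewrite gt_max xb.
exists (N b / (1 - q)); first by rewrite divr_ge0// subr_ge0 ltW.
have lq : N (b * x - 1) <= q by rewrite le_max lexx orbT.
have rq : N (x * b - 1) <= q by rewrite le_max lexx.
by move=> e; exact: (refine lq rq q1).
Qed.

(** An approximate inverse of y x yields a left one for x, and one of x y yields a right one; the
    two may differ. *)
Lemma near_inv_mul_cancel x y : near_inv N (x * y) -> near_inv N (y * x) ->
  near_inv N x.
Proof.
move=> [b [xyb _]] [b' [_ b'yx]].
by apply: (@near_inv_two_sided (b' * y) (y * b)); rewrite ?mulrA// -mulrA.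
Qed.

Lemma near_inv_mul x y : near_inv N x -> near_inv N y -> near_inv N (x * y).
Proof.
move=> /near_inv_refine[M M0 HM] /near_inv_refine[K K0 HK].
(* Errors of the two factors get multiplied by norms of the other data, so they are made small
   relative to these: e = 1 / (4 D) leaves at most 1/4. *)
pose D := N x * M + N y * K + 1.
have D0 : 0 < D by rewrite ltr_wpDl// addr_ge0// mulr_ge0.
pose e := (1 / 4) / D.
have e0 : 0 < e by rewrite divr_gt0//; lra.
have De : D * e = 1 / 4 by rewrite mulrC divfK// gt_eqF.
clearbody e.
have e4 : N x * M * e + N y * K * e + e = 1 / 4.
  by rewrite -De /D; ring.
have xM0 : 0 <= N x * M * e by rewrite !mulr_ge0// ltW.
have yK0 : 0 <= N y * K * e by rewrite !mulr_ge0// ltW.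
have [a [aM xa ax]] := HM e e0; have [b [bK yb by_]] := HK e e0.
exists (b * a); split.
  have -> : x * y * (b * a) - 1 = x * (y * b - 1) * a + (x * a - 1).
    by rewrite mulrBr mulrBl mulr1 !mulrA addrA addrNK.
  apply: (@le_lt_trans _ _ (N x * e * M + e)); last by lra.
  apply: le_trans (snD sN _ _) _; apply: lerD => //.
  apply: le_trans (snM sN _ _) _; apply: ler_pM => //.
  by apply: le_trans (snM sN _ _) _; exact: ler_wpM2l.
have -> : b * a * (x * y) - 1 = b * (a * x - 1) * y + (b * y - 1).
  by rewrite mulrBr mulrBl mulr1 !mulrA addrA addrNK.
apply: (@le_lt_trans _ _ (K * e * N y + e)); last by lra.
apply: le_trans (snD sN _ _) _; apply: lerD => //.
apply: le_trans (snM sN _ _) _; apply: ler_pM => //.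
apply: le_trans (snM sN _ _) _; apply: ler_pM => //.
Qed.

Lemma near_invZ (z : R[i]) x : z != 0 -> near_inv N x -> near_inv N (z *: x).
Proof.
move=> z0 [b [xb bx]]; exists (z^-1 *: b).
by rewrite -!scalerAl -!scalerAr !scalerA mulfV// mulVf// !scale1r.
Qed.

Lemma near_inv_eq x y : N (x - y) = 0 -> near_inv N x -> near_inv N y.
Proof.
move=> xy0 [b [xb bx]]; exists b; split.
  have -> : y * b - 1 = (x * b - 1) - (x - y) * b.
    by rewrite mulrBl opprB [RHS]addrC subrKA.
  apply: le_lt_trans (snB _ _) _; apply: le_lt_trans xb.
  by rewrite gerDl; apply: le_trans (snM sN _ _) _; rewrite xy0 mul0r.
have -> : b * y - 1 = (b * x - 1) - b * (x - y).
  by rewrite mulrBr opprB [RHS]addrC subrKA.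
apply: le_lt_trans (snB _ _) _; apply: le_lt_trans bx.
by rewrite gerDl; apply: le_trans (snM sN _ _) _; rewrite xy0 mulr0.
Qed.

Lemma near_inv_1sub x n : N (x ^+ n) < 1 -> near_inv N (1 - x).
Proof.
move=> xn; exists (\sum_(i < n) x ^+ i).
by rewrite geom_r geom_l addrAC subrr sub0r snN.
Qed.

(** The easy half of the spectral radius formula: some power of x / z has seminorm less than 1, and
    a finite geometric sum then inverts 1 - x / z up to that power. *)
Lemma power_bounded_near_inv x t (z : R[i]) : power_bounded N x t -> 0 <= t ->
  t < normc z -> near_inv N (z%:A - x).
Proof.
move=> [C HC] t0 tz; have nz0 : 0 < normc z by exact: le_lt_trans tz.
have z0 : z != 0 by rewrite -normc_gt0.
have -> : z%:A - x = z *: (1 - z^-1 *: x).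
  by rewrite scalerBr scalerA mulfV// scale1r.
apply: near_invZ => //.
have C1 : 0 < `|C| + 1 by rewrite ltr_wpDl.
have q01 : 0 <= t / normc z < 1.
  by rewrite divr_ge0 ?normc_ge0//= ltr_pdivrMr// mul1r.
have [n qn] := expr_lt_eps q01 (etrans (invr_gt0 _) C1).
apply: (@near_inv_1sub _ n).
rewrite exprZn (snZ sN) normcX Normc.normcV.
rewrite -(ltr_pM2l C1) mulfV ?gt_eqF// in qn; apply: le_lt_trans qn.
rewrite exprMn mulrA [leLHS]mulrC ler_wpM2r ?exprn_ge0 ?invr_ge0 ?normc_ge0//.
apply: le_trans (HC n) _; rewrite ler_wpM2r ?exprn_ge0//.
by apply: le_trans (ler_norm _) _; rewrite lerDl.
Qed.

Lemma near_inv_gt_norm x (z : R[i]) : N x < normc z -> near_inv N (z%:A - x).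
Proof.
move=> xz; apply: (power_bounded_near_inv _ _ xz) => //.
(* The maximum takes care of n = 0, where the power is 1 and N 1 may exceed 1. *)
exists (Num.max 1 (N 1)) => -[|n]; rewrite ?expr0 ?mulr1 ?le_max ?lexx ?orbT//.
apply: le_trans (sn_expr _ _) _.
by rewrite ler_peMl ?exprn_ge0// le_max lexx.
Qed.

End seminorm_theory.

Lemma near_inv_le N N' x : (forall y, N y <= N' y) -> near_inv N' x -> near_inv N x.
Proof.
by move=> NN' [b [xb bx]]; exists b; split; apply: le_lt_trans (NN' _) _.
Qed.

End seminormed_algebras.

(** * Complex roots of unity *)

Section roots_of_unity.
Variable R : realType.

(** X^n - 1 splits and is separable, so it has n distinct roots, and a field with n distinct n-th
    roots of unity contains a primitive one. *)
Lemma primitive_root_exists n : (0 < n)%N -> exists w : R[i], n.-primitive_root w.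
Proof.
move=> n0; pose p : {poly R[i]} := 'X^n - 1.
have [rs] := closed_field_poly_normal p.
rewrite (monicP (monicXnsubC _ n0)) scale1r => prs.
have nrs : (n < (size rs).+1)%N.
  by rewrite -(size_prod_XsubC rs id) -prs size_XnsubC.
have rs1 : all n.-unity_root rs.
  by apply/allP => z; rewrite -root_prod_XsubC -prs.
have urs : uniq rs.
  by rewrite -separable_prod_XsubC -prs separable_Xn_sub_1// pnatr_eq0 -lt0n.
by have /hasP[w _ pw] := has_prim_root n0 rs1 urs nrs; exists w.
Qed.

Lemma primitive_root_normc n (w : R[i]) : n.-primitive_root w -> normc w = 1.
Proof.
move=> pw; apply: (@pexpIrn _ n (prim_order_gt0 pw)); rewrite ?nnegrE ?normc_ge0//.
by rewrite -normcX (prim_expr_order pw) Normc.normc1 expr1n.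
Qed.

Lemma primitive_root_sum n (w : R[i]) k : n.-primitive_root w -> (0 < k < n)%N ->
  \sum_(j < n) (w ^+ j) ^+ k = 0.
Proof.
move=> pw /andP[k0 kn].
have : (w ^+ k - 1) * \sum_(j < n) (w ^+ j) ^+ k = 0.
  under eq_bigr do rewrite exprAC.
  by rewrite -subrX1 exprAC (prim_expr_order pw) expr1n subrr.
move/eqP; rewrite mulf_eq0 subr_eq0 => /orP[|/eqP//].
rewrite -(expr0 w) (eq_prim_root_expr pw) mod0n modn_small//.
by rewrite eqn0Ngt k0.
Qed.

End roots_of_unity.

(** * Power-boundedness *)

Section rickart.
Variables (R : realType) (E : algType R[i]) (N : E -> R).
Hypothesis sN : algebra_seminorm N.
Variable x : E.
Let N_ge0 y : 0 <= N y := sn_ge0 sN y.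
Hint Resolve N_ge0 : core.

(** Says that 1 - z x has an inverse of norm at most M in the completion, expressed by
    approximations of that inverse inside E. *)
Definition approx_resolvent (M : R) (z : R[i]) := forall e : R, 0 < e ->
  exists b, [/\ N b <= M, N ((1 - z *: x) * b - 1) <= e & N (b * (1 - z *: x) - 1) <= e].

(** Invertibility is an open condition, with a locally uniform bound: one approximate inverse at z
    still has error at most 1/2 at every z' close to z, and can be refined from there. *)
Lemma near_inv_approx_resolvent z : near_inv N (1 - z *: x) ->
  exists M d, 0 < d /\ forall z', normc (z' - z) < d -> approx_resolvent M z'.
Proof.
move=> /(near_inv_refine sN)[_ _ /(_ (1/4))[|b [_ xb bx]]]; first by lra.
have D0 : 0 < 4 * (N x * N b + 1) by rewrite mulr_gt0// ltr_wpDl// mulr_ge0.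
exists (N b / (1 - 1 / 2)), (4 * (N x * N b + 1))^-1; split; first by rewrite invr_gt0.
move=> z' zz' e e0.
have zz : normc (z' - z) * (N x * N b) <= 1 / 4.
  have := ltW zz'; rewrite -(ler_pM2r D0) mulVf ?gt_eqF//.
  have := normc_ge0 (z' - z); nra.
apply: (@refine _ _ _ sN b b _ (1 / 2)) e0; last by lra.
- have -> : b * (1 - z' *: x) - 1 = (b * (1 - z *: x) - 1) - (z' - z) *: (b * x).
    rewrite !mulrBr !mulr1 -!scalerAr scalerBl opprB.
    by rewrite [in RHS]addrAC [b - _ + _]addrC subrKA [in RHS]addrC.
  apply: le_trans (snB sN _ _) _.
  have -> : 1 / 2 = 1 / 4 + 1 / 4 :> R by lra.
  apply: lerD => //; apply: le_trans zz.
  by rewrite (snZ sN) ler_wpM2l ?normc_ge0// mulrC; exact: (snM sN).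
- have -> : (1 - z' *: x) * b - 1 = ((1 - z *: x) * b - 1) - (z' - z) *: (x * b).
    rewrite !mulrBl !mul1r -!scalerAl scalerBl opprB.
    by rewrite [in RHS]addrAC [b - _ + _]addrC subrKA [in RHS]addrC.
  apply: le_trans (snB sN _ _) _.
  have -> : 1 / 2 = 1 / 4 + 1 / 4 :> R by lra.
  apply: lerD => //; apply: le_trans zz.
  by rewrite (snZ sN) ler_wpM2l ?normc_ge0//; exact: (snM sN).
Qed.

Lemma normc_le_abs (u v : R) : normc (Complex u v) <= `|u| + `|v|.
Proof.
have -> : Complex u v = u%:C%C + 'i%C * v%:C%C by simpc.
apply: le_trans (le_normcD _ _) _.
by rewrite Normc.normcM !normc_real [normc 'i%C]/Normc.normc /= expr0n expr1n add0r sqrtr1 mul1r.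
Qed.

Lemma abs_le_normc (z : R[i]) : `|complex.Re z| <= normc z /\ `|complex.Im z| <= normc z.
Proof.
case: z => u v; rewrite -!sqrtr_sqr /Normc.normc /=; split; rewrite ler_wsqrtr//.
  by rewrite lerDl sqr_ge0.
by rewrite lerDr sqr_ge0.
Qed.

(** Compactness of the disc of radius r. It is run on a square in the plane, with the bound M as a
    parameter tending to infinity; points outside the disc have a neighbourhood that misses it,
    where nothing is claimed. *)
Lemma approx_resolvent_uniform (r : R) :
  (forall z, normc z <= r -> near_inv N (1 - z *: x)) ->
  exists M, forall z, normc z <= r -> approx_resolvent M z.
Proof.
move=> Hr; pose K : set (R * R) := `[- r, r] `*` `[- r, r].
have /compact_near_coveringP cK : compact K.
  by apply: compact_setX; exact: segment_compact.
pose P (M : R) (u : R * R) := normc (Complex u.1 u.2) <= r ->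
  approx_resolvent M (Complex u.1 u.2).
have dist (u v : R * R) d : ball u (d / 2) v ->
    normc (Complex v.1 v.2 - Complex u.1 u.2) < d.
  move=> [h1 h2]; rewrite (_ : _ - _ = Complex (v.1 - u.1) (v.2 - u.2)); last by simpc.
  apply: le_lt_trans (normc_le_abs _ _) _; rewrite [d]splitr.
  by apply: ltrD; rewrite distrC.
have := cK R +oo P _ _; case.
  move=> u Ku; pose z := Complex u.1 u.2.
  have [zr|rz] := lerP (normc z) r.
    have [M [d [d0 Hd]]] := near_inv_approx_resolvent (Hr _ zr).
    exists (ball u (d / 2), [set M' | M < M']) => /=.
      split; first by apply: nbhsx_ballx; rewrite divr_gt0.
      by exists M; split => //; exact: num_real.
    move=> [v M'] [/= uv MM'] _ e e0.
    have [b [bM xb bx]] := Hd _ (dist _ _ _ uv) e e0.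
    by exists b; split => //; exact: le_trans (ltW MM').
  exists (ball u ((normc z - r) / 2), [set: R]) => /=.
    split; first by apply: nbhsx_ballx; rewrite divr_gt0 ?subr_gt0.
    exact: filterT.
  move=> [v M'] [/= uv _] vr; exfalso.
  have zv := dist _ _ _ uv.
  have := le_normcD (Complex v.1 v.2) (- (Complex v.1 v.2 - z)).
  by rewrite normcN opprB addrCA subrr addr0; move: vr zv rz; rewrite /z; lra.
(* The neighbourhood of infinity consists of the numbers strictly greater than M. *)
move=> M [_ HM]; exists (M + 1) => z zr.
have [h1 h2] := abs_le_normc z.
have := HM (M + 1) _ (complex.Re z, complex.Im z).
rewrite ltrDl ltr01 => /(_ isT); rewrite /P /=; case: z zr h1 h2 => u v /= zr h1 h2.
apply => //; split; rewrite /= in_itv/= -ler_norml; exact: le_trans zr.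
Qed.

Lemma sn_average n (F : 'I_n -> E) (K : R) : (0 < n)%N -> (forall j, N (F j) <= K) ->
  N ((n%:R : R[i])^-1 *: \sum_j F j) <= K.
Proof.
move=> n0 FK; have nn0 : (0 : R) < n%:R by rewrite ltr0n.
rewrite (snZ sN) Normc.normcV -[n%:R](rmorph_nat (real_complex R)) normc_real normr_nat.
rewrite mulrC ler_pdivrMr//; apply: le_trans (sn_sum sN _ _ _) _.
apply: le_trans (ler_sum _ (fun j _ => FK j)) _.
by rewrite sumr_const card_ord mulr_natr.
Qed.

(** With u_j = w^j s x, all u_j^n equal s^n x^n, and 1 - u_j^n = (1 - u_j) (1 + u_j + ... +
    u_j^(n-1)). By orthogonality of roots of unity the average over j of these geometric sums is 1,
    so the error is the average of (b_j (1 - u_j) - 1) times a geometric sum. *)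
Lemma averaged_inverse n (w : R[i]) (s k : R) (b : 'I_n -> E) :
  n.-primitive_root w -> 0 <= s ->
  (forall j, N (b j * (1 - (w ^+ j * s%:C%C) *: x) - 1) <= k) ->
  N ((n%:R : R[i])^-1 *: (\sum_j b j) * (1 - (s ^+ n)%:C%C *: x ^+ n) - 1)
    <= k * \sum_(i < n) s ^+ i * N (x ^+ i).
Proof.
move=> pw s0 bk; have n0 := prim_order_gt0 pw.
have nn0C : (n%:R : R[i]) != 0 by rewrite pnatr_eq0 -lt0n.
pose u (j : 'I_n) := (w ^+ j * s%:C%C) *: x.
have un j : u j ^+ n = (s ^+ n)%:C%C *: x ^+ n.
  rewrite exprZn exprMn exprAC (prim_expr_order pw) expr1n mul1r.
  by rewrite -rmorphXn.
have avg1 : (n%:R : R[i])^-1 *: \sum_j \sum_(i < n) u j ^+ i = 1.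
  rewrite exchange_big /= (bigD1 (Ordinal n0))//= [X in _ + X]big1 ?addr0.
    rewrite (eq_bigr (fun=> 1)) => [|j _]; last exact: expr0.
    by rewrite sumr_const card_ord -[X in _ *: X]scaler_nat scalerA mulVf// scale1r.
  move=> i i0; under eq_bigr => j _ do rewrite exprZn exprMn mulrC -scalerA.
  rewrite -scaler_sumr -scaler_suml (primitive_root_sum pw) ?scale0r ?scaler0//.
  by rewrite lt0n ltn_ord andbT.
rewrite -[X in _ - X]avg1 -scalerAl -scalerBr mulr_suml -sumrB.
apply: sn_average => // j.
rewrite -(un j) -(geom_r (u j)) mulrA -[X in N (_ - X)]mul1r -mulrBl.
apply: le_trans (snM sN _ _) _; apply: ler_pM => //.
apply: le_trans (sn_sum sN _ _ _) _; apply: ler_sum => i _.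
rewrite exprZn (snZ sN) normcX Normc.normcM normcX (primitive_root_normc pw).
by rewrite expr1n mul1r normc_real ger0_norm.
Qed.

Section averages.
Variables (r M : R).
Hypothesis HM : forall z, normc z <= r -> approx_resolvent M z.

(** With [w] a primitive [n]-th root of unity, the average over [j < n] of the
    resolvents [(1 - w^j s x)^-1] is [(1 - s^n x^n)^-1]; as a function of [s] it
    is Lipschitz with a constant that does not depend on [n]. *)
Lemma averaged_resolvent n (s s0 e : R) : (0 < n)%N -> 0 <= s <= r ->
  0 <= s0 <= r -> 0 < e -> exists g g0,
  [/\ N (g - g0) <= `|s - s0| * (M ^+ 2 * N x) + e, N g0 <= M,
      N (g * (1 - (s ^+ n)%:C%C *: x ^+ n) - 1) <= e &
      N (g0 * (1 - (s0 ^+ n)%:C%C *: x ^+ n) - 1) <= e].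
Proof.
move=> n0 /andP[s_ge0 sr] /andP[s0_ge0 s0r] e0.
have [w pw] := primitive_root_exists R n0.
have wz j t : 0 <= t -> normc (w ^+ j * t%:C%C) = t.
  move=> t0; rewrite Normc.normcM normcX (primitive_root_normc pw) expr1n mul1r.
  by rewrite normc_real ger0_norm.
have M0 : 0 <= M.
  have := @HM 0; rewrite Normc.normc0 => /(_ (le_trans s_ge0 sr) 1 ltr01)[b [bM _ _]].
  exact: le_trans bM.
pose L (t : R) := \sum_(i < n) t ^+ i * N (x ^+ i).
have L0 t : 0 <= t -> 0 <= L t.
  by move=> t0; apply: sumr_ge0 => i _; rewrite mulr_ge0// exprn_ge0.
(* One precision k = e / D for the resolvents meets the three demands [kM], [kL] and [kL0]; the last
   summand keeps D positive. *)
pose D := 2 * M + L s + L s0 + 1.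
have Ls := L0 _ s_ge0; have Ls0 := L0 _ s0_ge0.
have D0 : 0 < D by rewrite /D; lra.
pose k := e / D.
have k0 : 0 < k by rewrite divr_gt0.
have kD : k * D = e by rewrite divfK// gt_eqF.
have kM : 2 * M * k <= e by rewrite -kD mulrC ler_wpM2l ?ltW// /D; lra.
have kL : k * L s <= e by rewrite -kD ler_wpM2l ?ltW// /D; lra.
have kL0 : k * L s0 <= e by rewrite -kD ler_wpM2l ?ltW// /D; lra.
have res t : 0 <= t <= r -> forall j : 'I_n, exists b,
    [/\ N b <= M, N ((1 - (w ^+ j * t%:C%C) *: x) * b - 1) <= k &
        N (b * (1 - (w ^+ j * t%:C%C) *: x) - 1) <= k].
  by move=> /andP[t0 tr] j; apply: HM k0; rewrite wz.
have [b Hb] := choice (res s (introT andP (conj s_ge0 sr))).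
have [b0 Hb0] := choice (res s0 (introT andP (conj s0_ge0 s0r))).
exists ((n%:R : R[i])^-1 *: \sum_j b j), ((n%:R : R[i])^-1 *: \sum_j b0 j); split.
- rewrite -scalerBr -sumrB; apply: sn_average => // j.
  have [bM _ bx] := Hb j; have [b0M xb0 _] := Hb0 j.
  set z := w ^+ j * s%:C%C in bx; set z0 := w ^+ j * s0%:C%C in xb0.
  (* The resolvent identity, with correction terms for inexact inverses. *)
  have -> : b j - b0 j = (z - z0) *: (b j * x * b0 j)
      - b j * ((1 - z0 *: x) * b0 j - 1) + (b j * (1 - z *: x) - 1) * b0 j.
    have -> : (z - z0) *: (b j * x * b0 j) =
        b j * (1 - z0 *: x) * b0 j - b j * (1 - z *: x) * b0 j.
      rewrite -[RHS]mulrBl -[in RHS]mulrBr opprB [1 - _ + _]addrC subrKA -scalerBl.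
      by rewrite -scalerAr -scalerAl.
    rewrite [b j * (_ - 1)]mulrBr [(_ - 1) * b0 j]mulrBl mulr1 mul1r !mulrA opprB.
    by rewrite [X in _ = X + _]addrC !subrKA.
  have nb : 2 * M * k = M * k + k * M by ring.
  apply: le_trans (snD sN _ _) _; apply: le_trans (lerD (snB sN _ _) (lexx _)) _.
  rewrite -addrA; apply: lerD; last first.
    apply: le_trans kM; rewrite nb; apply: lerD; apply: le_trans (snM sN _ _) _.
      exact: ler_pM.
    exact: ler_pM.
  rewrite (snZ sN) -mulrBr Normc.normcM normcX (primitive_root_normc pw) expr1n.
  rewrite mul1r -rmorphB normc_real ler_wpM2l//.
  apply: le_trans (snM sN _ _) _; rewrite expr2 -mulrA [M * N x]mulrC mulrA.
  apply: ler_pM => //; apply: le_trans (snM sN _ _) _; exact: ler_wpM2r.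
- by apply: sn_average => // j; have [] := Hb0 j.
- apply: le_trans kL; apply: (averaged_inverse pw) => // j; by have [] := Hb j.
- apply: le_trans kL0; apply: (averaged_inverse pw) => // j; by have [] := Hb0 j.
Qed.

Let vanishes (s : R) := forall e : R, 0 < e ->
  exists n0, forall n, (n0 <= n)%N -> s ^+ n * N (x ^+ n) <= e.

(** If s0^n x^n is small, the averaged resolvent g0 at s0 is within 3/16 of 1. The Lipschitz bound
    is uniform in n, so the one at s, g, is within 1/2 of 1. Being nearly inverse to 1 - s^n x^n, it
    keeps this element bounded. *)
Lemma vanishes_step (s0 s : R) : 0 <= s0 <= r -> 0 <= s <= r ->
  `|s - s0| * (M ^+ 2 * N x) <= 1 / 8 -> vanishes s0 ->
  exists C, forall n, s ^+ n * N (x ^+ n) <= C.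
Proof.
move=> s0r sr ss0 v0.
have s_ge0 : 0 <= s by case/andP: sr.
have s0_ge0 : 0 <= s0 by case/andP: s0r.
have M1 : 0 < `|M| + 1 by rewrite ltr_wpDl.
have [|n0 Hn0] := v0 ((1 / 8) / (`|M| + 1)); first by rewrite divr_gt0//; lra.
(* The sum covers the exponents up to n0. Beyond, [y1] gives N (1 - y) <= 2 N 1 + 1/8, hence N y <=
   3 N 1 + 1/8. *)
exists (3 * N 1 + 2 + \sum_(i < n0.+1) s ^+ i * N (x ^+ i)) => n.
have S0 (I : finType) (F : I -> R) : (forall i, 0 <= F i) -> 0 <= \sum_i F i.
  by move=> F0; apply: sumr_ge0 => i _; exact: F0.
have sN0 k : 0 <= s ^+ k * N (x ^+ k) by rewrite mulr_ge0// exprn_ge0.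
have [nn0|nn0] := ltnP n n0.+1.
  rewrite (bigD1 (Ordinal nn0))//=.
  have := @sumr_ge0 R _ (index_enum _) (fun i : 'I_n0.+1 => i != Ordinal nn0)
    (fun i : 'I_n0.+1 => s ^+ i * N (x ^+ i)) (fun i _ => sN0 i).
  by have := N_ge0 1; have := sN0 n; lra.
apply: (@le_trans _ _ (3 * N 1 + 2)); last by rewrite lerDl S0.
have e0 : (0 : R) < 1 / 16 by lra.
have n_gt0 : (0 < n)%N by exact: leq_ltn_trans nn0.
have [g [g0 [gg0 g0M gs g0s]]] := averaged_resolvent n_gt0 sr s0r e0.
have Mk : N (g0 * ((s0 ^+ n)%:C%C *: x ^+ n)) <= 1 / 8.
  rewrite -scalerAr (snZ sN) normc_real ger0_norm ?exprn_ge0//.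
  apply: (@le_trans _ _ ((`|M| + 1) * (s0 ^+ n * N (x ^+ n)))).
    rewrite mulrCA ler_wpM2l ?exprn_ge0//; apply: le_trans (snM sN _ _) _.
    rewrite ler_wpM2r//; apply: le_trans g0M _; apply: le_trans (ler_norm _) _.
    by rewrite lerDl.
  by rewrite mulrC -ler_pdivlMr//; apply: Hn0; exact: ltnW.
have g01 : N (g0 - 1) <= 1 / 8 + 1 / 16.
  have -> : g0 - 1 = g0 * ((s0 ^+ n)%:C%C *: x ^+ n)
      + (g0 * (1 - (s0 ^+ n)%:C%C *: x ^+ n) - 1).
    by rewrite mulrBr mulr1 addrA [_ + (g0 - _)]addrC subrK.
  by apply: le_trans (snD sN _ _) _; exact: lerD.
have g1 : N (1 - g) <= 1 / 2.
  rewrite (snBC sN); apply: le_trans (sn_trans sN g0 _ _) _; lra.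
set y := (s ^+ n)%:C%C *: x ^+ n in gs.
have Ny : N y = s ^+ n * N (x ^+ n).
  by rewrite (snZ sN) normc_real ger0_norm// exprn_ge0.
have y1 : N (1 - y) <= 1 / 2 * N (1 - y) + (N 1 + 1 / 16).
  have {1}-> : 1 - y = (1 - g) * (1 - y) + (1 + (g * (1 - y) - 1)).
    by rewrite [X in _ = _ + X]addrC subrK [in RHS]mulrBl mul1r subrK.
  apply: le_trans (snD sN _ _) _; apply: lerD.
    by apply: le_trans (snM sN _ _) _; rewrite ler_wpM2r.
  by apply: le_trans (snD sN _ _) _; exact: lerD.
rewrite -Ny; have -> : y = 1 - (1 - y) by rewrite opprB addrC subrK.
by apply: le_trans (snB sN _ _) _; lra.
Qed.

Lemma vanishes_lt (s s' C : R) : 0 <= s' < s -> (forall n, s ^+ n * N (x ^+ n) <= C) ->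
  vanishes s'.
Proof.
move=> /andP[s'0 s's] HC e e0; have s0 : 0 < s by exact: le_lt_trans s's.
have C1 : 0 < `|C| + 1 by rewrite ltr_wpDl.
have q01 : 0 <= s' / s < 1 by rewrite divr_ge0 ?(ltW s0)//= ltr_pdivrMr// mul1r.
have [n0 Hn0] := expr_lt_eps q01 (divr_gt0 e0 C1).
exists n0 => n n0n; have -> : s' ^+ n = (s' / s) ^+ n * s ^+ n.
  by rewrite exprMn exprVn divfK// expf_neq0// gt_eqF.
rewrite -mulrA; apply: (@le_trans _ _ (e / (`|C| + 1) * (`|C| + 1))).
  have /andP[q0 q1] := q01.
  apply: ler_pM; first exact: exprn_ge0.
  - by rewrite mulr_ge0// exprn_ge0// ltW.
  - apply: le_trans (ltW Hn0); rewrite -(subnKC n0n) exprD ler_piMr ?exprn_ge0//.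
    by rewrite exprn_ile1// ltW.
  - by apply: le_trans (HC n) _; apply: le_trans (ler_norm _) _; rewrite lerDl.
by rewrite divfK// gt_eqF.
Qed.

(** Boundedness spreads from 0 to r along a grid. A step of [vanishes_step] turns vanishing into
    mere boundedness, and vanishing is recovered at any smaller radius; so each stage jumps two grid
    points ahead and falls back one. *)
Lemma bounded_at_radius : 0 < r -> exists C, forall n, r ^+ n * N (x ^+ n) <= C.
Proof.
move=> r0; pose K := r * (M ^+ 2 * N x).
have K0 : 0 <= K by rewrite mulr_ge0 ?(ltW r0)// mulr_ge0// sqr_ge0.
(* Two grid steps of length r / m then cost 2 K / m <= 1/8, as [vanishes_step] requires. *)
have [m Hm] : exists m : nat, 16 * K + 1 < m%:R.
  by exists (Num.bound (16 * K + 1)); rewrite archi_boundP//; lra.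
have m0 : (0 : R) < m%:R by apply: le_lt_trans Hm; lra.
have rm0 : 0 <= r / m%:R by rewrite divr_ge0// ltW.
pose s k := k%:R * (r / m%:R).
have sk k : (k <= m)%N -> 0 <= s k <= r.
  move=> km; rewrite mulr_ge0//=; apply: (@le_trans _ _ (m%:R * (r / m%:R))).
    by rewrite ler_wpM2r// ler_nat.
  by rewrite mulrC divfK// gt_eqF.
have step k l : (k <= l <= k.+2)%N -> (l <= m)%N -> vanishes (s k) ->
    exists C, forall n, s l ^+ n * N (x ^+ n) <= C.
  move=> /andP[kl lk] lm; apply: vanishes_step; rewrite ?sk ?(leq_trans kl)//.
  rewrite /s -mulrBl normrM -natrB// normr_nat.
  have -> : `|r / m%:R| = r / m%:R by rewrite ger0_norm.
  have lk2 : ((l - k)%:R : R) <= 2 by rewrite ler_nat leq_subLR addn2.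
  have -> : (l - k)%:R * (r / m%:R) * (M ^+ 2 * N x) = (l - k)%:R * (K / m%:R).
    by rewrite /K; ring.
  apply: (@le_trans _ _ (2 * (K / m%:R))).
    by rewrite ler_wpM2r// divr_ge0// ltW.
  by rewrite mulrA ler_pdivrMr//; lra.
have van k : (k < m)%N -> vanishes (s k).
  elim: k => [_ e e0|k IH km].
    (* At radius 0 the powers vanish from exponent 1 on, since 0 ^+ 0 is 1. *)
    exists 1%N => -[//|n] _; rewrite /s mul0r expr0n/= mul0r; exact: ltW.
  have vk := IH (ltnW km).
  have [km2|km2] := leqP k.+2 m.
    have [|C HC] := step k k.+2 _ km2 vk; first by rewrite leqnn andbT ltnW.
    apply: vanishes_lt HC; rewrite (andP (sk _ (ltnW km))).1/= ltr_pM2r ?divr_gt0//.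
    by rewrite ltr_nat.
  by move: km; rewrite ltnNge -ltnS km2.
have m1 : (0 < m)%N by rewrite -(ltr_nat R).
have m1m : (m.-1 < m)%N by rewrite prednK.
have mm : (m.-1 <= m <= m.-1.+2)%N by rewrite leq_pred prednK// leqnSn.
have [C HC] := step m.-1 m mm (leqnn m) (van _ m1m).
have sm : s m = r by rewrite /s mulrC divfK// gt_eqF.
by exists C; rewrite -sm.
Qed.

End averages.

(** The hard half of Gelfand's spectral radius formula. *)
Lemma power_bounded_of_near_inv (t : R) : 0 < t ->
  (forall z, t <= normc z -> near_inv N (z%:A - x)) -> power_bounded N x t.
Proof.
move=> t0 Ht; have ti0 : 0 < t^-1 by rewrite invr_gt0.
have [z|M HM] := @approx_resolvent_uniform t^-1.
  have [-> _|z0 zt] := eqVneq z 0.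
    rewrite scale0r subr0; exists 1; rewrite mulr1 subrr (sn0 sN).
    by split; exact: ltr01.
  have -> : 1 - z *: x = z *: (z^-1%:A - x).
    by rewrite scalerBr scalerA mulfV// scale1r.
  apply: near_invZ => //; apply: Ht.
  by rewrite Normc.normcV -(invrK t) lef_pV2 ?posrE ?normc_gt0.
have [C HC] := bounded_at_radius HM ti0.
exists C => n; have := HC n; rewrite exprVn mulrC ler_pdivrMr ?exprn_gt0//.
Qed.

End rickart.

(** * Interpolation of seminorms *)

Section interpolation.
Variables (R : realType) (E : algType R[i]) (n1 n2 : E -> R).
Hypotheses (s1 : algebra_seminorm n1) (s2 : algebra_seminorm n2).
Hypothesis n21 : forall f, n2 f <= n1 f.
Let n1_ge0 f : 0 <= n1 f := sn_ge0 s1 f.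
Let n2_ge0 f : 0 <= n2 f := sn_ge0 s2 f.
Hint Resolve n1_ge0 n2_ge0 : core.

Lemma sub_add_scalar (x : E) (mu : R[i]) :
  (x - mu%:A) * (x + mu%:A) = x ^+ 2 - (mu ^+ 2)%:A.
Proof.
by rewrite mulrDr !mulrBl !mulr_algl mulr_algr subrKA scalerA -!expr2.
Qed.

Lemma powRX (a r : R) n : 0 <= a -> (a ^+ n) `^ r = (a `^ r) ^+ n.
Proof.
move=> a0; elim: n => [|n IH]; first by rewrite !expr0 powR1.
by rewrite !exprS powRM ?exprn_ge0// IH.
Qed.

Lemma powR_le_id (a r : R) : 1 <= a -> 0 <= r <= 1 -> a `^ r <= a.
Proof.
by move=> a1 /andP[r0 r1]; rewrite -[leRHS]powRr1 ?(le_trans ler01)// ler_powR.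
Qed.

(** Homogeneity and submultiplicativity pass from n1 and n2 to this mean, but the triangle
    inequality is lost in general. *)
Definition log_mean (th : R) f := n1 f `^ (1 - th) * n2 f `^ th.

(** The largest subadditive minorant of [log_mean th]: a real interpolation
    (J-method) norm between [n1] and [n2], built directly on the algebra. *)
Definition interpolated (th : R) f :=
  inf [set \sum_(g <- s) log_mean th g | s in [set s : seq E | \sum_(g <- s) g = f]].

Section theta.
Variable th : R.
Hypothesis th01 : 0 < th < 1.

Let th0 : 0 < th. Proof. by case/andP: th01. Qed.
Let th1 : 0 < 1 - th. Proof. by rewrite subr_gt0; case/andP: th01. Qed.

Lemma log_mean_ge0 f : 0 <= log_mean th f.
Proof. by rewrite mulr_ge0 ?powR_ge0. Qed.
Hint Resolve log_mean_ge0 : core.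

Lemma powR_split (a : R) : 0 <= a -> a `^ (1 - th) * a `^ th = a.
Proof.
rewrite le_eqVlt => /orP[/eqP<-|a0]; first by rewrite !powR0 ?gt_eqF// mulr0.
by rewrite -powRD ?(gt_eqF a0) ?implybT// subrK powRr1 ?ltW.
Qed.

Lemma log_meanM f g : log_mean th (f * g) <= log_mean th f * log_mean th g.
Proof.
rewrite /log_mean mulrACA -!powRM//; apply: ler_pM; rewrite ?powR_ge0//.
  by apply: ge0_ler_powR; rewrite ?nnegrE ?mulr_ge0 ?(ltW th1)//; exact: (snM s1).
by apply: ge0_ler_powR; rewrite ?nnegrE ?mulr_ge0 ?(ltW th0)//; exact: (snM s2).
Qed.

Lemma log_meanZ (z : R[i]) f : log_mean th (z *: f) = normc z * log_mean th f.
Proof.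
rewrite /log_mean (snZ s1) (snZ s2) !powRM ?normc_ge0// mulrACA powR_split//.
exact: normc_ge0.
Qed.

Lemma log_mean_le f : log_mean th f <= n1 f.
Proof.
rewrite -[leRHS]powR_split// ler_wpM2l ?powR_ge0//.
by apply: ge0_ler_powR; rewrite ?nnegrE ?(ltW th0).
Qed.

Lemma sum_log_mean_ge0 (s : seq E) : 0 <= \sum_(g <- s) log_mean th g.
Proof. exact: sumr_ge0. Qed.
Hint Resolve sum_log_mean_ge0 : core.

Lemma interpolated_le_sum (s : seq E) :
  interpolated th (\sum_(g <- s) g) <= \sum_(g <- s) log_mean th g.
Proof.
apply: ge_inf; last by exists s.
by exists 0 => _ [s' _ <-].
Qed.

Lemma interpolated_decomposition f e : 0 < e -> exists s : seq E,
  \sum_(g <- s) g = f /\ \sum_(g <- s) log_mean th g < interpolated th f + e.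
Proof.
move=> e0.
have hinf : has_inf [set \sum_(g <- s) log_mean th g |
    s in [set s : seq E | \sum_(g <- s) g = f]].
  split; last by exists 0 => _ [s' _ <-].
  by exists (\sum_(g <- [:: f]) log_mean th g), [:: f] => //=; rewrite big_seq1.
by have [_ [s <- <-] ?] := inf_adherent e0 hinf; exists s.
Qed.

Lemma interpolated_le_log_mean f : interpolated th f <= log_mean th f.
Proof. by have := interpolated_le_sum [:: f]; rewrite !big_seq1. Qed.

Lemma interpolated_le f : interpolated th f <= n1 f.
Proof. exact: le_trans (interpolated_le_log_mean f) (log_mean_le f). Qed.

Lemma interpolated_ge0 f : 0 <= interpolated th f.
Proof.
apply: lb_le_inf; last by move=> _ [s _ <-].
by exists (\sum_(g <- [:: f]) log_mean th g), [:: f] => //=; rewrite big_seq1.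
Qed.

Lemma interpolatedD f g :
  interpolated th (f + g) <= interpolated th f + interpolated th g.
Proof.
apply/ler_addgt0Pr => e e0; have e2 : 0 < e / 2 by rewrite divr_gt0.
have [s [fE sf]] := interpolated_decomposition f e2.
have [t [gE tg]] := interpolated_decomposition g e2.
have := interpolated_le_sum (s ++ t); rewrite !big_cat /= fE gE.
by move/le_trans; apply; lra.
Qed.

Lemma interpolatedZ_le (z : R[i]) f :
  interpolated th (z *: f) <= normc z * interpolated th f.
Proof.
apply/ler_addgt0Pr => e e0.
have z1 : 0 < normc z + 1 by rewrite ltr_wpDl ?normc_ge0.
have [s [fE sf]] := interpolated_decomposition f (divr_gt0 e0 z1).
have := interpolated_le_sum [seq z *: g | g <- s].
rewrite !big_map -scaler_sumr fE; under eq_bigr do rewrite log_meanZ.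
move/le_trans; apply; rewrite -mulr_sumr.
apply: le_trans (ler_wpM2l (normc_ge0 z) (ltW sf)) _.
rewrite mulrDr lerD2l mulrCA ler_piMr ?(ltW e0)// ler_pdivrMr// mul1r lerDl.
exact: ler01.
Qed.

(** The products of the pieces of two decompositions form a decomposition of the product. *)
Lemma interpolatedM f g :
  interpolated th (f * g) <= interpolated th f * interpolated th g.
Proof.
apply/ler_addgt0Pr => e e0.
have if0 := interpolated_ge0 f; have ig0 := interpolated_ge0 g.
set a := interpolated th f in if0 *; set b := interpolated th g in ig0 *.
(* With d <= 1, (a + d) (b + d) <= a b + d (a + b + 1) <= a b + e. *)
pose d := Num.min 1 (e / (a + b + 1)).
have ab1 : 0 < a + b + 1 by lra.
have d0 : 0 < d by rewrite lt_min ltr01 divr_gt0.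
have d1 : d <= 1 by rewrite ge_min lexx.
have de : d * (a + b + 1) <= e by rewrite -ler_pdivlMr// ge_min lexx orbT.
have [s [fE sf]] := interpolated_decomposition f d0.
have [t [gE tg]] := interpolated_decomposition g d0.
have := interpolated_le_sum [seq u * v | u <- s, v <- t].
rewrite !big_allpairs_dep /=.
under eq_bigr do rewrite -mulr_sumr gE; rewrite -mulr_suml fE.
move/le_trans; apply; apply: (@le_trans _ _ ((a + d) * (b + d))); last by nra.
apply: (@le_trans _ _ ((\sum_(u <- s) log_mean th u) * (\sum_(v <- t) log_mean th v))).
  rewrite mulr_suml; apply: ler_sum => u _; rewrite mulr_sumr.
  by apply: ler_sum => v _; exact: log_meanM.
by apply: ler_pM => //; exact: ltW.
Qed.

Lemma interpolated_seminorm : algebra_seminorm (interpolated th).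
Proof.
split; [exact: interpolatedD| |exact: interpolatedM].
move=> z f; apply/eqP; rewrite eq_le interpolatedZ_le /=.
have [->|z0] := eqVneq z 0.
  by rewrite Normc.normc0 mul0r interpolated_ge0.
have nz : 0 < normc z by rewrite normc_gt0.
have := interpolatedZ_le z^-1 (z *: f).
by rewrite scalerA mulVf// scale1r Normc.normcV ler_pdivlMl.
Qed.

(** For t > 1, the mean of q^n is at most a constant times t^n k^n, where k < 1 comes from n2.
    Taking t close to 1 gives decay, so a power of q is small and the finite geometric sum inverts 1
    - q. *)
Lemma near_inv_interpolated (q : E) : (forall t, 1 < t -> power_bounded n1 q t) ->
  n2 q < 1 -> near_inv (interpolated th) (1 - q).
Proof.
move=> q1 q2; pose k := n2 q `^ th.
have k0 : 0 <= k by exact: powR_ge0.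
have k1 : k < 1.
  have <- : 1 `^ th = 1 :> R by rewrite powR1.
  by apply: gt0_ltr_powR; rewrite ?nnegrE.
(* Any t with t > 1 and t k < 1 would do. *)
pose t := 2 / (1 + k).
have k1p : 0 < 1 + k by lra.
have t1 : 1 < t by rewrite ltr_pdivlMr//; lra.
have tk1 : t * k < 1 by rewrite mulrAC ltr_pdivrMr//; lra.
have [C HC] := q1 t t1.
have t0 : 0 <= t by lra.
have C0 : 0 < `|C| + 1 by rewrite ltr_wpDl.
have tk01 : 0 <= t * k < 1 by rewrite tk1 mulr_ge0.
have [n Hn] : exists n, (t * k) ^+ n.+1 < (`|C| + 1)^-1.
  have [n Hn] := expr_lt_eps tk01 (etrans (invr_gt0 _) C0); exists n.
  have /andP[tk0 _] := tk01.
  by apply: le_lt_trans Hn; rewrite exprS ler_piMl ?(ltW tk1)// exprn_ge0.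
apply: (near_inv_1sub (n := n.+1) interpolated_seminorm).
apply: le_lt_trans (interpolated_le_log_mean _) _.
rewrite -(ltr_pM2l C0) mulfV ?gt_eqF// in Hn; apply: le_lt_trans Hn.
rewrite exprMn mulrA /log_mean; apply: ler_pM; rewrite ?powR_ge0//.
  (* The constant is enlarged to at least 1, so that the base is at least 1 and raising it to the
     power 1 - th does not increase it. *)
  apply: (@le_trans _ _ (((`|C| + 1) * t ^+ n.+1) `^ (1 - th))).
    have Ct0 : 0 <= (`|C| + 1) * t ^+ n.+1 by rewrite mulr_ge0 ?exprn_ge0// ltW.
    apply: ge0_ler_powR; rewrite ?nnegrE ?(ltW th1)//.
    apply: le_trans (HC _) _; rewrite ler_wpM2r ?exprn_ge0//.
    by apply: le_trans (ler_norm _) _; rewrite lerDl.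
  apply: powR_le_id; last by rewrite ltW//= gerBl ltW.
  by rewrite -[leLHS]mulr1; apply: ler_pM => //; rewrite ?lerDr// exprn_ege1// ltW.
rewrite /k -powRX//; apply: ge0_ler_powR; rewrite ?nnegrE ?exprn_ge0// ?(ltW th0)//.
exact: (sn_expr s2).
Qed.

End theta.

(** The proof fixes [th], shows that the spectral radius of [a] for
    [interpolated th] is at most [n2 a], and lets [th] tend to 0. *)
Lemma near_inv_of_real_spectrum (a : E) (K : R) : 1 <= K ->
  (forall z : R[i], z \isn't Num.real -> near_inv n1 (z%:A - a)) ->
  (forall z eta : R, n2 a < `|z| -> 0 < eta -> eta * (`|z| + n1 a) ^+ 2 <= 1 ->
    n2 (1 - eta%:C%C *: (z%:C%C%:A - a) ^+ 2) < 1) ->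
  (forall th n, 0 < th < 1 -> n1 (a ^+ n) <= (K `^ th) ^+ n * interpolated th (a ^+ n)) ->
  forall z : R[i], n2 a < normc z -> near_inv n1 (z%:A - a).
Proof.
move=> K1 Hnr Hq Hsupp.
have pbq (z eta : R) : 0 < eta -> eta * (`|z| + n1 a) ^+ 2 <= 1 ->
    forall t, 1 < t -> power_bounded n1 (1 - eta%:C%C *: (z%:C%C%:A - a) ^+ 2) t.
  move=> eta0 etaz t t1; apply: (power_bounded_of_near_inv s1); first by lra.
  move=> w tw; pose mu := sqrtC ((1 - w) / eta%:C%C).
  have etaC0 : eta%:C%C != 0 by rewrite realC_eq0 gt_eqF.
  have mu2 : mu ^+ 2 * eta%:C%C = 1 - w by rewrite sqrtCK divfK.
  (* Spectral mapping by hand: w - q = eta ((z - a)^2 - mu^2) splits into linear factors in a. If mu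
     is not real, both factors have nonreal scalars. *)
  have -> : w%:A - (1 - eta%:C%C *: (z%:C%C%:A - a) ^+ 2) =
      eta%:C%C *: (((z%:C%C - mu)%:A - a) * ((z%:C%C + mu)%:A - a)).
    rewrite [(z%:C%C - mu)%:A]scalerBl [(z%:C%C + mu)%:A]scalerDl.
    rewrite [_ - mu%:A - a]addrAC [_ + mu%:A - a]addrAC; set A := _ - a.
    rewrite sub_add_scalar scalerBr scalerA [eta%:C%C * _]mulrC mu2 scalerBl scale1r.
    by rewrite !opprB addrCA addrA.
  apply: near_invZ => //.
  have [mur|munr] := boolP (mu \is Num.real); last first.
    have zr : z%:C%C \is Num.real by rewrite complex_real.
    apply: (near_inv_mul s1); apply: Hnr; apply: contra munr => h.
      by rewrite -[mu](subKr z%:C%C) rpredB.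
    by rewrite -[mu](addKr z%:C%C) rpredD ?rpredN.
  have [m mE] := complex_realP _ mur.
  have wE : w = (1 - m ^+ 2 * eta)%:C%C.
    have -> : (1 - m ^+ 2 * eta)%:C%C = 1 - mu ^+ 2 * eta%:C%C.
      by rewrite mE rmorphB /= rmorphM /= rmorphXn /= rmorph1.
    by rewrite mu2 subKr.
  (* For real mu, w is real and at most 1, so that |w| > 1 forces w < -1. Hence |mu| exceeds |z| +
     n1 a, and z - mu and z + mu lie beyond the norm n1 a. *)
  have m2 : 2 < m ^+ 2 * eta.
    have := lt_le_trans t1 tw; rewrite wE normc_real ltr_normr => /orP[|]; last by lra.
    have : 0 <= m ^+ 2 * eta by rewrite mulr_ge0 ?sqr_ge0// ltW.
    by lra.
  have bm : `|z| + n1 a < `|m|.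
    rewrite -(@ltr_pXn2r _ 2) ?nnegrE ?addr_ge0// -normrX [Num.norm (m ^+ 2)]ger0_norm ?sqr_ge0//.
    rewrite -(ltr_pM2r eta0).
    rewrite [ltLHS]mulrC; apply: le_lt_trans etaz _.
    by apply: lt_trans m2; lra.
  have := ler_normB m z; have := ler_normD z m; have := ler_normD (z + m) (- z).
  have := ler_normB (z - m) z; rewrite addrAC subrr add0r normrN [z + m - z]addrAC subrr add0r normrN.
  move=> h1 h2 h3 h4.
  apply: (near_inv_mul s1); apply: (near_inv_gt_norm s1); rewrite mE.
    by rewrite -rmorphB normc_real; lra.
  by rewrite -rmorphD normc_real; lra.
have nearN th z : 0 < th < 1 -> n2 a < `|z| -> near_inv (interpolated th) (z%:C%C%:A - a).
  move=> th01 az; pose D := (`|z| + n1 a) ^+ 2 + 1.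
  have D0 : 0 < D by rewrite ltr_wpDl ?sqr_ge0.
  have eta0 : 0 < D^-1 by rewrite invr_gt0.
  have etaD : D^-1 * (`|z| + n1 a) ^+ 2 <= 1.
    by rewrite ler_pdivrMl// mulr1 lerDl.
  have := near_inv_interpolated th01 (pbq _ _ eta0 etaD) (Hq _ _ az eta0 etaD).
  rewrite opprB addrC subrK => h.
  have etaC0 : (D^-1)%:C%C != 0 :> R[i] by rewrite realC_eq0 gt_eqF.
  have {}h : near_inv (interpolated th) ((z%:C%C%:A - a) ^+ 2).
    by have := near_invZ (invr_neq0 etaC0) h; rewrite scalerA mulVf// scale1r.
  by apply: (near_inv_mul_cancel (interpolated_seminorm th01) (y := z%:C%C%:A - a)).
move=> z az.
have n2a0 : 0 <= n2 a by [].
pose t := (n2 a + normc z) / 2.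
have at_ : n2 a < t by rewrite ltr_pdivlMr//; lra.
have tz : t < normc z by rewrite ltr_pdivrMr//; lra.
have t0 : 0 < t by exact: le_lt_trans at_.
(* th = 1 / (n + 2), where (t / |z|)^n < 1 / K; the shift by 2 keeps th strictly below 1 even for n
   = 0. *)
have [th th01 Kth] : exists2 th, 0 < th < 1 & K `^ th * t < normc z.
  have r01 : 0 <= t / normc z < 1.
    by rewrite divr_ge0 ?normc_ge0 ?(ltW t0)//= ltr_pdivrMr ?mul1r// (lt_trans t0).
  have K0 : 0 < K by lra.
  have [n Hn] := expr_lt_eps r01 (etrans (invr_gt0 _) K0).
  exists (n.+2%:R^-1); first by rewrite invr_gt0 ltr0n invf_lt1 ?ltr1n ?ltr0n.
  rewrite -ltr_pdivlMr// -(@ltr_pXn2r _ n.+2) ?nnegrE ?powR_ge0//; last first.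
    by rewrite divr_ge0 ?normc_ge0 ?(ltW t0).
  rewrite -powR_mulrn ?powR_ge0// -powRrM mulVf ?pnatr_eq0// powRr1 ?(ltW K0)//.
  rewrite -[ltLHS]invrK -[normc z / t]invrK invf_div exprVn ltf_pV2 ?posrE ?invr_gt0//.
    apply: le_lt_trans Hn; have /andP[r0 r1] := r01.
    by rewrite -addn2 exprD ler_piMr ?exprn_ge0// exprn_ile1// ltW.
  by rewrite exprn_gt0// divr_gt0// (lt_trans t0).
have pbN : power_bounded (interpolated th) a t.
  apply: (power_bounded_of_near_inv (interpolated_seminorm th01) t0) => w tw.
  have [wr|wnr] := boolP (w \is Num.real); last first.
    by apply: near_inv_le (Hnr _ wnr) => f; exact: interpolated_le.
  have [v vE] := complex_realP _ wr; rewrite vE; apply: nearN => //.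
  by move: tw; rewrite vE normc_real; exact: lt_le_trans.
have [C HC] := pbN.
apply: (power_bounded_near_inv s1 _ _ Kth); last by rewrite mulr_ge0 ?powR_ge0// ltW.
exists C => n; apply: le_trans (Hsupp th n th01) _.
by rewrite exprMn mulrCA ler_wpM2l// exprn_ge0// powR_ge0.
Qed.

End interpolation.

(** * Convexity of real powers *)

Section powR_facts.
Variable R : realType.
Implicit Types a m r : R.

(** The graph of the r-th power lies above its tangent at m; this is Young's inequality for a and
    m^(r-1). *)
Lemma powR_tangent a m r : 0 <= a -> 0 <= m -> 1 <= r ->
  r * (a * m `^ (r - 1)) <= a `^ r + (r - 1) * m `^ r.
Proof.
move=> a0 m0; rewrite le_eqVlt => /orP[/eqP<-|r1].
  by rewrite subrr mul0r addr0 powRr0 mulr1 mul1r powRr1.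
have r0 : 0 < r by lra.
have r10 : 0 < r - 1 by lra.
have q0 : 0 < r / (r - 1) by rewrite divr_gt0.
have rq : r^-1 + (r / (r - 1))^-1 = 1.
  by rewrite invf_div; field; rewrite !gt_eqF.
have := conjugate_powR a0 (powR_ge0 m (r - 1)) r0 q0 rq.
rewrite -powRrM mulrCA mulfV ?gt_eqF// mulr1.
rewrite -(ler_pM2l r0) => /le_trans; apply.
rewrite le_eqVlt; apply/orP; left; apply/eqP.
by rewrite invf_div mulrDr; field; rewrite gt_eqF.
Qed.

(** Jensen's inequality, by summing the tangent bound at the mean m = S / W. The weights may add up
    to less than W, which is the situation in the Schur test. *)
Lemma powR_jensen (I : eqType) (s : seq I) (w g : I -> R) (W r : R) :
  1 <= r -> 0 < W -> (forall i, 0 <= w i) -> (forall i, 0 <= g i) ->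
  \sum_(i <- s) w i <= W ->
  (\sum_(i <- s) w i * g i) `^ r <= W `^ (r - 1) * \sum_(i <- s) w i * g i `^ r.
Proof.
move=> r1 W0 w0 g0 wW; set S := \sum_(i <- s) w i * g i.
have S0 : 0 <= S by apply: sumr_ge0 => i _; rewrite mulr_ge0.
pose m := S / W.
have m0 : 0 <= m by rewrite divr_ge0// ltW.
have SE : S = W * m by rewrite mulrC divfK// gt_eqF.
have mr : m * m `^ (r - 1) = m `^ r.
  have [->|mN0] := eqVneq m 0; first by rewrite mul0r powR0// gt_eqF//; lra.
  by rewrite -[X in X * _]powRr1// -powRD ?mN0 ?implybT// addrC subrK.
have key : W * m `^ r <= \sum_(i <- s) w i * g i `^ r.
  have : \sum_(i <- s) w i * (r * (g i * m `^ (r - 1))) <=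
         \sum_(i <- s) w i * (g i `^ r + (r - 1) * m `^ r).
    by apply: ler_sum => i _; rewrite ler_wpM2l// powR_tangent.
  have -> : \sum_(i <- s) w i * (r * (g i * m `^ (r - 1))) = r * (W * m `^ r).
    rewrite -mr [W * _]mulrA -SE /S mulr_suml mulr_sumr.
    by apply: eq_bigr => i _; ring.
  under [leRHS]eq_bigr do rewrite mulrDr.
  rewrite big_split /= -mulr_suml => h.
  have : (\sum_(i <- s) w i) * ((r - 1) * m `^ r) <= W * ((r - 1) * m `^ r).
    by rewrite ler_wpM2r// mulr_ge0 ?powR_ge0// subr_ge0.
  by move: h; lra.
rewrite SE powRM ?(ltW W0)//.
have -> : W `^ r = W `^ (r - 1) * W.
  by rewrite -[X in _ * X]powRr1 ?(ltW W0)// -powRD ?(gt_eqF W0) ?implybT// subrK.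
by rewrite -mulrA ler_wpM2l// powR_ge0.
Qed.

End powR_facts.

(** * Finite and unordered sums *)

Section sums.
Variables (R : realType) (T : choiceType).
Implicit Types (X Y : {fset T}).

Lemma eq_fsum_support (V : nmodType) X Y (F : T -> V) :
  (forall i, i \notin X -> F i = 0) -> (forall i, i \notin Y -> F i = 0) ->
  \sum_(i <- X) F i = \sum_(i <- Y) F i.
Proof. by move=> FX FY; rewrite -(fsbigTE X)// -(fsbigTE Y). Qed.

Lemma fsum_restrict (V : nmodType) X Y (F : T -> V) : (forall i, i \notin X -> F i = 0) ->
  {subset X <= Y} -> \sum_(i <- Y) F i = \sum_(i <- X) F i.
Proof.
by move=> FX XY; apply: eq_fsum_support => // i iY; apply: FX; apply: contra iY; exact: XY.
Qed.

Lemma fsum_le X Y (F : T -> R) : (forall i, 0 <= F i) -> {subset X <= Y} ->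
  \sum_(i <- X) F i <= \sum_(i <- Y) F i.
Proof.
move=> F0 XY; rewrite [leRHS](bigID (mem X)) /= -[leLHS]addr0; apply: lerD.
  rewrite -[leRHS]big_filter [leRHS](perm_big (enum_fset X)) //.
  apply: uniq_perm; rewrite ?filter_uniq ?fset_uniq// => i; rewrite mem_filter.
  by case: (boolP (i \in X)) => [/XY ->|].
by apply: sumr_ge0.
Qed.

Lemma esum_leP (a : T -> R) (B : R) : (forall x, 0 <= a x) ->
  ((\esum_(x in [set: T]) (a x)%:E <= B%:E)%E <-> forall X, \sum_(x <- X) a x <= B).
Proof.
move=> a0; split=> [aB X|aB].
  rewrite -lee_fin -sumEFin; apply: le_trans aB; apply: ereal_sup_ubound.
  exists [set` X] => /=; first by split.
  by rewrite fsbig_finite// set_fsetK.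
apply: ge_ereal_sup => _ [A [fA _] <-].
by rewrite fsbig_finite// sumEFin lee_fin.
Qed.

Lemma esum_finite_support X (a : T -> R) : (forall x, 0 <= a x) ->
  (forall x, x \notin X -> a x = 0) ->
  (\esum_(x in [set: T]) (a x)%:E = (\sum_(x <- X) a x)%:E)%E.
Proof.
move=> a0 aX; rewrite (eq_esum (b := fun x => if x \in [set` X] then (a x)%:E else 0%E)).
  rewrite -esum_mkcond esum_fset//; last by move=> i _; rewrite lee_fin.
  by rewrite fsbig_finite// set_fsetK sumEFin.
by move=> x _; case: ifPn => //; rewrite notin_setE /= => /negP/aX ->.
Qed.

Lemma rsum_finite_support X (a : T -> R) : (forall x, x \notin X -> a x = 0) ->
  rsum a = \sum_(x <- X) a x.
Proof.
have pos (b : T -> R) : (forall x, x \notin X -> b x = 0) ->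
    fine (\esum_(x in [set: T]) (Num.max (b x) 0)%:E)%E = \sum_(x <- X) Num.max (b x) 0.
  move=> bX; rewrite (@esum_finite_support X)// => x; first by rewrite le_max lexx orbT.
  by move/bX ->; rewrite maxxx.
move=> aX; rewrite /rsum !pos//; last by move=> x /aX ->; rewrite oppr0.
rewrite -sumrB; apply: eq_bigr => x _.
by have [h|h] := lerP 0 (a x); rewrite ?(max_l h); case: (lerP (- a x) 0); lra.
Qed.

Lemma csum_finite_support X (a : T -> R[i]) : (forall x, x \notin X -> a x = 0) ->
  csum a = \sum_(x <- X) a x.
Proof.
move=> aX; rewrite /csum !(@rsum_finite_support X); try by move=> x /aX ->.
elim: (enum_fset X) => [|x s IH]; first by rewrite !big_nil.
by rewrite !big_cons -IH; case: (a x).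
Qed.

End sums.

Lemma sum_powR_normalized (R : realType) (I : Type) (s : seq I) (a : I -> R) (A r : R) :
  0 < A -> (forall i, 0 <= a i) -> \sum_(i <- s) a i `^ r <= A `^ r ->
  \sum_(i <- s) (a i / A) `^ r <= 1.
Proof.
move=> A0 a0 aA; have Ar : 0 < A `^ r by exact: powR_gt0.
rewrite -(ler_pM2r Ar) mul1r; apply: le_trans aA.
rewrite mulr_suml; apply: ler_sum => i _.
by rewrite -powRM ?divfK ?gt_eqF ?divr_ge0 ?(ltW A0).
Qed.

(** * The spaces [l^p] *)

Section lp_balls.
Variables (R : realType) (T : choiceType).
Implicit Types (X Y : {fset T}) (g h u : T -> R[i]) (p q : \bar R) (A B r : R).

(** Real upper bounds replace the norm itself, which takes extended real values and is infinite off
    l^p. *)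
Definition pball p g A := (lnorm p g <= A%:E)%E.

Lemma pball_finP r g A : 0 < r -> 0 <= A ->
  pball r%:E g A <-> forall X, \sum_(x <- X) normc (g x) `^ r <= A `^ r.
Proof.
move=> r0 A0; have pos x : 0 <= normc (g x) `^ r by exact: powR_ge0.
rewrite -(esum_leP _ pos) /pball /=; set S := (\esum_(x in _) _)%E.
have S0 : (0 <= S)%E by apply: esum_ge0 => x _; rewrite lee_fin.
have ri0 : 0 < r^-1 by rewrite invr_gt0.
case: S S0 => [s||//] s0; last by rewrite poweRyr ?gt_eqF// !leye_eq.
rewrite poweR_EFin !lee_fin; rewrite lee_fin in s0; split=> h.
  have : (s `^ r^-1) `^ r <= A `^ r.
    by apply: ge0_ler_powR; rewrite ?nnegrE ?powR_ge0// ltW.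
  by rewrite -powRrM mulVf ?gt_eqF// powRr1.
have : s `^ r^-1 <= (A `^ r) `^ r^-1.
  by apply: ge0_ler_powR; rewrite ?nnegrE ?powR_ge0// ltW.
by rewrite -powRrM mulfV ?gt_eqF// powRr1.
Qed.

Lemma pball_inftyP g A : pball +oo%E g A <-> forall x, normc (g x) <= A.
Proof.
split=> [h x|h]; last by apply: ge_ereal_sup => _ [x _ <-]; rewrite lee_fin.
by rewrite -lee_fin; apply: le_trans h; apply: ereal_sup_ubound; exists x.
Qed.

Lemma pball_le p g A B : A <= B -> pball p g A -> pball p g B.
Proof. by move=> AB /le_trans; apply; rewrite lee_fin. Qed.

Lemma pball_closed p g A : (forall e : R, 0 < e -> pball p g (A + e)) -> pball p g A.
Proof. by move=> h; apply/lee_addgt0Pr => e e0; rewrite -EFinD; exact: h. Qed.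

Section exponent.
Variable p : \bar R.
Hypothesis p1 : (1 <= p)%E.

Lemma exponent_cases : (exists2 r : R, 1 <= r & p = r%:E) \/ p = +oo%E.
Proof.
case: p p1 => [r|_|//]; last by right.
by rewrite lee_fin => r1; left; exists r.
Qed.

Lemma pball_dominated g h A : 0 <= A -> (forall x, normc (g x) <= normc (h x)) ->
  pball p h A -> pball p g A.
Proof.
move=> A0 gh; case: exponent_cases => [[r r1 ->]|->]; last first.
  by rewrite !pball_inftyP => hA x; exact: le_trans (hA x).
have r0 : 0 < r by lra.
rewrite !pball_finP// => hA X; apply: le_trans (hA X); apply: ler_sum => x _.
by apply: ge0_ler_powR; rewrite ?nnegrE ?normc_ge0// ltW.
Qed.

Lemma pball_pointwise g A x : 0 <= A -> pball p g A -> normc (g x) <= A.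
Proof.
move=> A0; case: exponent_cases => [[r r1 ->]|->]; last by rewrite pball_inftyP.
have r0 : 0 < r by lra.
rewrite pball_finP// => /(_ [fset x]%fset); rewrite big_seq_fset1 => h.
rewrite leNgt; apply/negP => xA; move: h; apply/negP; rewrite -ltNge.
by apply: gt0_ltr_powR; rewrite ?nnegrE ?normc_ge0.
Qed.

Lemma pballZ (a : R[i]) g A : 0 <= A -> pball p g A ->
  pball p (fun x => a * g x) (normc a * A).
Proof.
move=> A0; have aA0 : 0 <= normc a * A by rewrite mulr_ge0 ?normc_ge0.
case: exponent_cases => [[r r1 ->]|->]; last first.
  rewrite !pball_inftyP => hA x.
  by rewrite Normc.normcM ler_wpM2l ?normc_ge0.
have r0 : 0 < r by lra.
rewrite !pball_finP// => hA X.
under eq_bigr do rewrite Normc.normcM powRM ?normc_ge0//.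
by rewrite -mulr_sumr powRM ?normc_ge0// ler_wpM2l ?powR_ge0.
Qed.

(** Minkowski's inequality: g + h is A + B times a convex combination of g / A and h / B. Both
    bounds are first enlarged by e / 2, which makes them positive. *)
Lemma pballD g h A B : 0 <= A -> 0 <= B -> pball p g A -> pball p h B ->
  pball p (fun x => g x + h x) (A + B).
Proof.
move=> A0 B0 gA hB; case: exponent_cases gA hB => [[r r1 ->]|->]; last first.
  rewrite !pball_inftyP => gA hB x.
  by apply: le_trans (le_normcD _ _) _; exact: lerD.
have r0 : 0 < r by lra.
move=> gA hB; apply: pball_closed => e e0.
pose A' := A + e / 2; pose B' := B + e / 2.
have A'0 : 0 < A' by rewrite /A'; lra.
have B'0 : 0 < B' by rewrite /B'; lra.
have /(pball_finP _ r0 (ltW A'0)) {}gA : pball r%:E g A' by apply: pball_le gA; rewrite /A'; lra.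
have /(pball_finP _ r0 (ltW B'0)) {}hB : pball r%:E h B' by apply: pball_le hB; rewrite /B'; lra.
have -> : A + B + e = A' + B' by rewrite /A' /B'; lra.
have AB0 : 0 < A' + B' by lra.
apply/pball_finP => // [|X]; first exact: ltW.
have AB' : 0 < (A' + B') `^ r by exact: powR_gt0.
pose t := A' / (A' + B'); pose t' := B' / (A' + B').
have t0 : 0 <= t by rewrite divr_ge0// ltW.
have t'0 : 0 <= t' by rewrite divr_ge0// ltW.
have tt' : t + t' = 1 by rewrite /t /t' -mulrDl mulfV// gt_eqF.
have tA : (A' + B') * t = A' by rewrite mulrC divfK// gt_eqF.
have tB : (A' + B') * t' = B' by rewrite mulrC divfK// gt_eqF.
clearbody t t'.
have conv a b : 0 <= a -> 0 <= b -> (t * a + t' * b) `^ r <= t * a `^ r + t' * b `^ r.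
  move=> a0 b0; have := @powR_jensen R bool [:: true; false]
    (fun i => if i then t else t') (fun i => if i then a else b) 1 r r1 ltr01.
  rewrite !big_cons !big_nil !addr0 powR1 mul1r; apply; rewrite ?tt'//.
    by case.
  by case.
apply: (@le_trans _ _ (\sum_(x <- X) (A' + B') `^ r *
    (t * (normc (g x) / A') `^ r + t' * (normc (h x) / B') `^ r))).
  apply: ler_sum => x _.
  have gx0 : 0 <= normc (g x) / A' by rewrite divr_ge0 ?normc_ge0// ltW.
  have hx0 : 0 <= normc (h x) / B' by rewrite divr_ge0 ?normc_ge0// ltW.
  apply: le_trans (ler_wpM2l (ltW AB') (conv _ _ gx0 hx0)).
  have S0 := addr_ge0 (mulr_ge0 t0 gx0) (mulr_ge0 t'0 hx0).
  rewrite -powRM ?(ltW AB0)//.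
  apply: ge0_ler_powR; rewrite ?nnegrE ?normc_ge0 ?(ltW r0)//.
    by rewrite (mulr_ge0 _ S0)// ltW.
  apply: le_trans (le_normcD _ _) _.
  rewrite mulrDr !mulrA tA tB le_eqVlt; apply/orP; left; apply/eqP.
  by rewrite [A' * _]mulrC [B' * _]mulrC !mulfK// gt_eqF.
rewrite -mulr_sumr -[leRHS]mulr1 ler_pM2l// big_split /=.
 rewrite -!mulr_sumr -tt'.
apply: lerD; rewrite -[leRHS]mulr1 ler_wpM2l//.
  by apply: sum_powR_normalized => // x; exact: normc_ge0.
by apply: sum_powR_normalized => // x; exact: normc_ge0.
Qed.

Lemma pball_zero A : 0 <= A -> pball p (fun=> 0) A.
Proof.
move=> A0; case: exponent_cases => [[r r1 ->]|->]; last first.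
  by apply/pball_inftyP => x; rewrite Normc.normc0.
have r0 : 0 < r by lra.
apply/pball_finP => // X; rewrite big1 ?powR_ge0// => x _.
by rewrite Normc.normc0 powR0// gt_eqF.
Qed.

Lemma pball_sum (I : Type) (s : seq I) (F : I -> T -> R[i]) (A : I -> R) :
  (forall i, 0 <= A i) -> (forall i, pball p (F i) (A i)) ->
  pball p (fun x => \sum_(i <- s) F i x) (\sum_(i <- s) A i).
Proof.
move=> A0 FA; elim: s => [|i s IH].
  by rewrite big_nil (_ : (fun x => _) = fun=> 0); [exact: pball_zero|apply/funext => x; rewrite big_nil].
rewrite big_cons (_ : (fun x => _) = fun x => F i x + \sum_(i <- s) F i x).
  by apply: pballD => //; exact: sumr_ge0.
by apply/funext => x; rewrite big_cons.
Qed.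

Definition restrict X g : T -> R[i] := fun x => if x \in X then g x else 0.

Lemma pball_restrict X g A : 0 <= A -> pball p g A -> pball p (restrict X g) A.
Proof.
move=> A0; apply: pball_dominated => // x; rewrite /restrict; case: ifP => //.
by rewrite Normc.normc0 normc_ge0.
Qed.

Lemma pball_of_restrict g A : 0 <= A -> (forall X, pball p (restrict X g) A) ->
  pball p g A.
Proof.
move=> A0; case: exponent_cases => [[r r1 ->]|->] gA; last first.
  apply/pball_inftyP => x; have /pball_inftyP/(_ x) := gA [fset x]%fset.
  by rewrite /restrict inE eqxx.
have r0 : 0 < r by lra.
apply/pball_finP => // X; have /(pball_finP _ r0 A0)/(_ X) := gA X.
rewrite [X in X <= _ -> _](_ : _ = \sum_(x <- X) normc (g x) `^ r)//.
by apply: eq_big_seq => x xX; rewrite /restrict xX.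
Qed.

Lemma pball_reindex (s : T -> T) g A : 0 <= A -> bijective s -> pball p g A ->
  pball p (g \o s) A.
Proof.
move=> A0 [s' sK s'K]; case: exponent_cases => [[r r1 ->]|->]; last first.
  by rewrite !pball_inftyP => gA x; exact: gA.
have r0 : 0 < r by lra.
rewrite !pball_finP// => gA X; apply: le_trans (gA [fset s x | x in X]%fset).
by rewrite big_imfset//= => x y _ _; exact: can_inj sK x y.
Qed.

Lemma pball_delta d : pball p (fun x => (x == d)%:R) 1.
Proof.
case: exponent_cases => [[r r1 ->]|->]; last first.
  by apply/pball_inftyP => x; case: (x == d); rewrite ?Normc.normc1 ?Normc.normc0// ler01.
have r0 : 0 < r by lra.
apply/pball_finP => // X; rewrite powR1.
apply: (@le_trans _ _ (\sum_(x <- (d |` X)%fset) normc ((x == d)%:R : R[i]) `^ r)).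
  by apply: fsum_le => x; rewrite ?powR_ge0// => xX; rewrite inE xX orbT.
rewrite (@fsum_restrict _ _ [fset d]%fset).
- by rewrite big_seq_fset1 eqxx Normc.normc1 powR1.
- by move=> x; rewrite inE => /negbTE ->; rewrite Normc.normc0 powR0// gt_eqF.
- by move=> x; rewrite !inE => ->.
Qed.

Lemma pball_finite_support X g : (forall x, x \notin X -> g x = 0) ->
  pball p g (\sum_(d <- X) normc (g d)).
Proof.
move=> gX; rewrite {1}(_ : g = fun x => \sum_(d <- X) g d * (x == d)%:R).
  apply: (@pball_sum _ _ (fun d x => g d * (x == d)%:R) (fun d => normc (g d))) => d.
    exact: normc_ge0.
  by rewrite -[normc _]mulr1; apply: pballZ => //; exact: pball_delta.
apply/funext => x; have [xX|xX] := boolP (x \in X); last first.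
  rewrite gX// big1_seq// => d /andP[_ dX].
  by rewrite (_ : x == d = false) ?mulr0//; apply: contraNF xX => /eqP ->.
rewrite (big_fsetD1 x)//= eqxx mulr1 big1_seq ?addr0// => d /andP[_].
by rewrite !inE eq_sym => /andP[/negbTE -> _]; rewrite mulr0.
Qed.

(** Uniform closeness is enough, because the norm is determined by restrictions to finite sets X,
    where a pointwise error costs at most the size of X times that error. *)
Lemma pball_close g A : 0 <= A ->
  (forall e : R, 0 < e -> exists2 h, pball p h A & forall x, normc (g x - h x) <= e) ->
  pball p g A.
Proof.
move=> A0 H; apply: pball_of_restrict => // X; apply: pball_closed => e e0.
have D0 : (0 : R) < (size (enum_fset X))%:R + 1 by rewrite ltr_wpDl.
have [h hA gh] := H _ (divr_gt0 e0 D0).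
rewrite (_ : restrict X g = fun x => restrict X h x + restrict X (g - h) x).
  apply: pballD => //; [exact: ltW|exact: pball_restrict|].
  apply: pball_le (@pball_finite_support X _ _); last first.
    by move=> x /negbTE xX; rewrite /restrict xX.
  apply: (@le_trans _ _ (\sum_(d <- X) e / ((size (enum_fset X))%:R + 1))).
    apply: ler_sum => x _; rewrite /restrict; case: ifP => _; first exact: gh.
    by rewrite Normc.normc0 divr_ge0 ?ltW.
  rewrite big_const_seq iter_addr_0 count_predT -[leLHS]mulr_natr.
  by rewrite mulrAC ler_pdivrMr// ler_wpM2l ?(ltW e0)// lerDl.
apply/funext => x; rewrite /restrict; case: ifP => _; last by rewrite addr0.
by rewrite addrC subrK.
Qed.

End exponent.

Lemma hoelder_conjugate_fin r : 1 < r -> hoelder_conjugate r%:E = (r / (r - 1))%:E.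
Proof.
move=> r1; have r10 : r - 1 != 0 by rewrite gt_eqF// subr_gt0.
have r0 : r != 0 by rewrite gt_eqF//; lra.
by rewrite /hoelder_conjugate/= eqe (negbTE r0) -EFinD inver (negbTE r10) -EFinM.
Qed.

Lemma hoelder_fin p g h A B X : (1 <= p)%E -> 0 <= A -> 0 <= B -> pball p g A ->
  pball (hoelder_conjugate p) h B ->
  \sum_(x <- X) normc (g x) * normc (h x) <= A * B.
Proof.
have endpoint (u v : T -> R[i]) (D E : R) : 0 <= D -> 0 <= E -> pball 1%E u D ->
    pball +oo%E v E -> \sum_(x <- X) normc (u x) * normc (v x) <= D * E.
  move=> D0 E0 /pball_finP - /(_ ltr01 D0)/(_ X) uD /pball_inftyP vE.
  rewrite powRr1// in uD; apply: (@le_trans _ _ (\sum_(x <- X) normc (u x) * E)).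
    by apply: ler_sum => x _; rewrite ler_wpM2l ?normc_ge0.
  rewrite -mulr_suml ler_wpM2r//; apply: le_trans uD; rewrite le_eqVlt.
  by apply/orP; left; apply/eqP/eq_bigr => x _; rewrite powRr1 ?normc_ge0.
move=> p1 A0 B0; case: (exponent_cases p1) => [[r]|->]; last first.
  rewrite hoelder_conjugatey => gA hB; rewrite mulrC.
  by under eq_bigr do rewrite mulrC; exact: endpoint.
rewrite le_eqVlt => /orP[/eqP<- ->|r1 ->].
  by rewrite hoelder_conjugate1; exact: endpoint.
rewrite hoelder_conjugate_fin//; set s := r / (r - 1) => gA hB.
have r0 : 0 < r by lra.
have r10 : 0 < r - 1 by lra.
have s0 : 0 < s by rewrite divr_gt0.
have rs : r^-1 + s^-1 = 1 by rewrite invf_div; field; rewrite !gt_eqF.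
have young (D E : R) : 0 < D -> 0 < E -> pball r%:E g D -> pball s%:E h E ->
    \sum_(x <- X) normc (g x) * normc (h x) <= D * E.
  move=> D0 E0 /(pball_finP _ r0 (ltW D0))/(_ X) gD /(pball_finP _ s0 (ltW E0))/(_ X) hE.
  have gD1 := sum_powR_normalized D0 (fun x => normc_ge0 (g x)) gD.
  have hE1 := sum_powR_normalized E0 (fun x => normc_ge0 (h x)) hE.
  have DE0 : 0 < D * E by exact: mulr_gt0.
  apply: (@le_trans _ _ (\sum_(x <- X) (D * E) *
      ((normc (g x) / D) `^ r / r + (normc (h x) / E) `^ s / s))).
    apply: ler_sum => x _.
    have -> : normc (g x) * normc (h x) = D * E * ((normc (g x) / D) * (normc (h x) / E)).
      by field; rewrite !gt_eqF.
    rewrite ler_wpM2l ?(ltW DE0)// conjugate_powR ?divr_ge0 ?normc_ge0 ?(ltW D0) ?(ltW E0)//.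
  rewrite -mulr_sumr -[leRHS]mulr1 ler_pM2l// big_split /= -!mulr_suml -rs.
  by apply: lerD; rewrite ler_pdivrMr// mulVf// gt_eqF.
apply/ler_addgt0Pr => e e0.
(* [young] divides by the bounds, so A and B, which may vanish, are replaced by A + d and B + d. *)
pose d := Num.min 1 (e / (A + B + 1)).
have AB1 : 0 < A + B + 1 by lra.
have d0 : 0 < d by rewrite lt_min ltr01 divr_gt0.
have d1 : d <= 1 by rewrite ge_min lexx.
have de : d * (A + B + 1) <= e by rewrite -ler_pdivlMr// ge_min lexx orbT.
apply: (@le_trans _ _ ((A + d) * (B + d))); last by nra.
apply: young; [lra|lra| |]; [apply: pball_le gA|apply: pball_le hB]; lra.
Qed.

(** This is z / |z|, and 0 at z = 0 because the inverse of 0 is 0. *)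
Definition phase (z : R[i]) : R[i] := z * (normc z)^-1%:C%C.

Lemma normc_phase_le z : normc (phase z) <= 1.
Proof.
rewrite Normc.normcM normc_real ger0_norm ?invr_ge0 ?normc_ge0//.
have [->|z0] := eqVneq (normc z) 0; first by rewrite mul0r ler01.
by rewrite mulfV.
Qed.

Lemma mul_conj_phase z : z * (phase z)^* = (normc z)%:C%C.
Proof.
rewrite /phase rmorphM /= conj_realC mulrA mul_conj -rmorphM /=.
have [->|z0] := eqVneq (normc z) 0; first by rewrite expr0n mul0r.
by rewrite expr2 mulfK.
Qed.

(** The converse of Hoelder's inequality, by test vectors: point masses for p = oo, phases for p =
    1, and the equality case of Hoelder's inequality in between. *)
Lemma pball_dual p u D : (1 <= p)%E -> 0 <= D ->
  (forall X h, (forall x, x \notin X -> h x = 0) ->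
    pball (hoelder_conjugate p) h 1 -> normc (\sum_(x <- X) u x * (h x)^*) <= D) ->
  pball p u D.
Proof.
move=> p1 D0 H; case: (exponent_cases p1) H => [[r]|->]; last first.
  rewrite hoelder_conjugatey => H; apply/pball_inftyP => x.
  have := H [fset x]%fset (fun y => (y == x)%:R).
  rewrite big_seq_fset1 eqxx conjC1 mulr1; apply; last exact: pball_delta.
  by move=> y; rewrite inE => /negbTE ->.
rewrite le_eqVlt => /orP[/eqP<- ->|r1 ->].
  rewrite hoelder_conjugate1 => H; apply/pball_finP => // X.
  rewrite powRr1//; have := H X (restrict X (phase \o u)).
  have -> : \sum_(x <- X) u x * (restrict X (phase \o u) x)^* =
      (\sum_(x <- X) normc (u x))%:C%C.
    rewrite rmorph_sum; apply: eq_big_seq => x xX.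
    by rewrite /restrict xX mul_conj_phase.
  rewrite normc_real => h; apply: le_trans (h _ _).
  - apply: le_trans (ler_norm _); rewrite le_eqVlt; apply/orP; left; apply/eqP.
    by apply: eq_bigr => x _; rewrite powRr1// normc_ge0.
  - by move=> x /negbTE xX; rewrite /restrict xX.
  - apply/pball_inftyP => x; rewrite /restrict; case: ifP => _.
      exact: normc_phase_le.
    by rewrite Normc.normc0 ler01.
rewrite hoelder_conjugate_fin//; set s := r / (r - 1) => H.
have r0 : 0 < r by lra.
have r10 : 0 < r - 1 by lra.
have s0 : 0 < s by rewrite divr_gt0.
have rs : r^-1 + s^-1 = 1 by rewrite invf_div; field; rewrite !gt_eqF.
have rss : (r - 1) * s = r by rewrite mulrC divfK// gt_eqF.
apply/pball_finP => // X; set S := \sum_(x <- X) _.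
have S0 : 0 <= S by apply: sumr_ge0 => x _; exact: powR_ge0.
have [->|SN0] := eqVneq S 0; first exact: powR_ge0.
have {SN0 S0}Sp : 0 < S by rewrite lt_def SN0.
(* The factor S^(-1/s) normalizes h in l^s; the pairing of u with h on X is then S^(1/r). *)
pose h x := phase (u x) * (normc (u x) `^ (r - 1) * S `^ (- s^-1))%:C%C.
have := H X (restrict X h).
have -> : \sum_(x <- X) u x * (restrict X h x)^* = (S * S `^ (- s^-1))%:C%C.
  rewrite mulr_suml rmorph_sum; apply: eq_big_seq => x xX.
  rewrite /restrict xX /h rmorphM /= conj_realC mulrA mul_conj_phase -rmorphM /= mulrA.
  congr (_ * _)%:C%C; have [->|n0] := eqVneq (normc (u x)) 0.
    by rewrite mul0r powR0// gt_eqF.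
  by rewrite -[X in X * _]powRr1 ?normc_ge0// -powRD ?n0 ?implybT// addrC subrK.
have SE : S * S `^ (- s^-1) = S `^ r^-1.
  rewrite -[X in X * _]powRr1 ?(ltW Sp)// -powRD ?(gt_eqF Sp) ?implybT//.
  by rewrite -rs addrK.
rewrite SE normc_real ger0_norm ?powR_ge0// => h1.
have {}h1 : S `^ r^-1 <= D.
  apply: h1 => [x /negbTE xX|]; first by rewrite /restrict xX.
  apply/pball_finP => // Y.
  apply: (@le_trans _ _ (\sum_(x <- (X `|` Y)%fset) normc (restrict X h x) `^ s)).
    by apply: fsum_le => x; rewrite ?powR_ge0// => xX; rewrite inE xX orbT.
  rewrite (@fsum_restrict _ _ X); last 2 first.
  - by move=> x /negbTE xX; rewrite /restrict xX Normc.normc0 powR0// gt_eqF.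
  - by move=> x xX; rewrite inE xX.
  have SV : S * S^-1 = 1 by rewrite mulfV// gt_eqF.
  rewrite powR1 -[leRHS]SV mulr_suml big_seq [leRHS]big_seq; apply: ler_sum => x xX.
  have -> : normc (u x) `^ r / S = (normc (u x) `^ (r - 1) * S `^ (- s^-1)) `^ s.
    rewrite powRM ?powR_ge0// -!powRrM rss mulNr mulVf ?gt_eqF//.
    by rewrite powR_inv1// ltW.
  apply: ge0_ler_powR; rewrite ?nnegrE ?(ltW s0) ?normc_ge0//.
    by rewrite mulr_ge0 ?powR_ge0.
  rewrite /restrict xX /h Normc.normcM normc_real ger0_norm ?mulr_ge0 ?powR_ge0//.
  by rewrite ler_piMl ?normc_phase_le// mulr_ge0 ?powR_ge0.
have : (S `^ r^-1) `^ r <= D `^ r.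
  by apply: ge0_ler_powR; rewrite ?nnegrE ?powR_ge0// ltW.
by rewrite -powRrM mulVf ?gt_eqF// powRr1 ?(ltW Sp).
Qed.

End lp_balls.

(** * Absolutely summable families *)

Section summable_families.
Variables (R : realType) (T : choiceType).
Implicit Types (a b : T -> R) (F G : T -> R[i]) (A B : R).

Lemma esum_part_fin a A : (forall X : {fset T}, \sum_(x <- X) `|a x| <= A) ->
  exists2 s : R, 0 <= s <= A & (\esum_(x in [set: T]) (Num.max (a x) 0)%:E = s%:E)%E.
Proof.
move=> aA; have m0 x : 0 <= Num.max (a x) 0 by rewrite le_max lexx orbT.
have : (\esum_(x in [set: T]) (Num.max (a x) 0)%:E <= A%:E)%E.
  apply/esum_leP => // X; apply: le_trans (aA X); apply: ler_sum => x _.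
  by rewrite ge_max ler_norm normr_ge0.
have : (0 <= \esum_(x in [set: T]) (Num.max (a x) 0)%:E)%E.
  by apply: esum_ge0 => x _; rewrite lee_fin.
case: (\esum_(x in _) _)%E => // s; rewrite !lee_fin => s0 sA.
by exists s => //; rewrite s0.
Qed.

Lemma rsum_le a A : (forall X : {fset T}, \sum_(x <- X) `|a x| <= A) -> `|rsum a| <= A.
Proof.
move=> aA; rewrite /rsum; have [s /andP[s0 sA] ->] := esum_part_fin aA.
have [|t /andP[t0 tA] ->] := @esum_part_fin (fun x => - a x) A.
  by move=> X; under eq_bigr do rewrite normrN.
by rewrite /= ler_norml; lra.
Qed.

(** The positive parts of a and b add up to f, the negative parts to g. These are not the parts of a
    + b, but f - g = a + b, and unordered sums respect such differences. *)
Lemma rsumD a b A B : (forall X : {fset T}, \sum_(x <- X) `|a x| <= A) ->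
  (forall X : {fset T}, \sum_(x <- X) `|b x| <= B) ->
  rsum (fun x => a x + b x) = rsum a + rsum b.
Proof.
move=> aA bB.
have NaA : forall X : {fset T}, \sum_(x <- X) `|- a x| <= A.
  by move=> X; under eq_bigr do rewrite normrN.
have NbB : forall X : {fset T}, \sum_(x <- X) `|- b x| <= B.
  by move=> X; under eq_bigr do rewrite normrN.
have abAB : forall X : {fset T}, \sum_(x <- X) `|a x + b x| <= A + B.
  move=> X; apply: le_trans (lerD (aA X) (bB X)).
  by rewrite -big_split; apply: ler_sum => x _; exact: ler_normD.
have NabAB : forall X : {fset T}, \sum_(x <- X) `|- (a x + b x)| <= A + B.
  by move=> X; under eq_bigr do rewrite normrN.
have [ap _ apE] := esum_part_fin aA; have [an _ anE] := esum_part_fin NaA.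
have [bp _ bpE] := esum_part_fin bB; have [bn _ bnE] := esum_part_fin NbB.
have [cp _ cpE] := esum_part_fin abAB; have [cn _ cnE] := esum_part_fin NabAB.
rewrite /rsum apE anE bpE bnE cpE cnE /=.
have m0 (c : T -> R) x : (0 <= (Num.max (c x) 0)%:E)%E.
  by rewrite lee_fin le_max lexx orbT.
pose f x := ((Num.max (a x) 0)%:E + (Num.max (b x) 0)%:E)%E.
pose g x := ((Num.max (- a x) 0)%:E + (Num.max (- b x) 0)%:E)%E.
have f0 x : (0 <= f x)%E by apply: adde_ge0; exact: m0.
have g0 x : (0 <= g x)%E by apply: adde_ge0; exact: (m0 (fun x => - _ x)).
have fE : (\esum_(x in [set: T]) f x = (ap + bp)%:E)%E.
  by rewrite esumD ?apE ?bpE// => x _; exact: m0.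
have gE : (\esum_(x in [set: T]) g x = (an + bn)%:E)%E.
  by rewrite esumD ?anE ?bnE// => x _; exact: (m0 (fun x => - _ x)).
have sf : summable [set: T] f.
  by rewrite /summable; under eq_esum do rewrite gee0_abs//; rewrite fE ltry.
have sg : summable [set: T] g.
  by rewrite /summable; under eq_esum do rewrite gee0_abs//; rewrite gE ltry.
have := esumB sf sg (fun x _ => f0 x) (fun x _ => g0 x).
have fgE x : (f x - g x = (a x + b x)%:E)%E.
  rewrite /f /g -!EFinD; congr (_%:E).
  by case: (lerP (a x) 0); case: (lerP (b x) 0); case: (lerP (- a x) 0); case: (lerP (- b x) 0); lra.
rewrite fE gE.
rewrite (eq_esum (b := fun x => (Num.max (a x + b x) 0)%:E)); last first.
  by move=> x _; rewrite funeposE fgE -EFin_max.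
rewrite [X in (_ - X)%E](eq_esum (b := fun x => (Num.max (- (a x + b x)) 0)%:E)); last first.
  by move=> x _; rewrite funenegE fgE -EFinN -EFin_max.
by rewrite cpE cnE -!EFinB => -[]; lra.
Qed.

Lemma pball1P F A : 0 <= A ->
  pball 1%E F A <-> forall X : {fset T}, \sum_(x <- X) normc (F x) <= A.
Proof.
move=> A0; rewrite (pball_finP _ ltr01 A0) powRr1//.
have E X : \sum_(x <- X) normc (F x) `^ 1 = \sum_(x <- X) normc (F x).
  by apply: eq_bigr => x _; rewrite powRr1 ?normc_ge0.
by split=> h X; have := h X; rewrite E.
Qed.

Lemma pball1_Re F A : 0 <= A -> pball 1%E F A ->
  forall X : {fset T}, \sum_(x <- X) `|complex.Re (F x)| <= A.
Proof.
move=> A0 /(pball1P _ A0) FA X; apply: le_trans (FA X); apply: ler_sum => x _.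
by have [] := abs_le_normc (F x).
Qed.

Lemma pball1_Im F A : 0 <= A -> pball 1%E F A ->
  forall X : {fset T}, \sum_(x <- X) `|complex.Im (F x)| <= A.
Proof.
move=> A0 /(pball1P _ A0) FA X; apply: le_trans (FA X); apply: ler_sum => x _.
by have [] := abs_le_normc (F x).
Qed.

Lemma csumD F G A B : 0 <= A -> 0 <= B -> pball 1%E F A -> pball 1%E G B ->
  csum (fun x => F x + G x) = csum F + csum G.
Proof.
move=> A0 B0 FA GB; rewrite /csum.
have ReD (z w : R[i]) : complex.Re (z + w) = complex.Re z + complex.Re w.
  by case: z; case: w.
have ImD (z w : R[i]) : complex.Im (z + w) = complex.Im z + complex.Im w.
  by case: z; case: w.
under [X in rsum X]funext do rewrite ReD.
under [X in Complex _ (rsum X)]funext do rewrite ImD.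
rewrite (rsumD (pball1_Re A0 FA) (pball1_Re B0 GB)).
by rewrite (rsumD (pball1_Im A0 FA) (pball1_Im B0 GB)).
Qed.

(** The factor 2 comes from bounding real and imaginary parts separately; the bound is only applied
    to errors that tend to 0. *)
Lemma normc_csum_le F A : 0 <= A -> pball 1%E F A -> normc (csum F) <= 2 * A.
Proof.
move=> A0 FA; apply: le_trans (normc_le_abs _ _) _.
have := rsum_le (pball1_Re A0 FA); have := rsum_le (pball1_Im A0 FA); lra.
Qed.

End summable_families.

(** * Convolution and the group algebra *)

Section group_actions.
Variables (R : realType) (G : groupType).

Definition supported_in (T : choiceType) (V : nmodType) (X : {fset T}) (f : T -> V) :=
  forall x, x \notin X -> f x = 0.

Lemma fsum_reindex (T : choiceType) (V : nmodType) (s : T -> T) (X Y : {fset T}) (F : T -> V) :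
  bijective s -> supported_in X (F \o s) -> supported_in Y F ->
  \sum_(x <- X) F (s x) = \sum_(y <- Y) F y.
Proof.
move=> bs FX FY; rewrite -(fsbigTE X (fun x => F (s x)) FX) -(fsbigTE Y F FY).
by rewrite [RHS](reindex_fsbigT _ _ bs).
Qed.

Lemma finitely_supportedP (f : G -> R[i]) :
  finitely_supported f <-> exists X : {fset G}, supported_in X f.
Proof.
split=> [fin_f|[X fX]].
  exists (fset_set [set x | f x != 0]) => x; rewrite in_fset_set// notin_setE /=.
  by move/negP; rewrite negbK => /eqP.
apply: (@sub_finite_set _ _ [set` X]) => // x /= fx.
by apply: contraNT fx => /fX ->.
Qed.

Section action.
Variables (T : choiceType) (act : G -> T -> T).
Hypotheses (act1 : forall c, act 1%g c = c)
  (actM : forall x y c, act (x * y)%g c = act x (act y c)).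

(** Covers both convolution, for G acting on itself, and [lambda], for G acting on the cosets, so
    that the algebraic laws are proved once. *)
Definition conv_act (f : G -> R[i]) (g : T -> R[i]) : T -> R[i] :=
  fun c => csum (fun y => f y * g (act y^-1%g c)).

Lemma actK x : cancel (act x) (act x^-1%g).
Proof. by move=> c; rewrite -actM mulVg act1. Qed.

Lemma actVK x : cancel (act x^-1%g) (act x).
Proof. by move=> c; rewrite -actM mulgV act1. Qed.

Lemma act_bij x : bijective (act x).
Proof. exact: Bijective (actK x) (actVK x). Qed.

Lemma conv_actE S f g c : supported_in S f ->
  conv_act f g c = \sum_(y <- S) f y * g (act y^-1%g c).
Proof. by move=> fS; apply: csum_finite_support => y /fS ->; rewrite mul0r. Qed.

Lemma supported_conv_act S (X : {fset T}) f g : supported_in S f -> supported_in X g ->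
  supported_in [fset act y c | y in S, c in X]%fset (conv_act f g).
Proof.
move=> fS gX c cX; rewrite (conv_actE _ _ fS) big1_seq// => y /andP[_ yS].
rewrite gX ?mulr0//; apply: contra cX => yX; apply/imfset2P.
by exists y => //; exists (act y^-1%g c); rewrite ?actVK.
Qed.

End action.

Lemma convolution_conv_act (f g : G -> R[i]) : convolution f g = conv_act *%g f g.
Proof. by []. Qed.

Lemma supported_convolution S K (f g : G -> R[i]) : supported_in S f -> supported_in K g ->
  supported_in [fset (y * w)%g | y in S, w in K]%fset (convolution f g).
Proof. by move=> fS gK; apply: supported_conv_act => //; [exact: mul1g|move=> *; rewrite mulgA]. Qed.

Section action_theory.
Variables (T : choiceType) (act : G -> T -> T).
Hypotheses (act1 : forall c, act 1%g c = c)
  (actM : forall x y c, act (x * y)%g c = act x (act y c)).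
Local Notation conv_act := (conv_act act).

Lemma mulg_bij (x : G) : bijective (fun y => x * y)%g.
Proof. by exists (fun y => x^-1 * y)%g => y; rewrite ?mulKg ?mulVKg. Qed.

Lemma conv_actA f k g : finitely_supported f -> finitely_supported k ->
  conv_act (convolution f k) g = conv_act f (conv_act k g).
Proof.
move=> /finitely_supportedP[S fS] /finitely_supportedP[K kK]; apply/funext => c.
rewrite (conv_actE _ _ _ (supported_convolution fS kK)) (conv_actE _ _ _ fS).
under eq_bigr do rewrite convolution_conv_act (conv_actE _ _ _ fS) mulr_suml.
rewrite exchange_big /= [LHS]big_seq [RHS]big_seq; apply: eq_bigr => y yS.
rewrite (conv_actE _ _ _ kK) mulr_sumr.
pose F w := f y * (k w * g (act w^-1%g (act y^-1%g c))).
rewrite -[RHS](@fsum_reindex _ _ (fun v => y^-1 * v)%g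
  [fset (y * w)%g | y in S, w in K]%fset K F).
- by apply: eq_bigr => v _; rewrite /F -mulrA -actM -invgM mulVKg.
- exact: mulg_bij.
- move=> v vSK; rewrite /F /= kK ?mul0r ?mulr0//; apply: contra vSK => vK.
  by apply/imfset2P; exists y => //; exists (y^-1 * v)%g; rewrite ?mulVKg.
- by move=> w /kK; rewrite /F => ->; rewrite mul0r mulr0.
Qed.

Lemma conv_actDl f k g : finitely_supported f -> finitely_supported k ->
  conv_act (f + k) g = conv_act f g + conv_act k g.
Proof.
move=> /finitely_supportedP[S fS] /finitely_supportedP[K kK]; apply/funext => c.
have fSK : supported_in (S `|` K)%fset f.
  by move=> x; rewrite inE negb_or => /andP[/fS].
have kSK : supported_in (S `|` K)%fset k.
  by move=> x; rewrite inE negb_or => /andP[_ /kK].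
have fkSK : supported_in (S `|` K)%fset (f + k).
  by move=> x xSK; rewrite -[LHS]/(f x + k x) fSK// kSK// addr0.
rewrite (conv_actE _ _ _ fkSK) -[RHS]/(conv_act f g c + conv_act k g c).
rewrite (conv_actE _ _ _ fSK) (conv_actE _ _ _ kSK) -big_split /=.
by apply: eq_bigr => y _; rewrite -mulrDl.
Qed.

Lemma conv_actZl (a : R[i]) f g : finitely_supported f ->
  conv_act (a *: f) g = a *: conv_act f g.
Proof.
move=> /finitely_supportedP[S fS]; apply/funext => c.
have afS : supported_in S (a *: f).
  by move=> x xS; rewrite -[LHS]/(a * f x) fS// mulr0.
rewrite (conv_actE _ _ _ afS) -[RHS]/(a * conv_act f g c) (conv_actE _ _ _ fS).
by rewrite mulr_sumr; apply: eq_bigr => y _; rewrite mulrA.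
Qed.

Lemma conv_act_linear f (a : R[i]) g h : finitely_supported f ->
  conv_act f (a *: g + h) = a *: conv_act f g + conv_act f h.
Proof.
move=> /finitely_supportedP[S fS]; apply/funext => c.
rewrite -[RHS]/(a * conv_act f g c + conv_act f h c) !(conv_actE _ _ _ fS).
rewrite mulr_sumr -big_split; apply: eq_bigr => y _ /=.
by rewrite -[(a *: g + h) _]/(a * g _ + h _) mulrDr mulrCA.
Qed.

Lemma conv_actZr f (a : R[i]) g : finitely_supported f ->
  conv_act f (a *: g) = a *: conv_act f g.
Proof.
move=> /finitely_supportedP[S fS]; apply/funext => c.
rewrite -[RHS]/(a * conv_act f g c) !(conv_actE _ _ _ fS) mulr_sumr.
by apply: eq_bigr => y _; rewrite -[(a *: g) _]/(a * g _) mulrCA.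
Qed.

Lemma conv_act_delta1 g : conv_act (@delta1 R G) g = g.
Proof.
apply/funext => c; rewrite (@conv_actE _ act [fset 1%g]%fset).
  by rewrite big_seq_fset1 /delta1 eqxx mul1r invg1 act1.
by move=> x; rewrite inE /delta1 => /negbTE ->.
Qed.

End action_theory.

Lemma convolution_delta1 f : finitely_supported f -> convolution f (@delta1 R G) = f.
Proof.
move=> /finitely_supportedP[S fS]; apply/funext => x.
rewrite convolution_conv_act (conv_actE _ _ _ fS).
rewrite (@eq_fsum_support _ _ S [fset x]%fset).
- by rewrite big_seq_fset1 /delta1 mulVg eqxx mulr1.
- by move=> y /fS ->; rewrite mul0r.
- move=> y; rewrite inE => yx; rewrite /delta1.
  by rewrite (_ : _ == _ = false) ?mulr0//; apply: contraNF yx => /eqP/mulg1_eq <-; rewrite invgK.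
Qed.

Lemma involutionK : involutive (@involution R G).
Proof. by move=> f; apply/funext => x; rewrite /involution invgK conjCK. Qed.

Lemma supported_involution (f : G -> R[i]) S : supported_in S f ->
  supported_in [fset x^-1%g | x in S]%fset (involution f).
Proof.
move=> fS x xS; rewrite /involution fS ?conjC0//; apply: contra xS => xS.
by apply/imfsetP; exists x^-1%g; rewrite ?invgK.
Qed.

Lemma involution_convolution (f g : G -> R[i]) : finitely_supported f ->
  finitely_supported g ->
  involution (convolution f g) = convolution (involution g) (involution f).
Proof.
move=> /finitely_supportedP[S fS] /finitely_supportedP[K gK]; apply/funext => x.
rewrite [in RHS]convolution_conv_act (conv_actE _ _ _ (supported_involution gK)).
rewrite /involution convolution_conv_act (conv_actE _ _ _ fS) rmorph_sum.
pose F w := (g w^-1%g)^* * (f (w^-1 * x)^-1%g)^*.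
rewrite -[RHS](@fsum_reindex _ _ (fun y => x * y)%g S _ F).
- apply: eq_bigr => y _; rewrite /F rmorphM /= mulrC; congr (_ * _).
    by congr (g _)^*; rewrite invgM.
  by congr (f _)^*; rewrite invgM invgK mulKg.
- exact: mulg_bij.
- by move=> y yS; rewrite /F /= !invgM !invgK mulKg fS// conjC0 mulr0.
- move=> w wK; rewrite /F gK ?conjC0 ?mul0r//; apply: contra wK => wK.
  by apply/imfsetP; exists w^-1%g; rewrite ?invgK.
Qed.

End group_actions.

(** * The group algebra CG as an algebra with involution *)

Section group_algebra_type.
Variables (R : realType) (G : groupType).

Definition finsupp : {pred G -> R[i]} := fun f => `[< finitely_supported f >].

Lemma finsuppP f : reflect (finitely_supported f) (f \in finsupp).
Proof. exact: asboolP. Qed.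

Fact finsupp_submod_closed : submod_closed finsupp.
Proof.
split=> [|a f g /finsuppP/finitely_supportedP[S fS] /finsuppP/finitely_supportedP[K gK]].
  by apply/finsuppP/finitely_supportedP; exists fset0.
apply/finsuppP/finitely_supportedP; exists (S `|` K)%fset => x.
rewrite inE negb_or => /andP[xS xK].
by rewrite -[LHS]/(a * f x + g x) fS// gK// mulr0 addr0.
Qed.
HB.instance Definition _ :=
  GRing.isSubmodClosed.Build R[i] (G -> R[i]) finsupp finsupp_submod_closed.

Record cg := CG { cgval :> G -> R[i]; _ : cgval \in finsupp }.
HB.instance Definition _ := [isSub for cgval].
HB.instance Definition _ := [Choice of cg by <:].
HB.instance Definition _ := [SubChoice_isSubLmodule of cg by <:].

Lemma cg_fin (f : cg) : finitely_supported f.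
Proof. by case: f => f fP; apply/finsuppP. Qed.

Lemma cg_support (f : cg) : exists S : {fset G}, supported_in S f.
Proof. exact/finitely_supportedP/cg_fin. Qed.

Fact convolution_finsupp (f g : cg) : convolution f g \in finsupp.
Proof.
have [S fS] := cg_support f; have [K gK] := cg_support g.
apply/finsuppP/finitely_supportedP.
by exists [fset (y * w)%g | y in S, w in K]%fset; exact: supported_convolution.
Qed.
Definition cg_mul (f g : cg) : cg := CG (convolution_finsupp f g).

Fact delta1_finsupp : @delta1 R G \in finsupp.
Proof.
apply/finsuppP/finitely_supportedP; exists [fset 1%g]%fset => x.
by rewrite inE /delta1 => /negbTE ->.
Qed.
Definition cg_one : cg := CG delta1_finsupp.

Fact involution_finsupp (f : cg) : involution f \in finsupp.
Proof.
have [S fS] := cg_support f; apply/finsuppP/finitely_supportedP.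
by exists [fset x^-1%g | x in S]%fset; exact: supported_involution.
Qed.
Definition star (f : cg) : cg := CG (involution_finsupp f).

Fact cg_mulA : associative cg_mul.
Proof.
move=> f g h; apply/val_inj => /=; rewrite !convolution_conv_act.
rewrite conv_actA//; try exact: cg_fin.
by move=> x y c; rewrite mulgA.
Qed.
Fact cg_mul1 : left_id cg_one cg_mul.
Proof. by move=> f; apply/val_inj; rewrite /= convolution_conv_act conv_act_delta1//; exact: mul1g. Qed.
Fact cg_mulr1 : right_id cg_one cg_mul.
Proof. move=> f; apply/val_inj; rewrite /= convolution_delta1//; exact: cg_fin. Qed.
Fact cg_mulDl : left_distributive cg_mul +%R.
Proof.
move=> f g h; apply/val_inj => /=; rewrite !convolution_conv_act.
apply: conv_actDl; exact: cg_fin.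
Qed.
Fact cg_mulDr : right_distributive cg_mul +%R.
Proof.
move=> f g h; apply/val_inj => /=; rewrite !convolution_conv_act.
rewrite -[X in conv_act _ _ (X + _)]scale1r conv_act_linear ?scale1r//; exact: cg_fin.
Qed.
Fact cg_one_neq0 : cg_one != 0.
Proof.
apply/eqP => /(congr1 (fun f : cg => f 1%g)) /=; rewrite /delta1 eqxx.
by apply/eqP; rewrite oner_eq0.
Qed.
HB.instance Definition _ := GRing.Zmodule_isNzRing.Build cg
  cg_mulA cg_mul1 cg_mulr1 cg_mulDl cg_mulDr cg_one_neq0.

Fact cg_scalerAl (a : R[i]) (f g : cg) : a *: (f * g) = (a *: f) * g.
Proof.
apply/val_inj => /=; rewrite !convolution_conv_act conv_actZl//; exact: cg_fin.
Qed.
HB.instance Definition _ := GRing.Lmodule_isLalgebra.Build R[i] cg cg_scalerAl.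
Fact cg_scalerAr (a : R[i]) (f g : cg) : a *: (f * g) = f * (a *: g).
Proof.
apply/val_inj => /=; rewrite !convolution_conv_act conv_actZr//; exact: cg_fin.
Qed.
HB.instance Definition _ := GRing.Lalgebra_isAlgebra.Build R[i] cg cg_scalerAr.

Lemma starK : involutive star.
Proof. by move=> f; apply/val_inj; exact: involutionK. Qed.

Lemma starM (f g : cg) : star (f * g) = star g * star f.
Proof. by apply/val_inj; apply: involution_convolution; exact: cg_fin. Qed.

Lemma starD (f g : cg) : star (f + g) = star f + star g.
Proof. by apply/val_inj/funext => x; exact: rmorphD. Qed.

Lemma starZ (a : R[i]) (f : cg) : star (a *: f) = a^* *: star f.
Proof. by apply/val_inj/funext => x; exact: rmorphM. Qed.

Lemma starN (f : cg) : star (- f) = - star f.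
Proof. by rewrite -scaleN1r starZ rmorphN /= conjC1 scaleN1r. Qed.

Lemma starB (f g : cg) : star (f - g) = star f - star g.
Proof. by rewrite starD starN. Qed.

Lemma star1 : star 1 = 1.
Proof. by rewrite -[star 1]mulr1 -{2}(starK 1) -starM mulr1 starK. Qed.

Lemma starX (f : cg) n : star (f ^+ n) = star f ^+ n.
Proof. by elim: n => [|n IH]; rewrite ?star1// exprS starM IH -exprSr. Qed.

Lemma star_realZ (x : R) (f : cg) : star (x%:C%C *: f) = x%:C%C *: star f.
Proof. by rewrite starZ conj_realC. Qed.

End group_algebra_type.

(** * The action of G on the cosets *)

Section coset_action.
Variables (G : groupType) (H : groupClosed G).
Local Open Scope quotient_scope.

Definition coset_act (y : G) (c : cosets H) : cosets H := \pi_(cosets H) (y * repr c)%g.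

Lemma coset_act_pi y x : coset_act y (\pi_(cosets H) x) = \pi_(cosets H) (y * x)%g.
Proof.
apply/eqquotP => /=; rewrite /same_coset invgM -mulgA mulKg.
by apply/(eqquotP (cosets H) (repr (\pi_(cosets H) x)) x); rewrite reprK.
Qed.

Lemma coset_act1 c : coset_act 1%g c = c.
Proof. by rewrite /coset_act mul1g reprK. Qed.

Lemma coset_actM x y c : coset_act (x * y)%g c = coset_act x (coset_act y c).
Proof. by rewrite {3}/coset_act coset_act_pi mulgA. Qed.

Lemma card_cosets_fset (S : {fset G}) d :
  (#|` [fset coset_act y c | y in S, c in [fset d]]%fset| <= #|` S|)%N.
Proof.
rewrite cardfE -[leqRHS](size_map (fun y => coset_act y d)) -cardfE.
apply: uniq_leq_size; first exact: fset_uniq.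
move=> c /imfset2P[y yS [d']]; rewrite inE => /eqP -> ->.
by apply/mapP; exists y.
Qed.

End coset_action.

(** * Operator norms of [lambda] *)

Section operator_norms.
Variables (R : realType) (T : choiceType) (t0 : T).
Implicit Types (S : (T -> R[i]) -> (T -> R[i])) (A B : R) (p : \bar R).

Definition op_le p S A := forall g B, 0 <= B -> pball p g B -> pball p (S g) (A * B).

Lemma lnorm_ge0 p (g : T -> R[i]) : (1 <= p)%E -> (0 <= lnorm p g)%E.
Proof.
case: p => [r| |//] p1 /=; first exact: poweR_ge0.
apply: (@le_trans _ _ (normc (g t0))%:E); first by rewrite lee_fin normc_ge0.
by apply: ereal_sup_ubound; exists t0.
Qed.

Lemma opnorm_ge0 p S : (1 <= p)%E -> (0 <= opnorm p S)%E.
Proof.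
move=> p1; apply: (le_trans (lnorm_ge0 (S (fun=> 0)) p1)).
by apply: ereal_sup_ubound; exists (fun=> 0) => //=; exact: pball_zero.
Qed.

Lemma opnorm_leP p S A : (1 <= p)%E -> 0 <= A ->
  (forall a g, S (fun x => a * g x) = (fun x => a * S g x)) ->
  (opnorm p S <= A%:E)%E <-> op_le p S A.
Proof.
move=> p1 A0 SZ; split=> [SA g B B0 gB|SA]; last first.
  apply: ge_ereal_sup => _ [g g1 <-]; rewrite -[A]mulr1.
  by apply: SA => //; exact: ler01.
have key e : 0 < e -> pball p (S g) (A * (B + e)).
  move=> e0; have Be0 : 0 < B + e by rewrite ltr_wpDl.
  have nBe : normc (B + e)%:C%C = B + e by rewrite normc_real ger0_norm// ltW.
  have Be0C : (B + e)%:C%C != 0 :> R[i] by rewrite realC_eq0 gt_eqF.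
  pose h x := (B + e)%:C%C^-1 * g x.
  have gh : g = fun x => (B + e)%:C%C * h x.
    by apply/funext => x; rewrite /h mulVKf.
  rewrite gh SZ mulrC -{2}nBe; apply: pballZ => //.
  apply: le_trans SA; apply: ereal_sup_ubound; exists h => //=.
  have -> : 1 = normc (B + e)%:C%C^-1 * (B + e) :> R.
    by rewrite Normc.normcV nBe mulVf// gt_eqF.
  by apply: pballZ => //; [exact: ltW|apply: pball_le gB; rewrite lerDl ltW].
apply: pball_closed => e e0.
have A1 : 0 < A + 1 by rewrite ltr_wpDl.
apply: pball_le (key _ (divr_gt0 e0 A1)).
rewrite mulrDr lerD2l mulrCA ler_piMr ?(ltW e0)// ler_pdivrMr// mul1r lerDl.
exact: ler01.
Qed.

End operator_norms.

Lemma pball_conv_act (R : realType) (G : groupType) (T : choiceType) (act : G -> T -> T)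
  (p : \bar R) (S : {fset G}) (f : G -> R[i]) u (B : R) :
  (1 <= p)%E -> (forall y, bijective (act y)) -> supported_in S f -> 0 <= B ->
  pball p u B -> pball p (conv_act act f u) ((\sum_(y <- S) normc (f y)) * B).
Proof.
move=> p1 ab fS B0 uB; rewrite mulr_suml.
rewrite (_ : conv_act act f u = fun c => \sum_(y <- S) f y * u (act y^-1%g c)); last first.
  by apply/funext => c; exact: conv_actE.
apply: pball_sum => // y; first by rewrite mulr_ge0// normc_ge0.
by apply: pballZ => //; exact: (pball_reindex p1 B0 (ab _)) uB.
Qed.

Section lambda_norms.
Variables (R : realType) (G : groupType) (H : groupClosed G).
Local Notation T := (cosets H).
Local Notation E := (cg R G).
Implicit Types (f g : E) (p : \bar R).
Local Open Scope quotient_scope.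

Let t0 : T := \pi_T 1%g.

Definition lam f : (T -> R[i]) -> (T -> R[i]) := lambda H f.

Lemma lamE (f : E) S u c : supported_in S f ->
  lam f u c = \sum_(y <- S) f y * u (coset_act y^-1%g c).
Proof. exact: conv_actE. Qed.

Lemma lamM f g u : lam (f * g) u = lam f (lam g u).
Proof.
exact: (conv_actA (@coset_actM G H) u (cg_fin f) (cg_fin g)).
Qed.

Lemma lam1 u : lam 1 u = u.
Proof. exact: (conv_act_delta1 (@coset_act1 G H) u). Qed.

Lemma lamD f g u : lam (f + g) u = (fun c => lam f u c + lam g u c).
Proof. exact: (conv_actDl (@coset_act G H) u (cg_fin f) (cg_fin g)). Qed.

Lemma lamZ (a : R[i]) f u : lam (a *: f) u = (fun c => a * lam f u c).
Proof. exact: (conv_actZl (@coset_act G H) a u (cg_fin f)). Qed.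

Lemma lam_linear f (a : R[i]) u v :
  lam f (fun c => a * u c + v c) = (fun c => a * lam f u c + lam f v c).
Proof. exact: (conv_act_linear (@coset_act G H) a u v (cg_fin f)). Qed.

Lemma lam_scale f (a : R[i]) u : lam f (fun c => a * u c) = (fun c => a * lam f u c).
Proof. exact: (conv_actZr (@coset_act G H) a u (cg_fin f)). Qed.

Lemma lam_bounded p f : (1 <= p)%E -> exists2 A, 0 <= A & op_le p (lam f) A.
Proof.
move=> p1; have [S fS] := cg_support f.
exists (\sum_(y <- S) normc (f y)); first by apply: sumr_ge0 => y _; exact: normc_ge0.
move=> u B B0 uB; apply: (pball_conv_act (act := @coset_act G H)) => // y.
exact: (act_bij (@coset_act1 G H) (@coset_actM G H)).
Qed.

Definition onorm p f : R := fine (opnorm p (lam f)).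

Section exponent.
Variable p : \bar R.
Hypothesis p1 : (1 <= p)%E.

Lemma opnorm_lamE f : opnorm p (lam f) = (onorm p f)%:E.
Proof.
have [A A0 fA] := lam_bounded f p1.
have : (opnorm p (lam f) <= A%:E)%E by apply/opnorm_leP => //; exact: lam_scale.
have := opnorm_ge0 t0 (lam f) p1.
by rewrite /onorm; case: (opnorm p (lam f)).
Qed.

Lemma onorm_ge0 f : 0 <= onorm p f.
Proof. by rewrite -lee_fin -opnorm_lamE; exact: (opnorm_ge0 t0 (lam f) p1). Qed.

Lemma onorm_op_le f : op_le p (lam f) (onorm p f).
Proof.
apply/opnorm_leP => //; [exact: onorm_ge0|exact: lam_scale|].
by rewrite opnorm_lamE.
Qed.

Lemma onorm_le f A : 0 <= A -> op_le p (lam f) A -> onorm p f <= A.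
Proof.
by move=> A0 fA; rewrite -lee_fin -opnorm_lamE; apply/opnorm_leP => //; exact: lam_scale.
Qed.

Lemma onorm_seminorm : algebra_seminorm (onorm p).
Proof.
have Z_le a f : onorm p (a *: f) <= normc a * onorm p f.
  apply: onorm_le => [|u B B0 uB]; first by rewrite mulr_ge0 ?normc_ge0 ?onorm_ge0.
  rewrite lamZ -mulrA; apply: pballZ => //; last exact: onorm_op_le.
  by rewrite mulr_ge0 ?onorm_ge0.
split=> [f g|a f|f g].
- apply: onorm_le => [|u B B0 uB]; first by rewrite addr_ge0 ?onorm_ge0.
  rewrite lamD mulrDl; apply: pballD => //; rewrite ?mulr_ge0 ?onorm_ge0//;
    exact: onorm_op_le.
- apply/eqP; rewrite eq_le Z_le /=; have [->|a0] := eqVneq a 0.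
    by rewrite Normc.normc0 mul0r onorm_ge0.
  have := Z_le a^-1 (a *: f).
  by rewrite scalerA mulVf// scale1r Normc.normcV ler_pdivlMl// normc_gt0.
- apply: onorm_le => [|u B B0 uB]; first by rewrite mulr_ge0 ?onorm_ge0.
  rewrite lamM -mulrA; apply: onorm_op_le; first by rewrite mulr_ge0 ?onorm_ge0.
  exact: onorm_op_le.
Qed.

End exponent.
End lambda_norms.

(** Unfolding [onorm] makes failing unification problems intractable. *)
#[global] Opaque onorm.

(** * The Hilbert space case *)

Section adjoints.
Variables (R : realType) (G : groupType) (H : groupClosed G).
Local Notation T := (cosets H).
Local Notation E := (cg R G).
Local Notation lam := (@lam R G H).
Local Notation onorm := (@onorm R G H).
Implicit Types (f g : E) (p : \bar R) (u v w : T -> R[i]) (X Y : {fset T}).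

Definition finite_support u := exists X, supported_in X u.

Lemma supported_lam S X f u : supported_in S (f : G -> R[i]) -> supported_in X u ->
  supported_in [fset coset_act y c | y in S, c in X]%fset (lam f u).
Proof. exact: (supported_conv_act (@coset_act1 G H) (@coset_actM G H)). Qed.

Lemma finite_support_lam f u : finite_support u -> finite_support (lam f u).
Proof.
move=> [X uX]; have [S fS] := cg_support f.
by exists [fset coset_act y c | y in S, c in X]%fset; exact: supported_lam.
Qed.

Lemma coset_act_bij y : bijective (@coset_act G H y).
Proof. exact: (act_bij (@coset_act1 G H) (@coset_actM G H)). Qed.

Lemma lam_star (S : {fset G}) f u c : supported_in S (f : G -> R[i]) ->
  lam (star f) u c = \sum_(y <- S) (f y)^* * u (coset_act y c).
Proof.
move=> fS; rewrite (@lamE R G H (star f) _ _ _ (supported_involution fS)).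
rewrite -(@fsum_reindex _ _ (fun y : G => y^-1%g) S _ (fun y => star f y * u (coset_act y^-1%g c))).
- by apply: eq_bigr => y _; rewrite /= /involution invgK.
- by exists (fun y : G => y^-1%g); exact: invgK.
- by move=> y yS; rewrite /= /involution invgK fS// conjC0 mul0r.
- by move=> y yS; rewrite /= (supported_involution fS)// mul0r.
Qed.

Lemma lam_adjoint (S : {fset G}) X f u v : supported_in S (f : G -> R[i]) ->
  supported_in X v ->
  \sum_(c <- X) lam (star f) u c * (v c)^* =
  \sum_(d <- [fset coset_act y c | y in S, c in X]%fset) u d * (lam f v d)^*.
Proof.
move=> fS vX; under eq_bigr do rewrite (lam_star _ _ fS) mulr_suml.
under [RHS]eq_bigr do rewrite (lamE _ _ fS) rmorph_sum mulr_sumr.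
rewrite exchange_big [RHS]exchange_big /= [LHS]big_seq [RHS]big_seq.
apply: eq_bigr => y yS.
pose F d := u d * (f y * v (coset_act y^-1%g d))^*.
have actK := actK (@coset_act1 G H) (@coset_actM G H).
have actVK := actVK (@coset_act1 G H) (@coset_actM G H).
rewrite -(@fsum_reindex _ _ (coset_act y) X _ F).
- by apply: eq_bigr => c _; rewrite /F actK rmorphM /= mulrCA mulrA.
- exact: coset_act_bij.
- by move=> c cX; rewrite /F /= actK vX// mulr0 conjC0 mulr0.
- move=> d dY; rewrite /F vX ?mulr0 ?conjC0 ?mulr0//; apply: contra dY => dX.
  by apply/imfset2P; exists y => //; exists (coset_act y^-1%g d); rewrite ?actVK.
Qed.

(** [lam (star f)] on l^p is the adjoint of [lam f] on l^q, so the bound follows from duality and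
    Hoelder's inequality. *)
Lemma onorm_star_le p q f : (1 <= p)%E -> (1 <= q)%E -> q = hoelder_conjugate p ->
  onorm p (star f) <= onorm q f.
Proof.
move=> p1 q1 qE; apply: onorm_le => //; first exact: onorm_ge0.
move=> u B B0 uB; have A0 := onorm_ge0 H q1 f.
apply: pball_dual => // [|X v vX]; first exact: mulr_ge0.
rewrite -qE => v1; have [S fS] := cg_support f.
rewrite (lam_adjoint _ fS vX); apply: le_trans (normc_sum _ _) _.
under eq_bigr do rewrite Normc.normcM normc_conj.
rewrite mulrC -[onorm q f]mulr1; apply: (hoelder_fin _ p1) => //.
  by rewrite mulr1.
by rewrite -qE; apply: onorm_op_le.
Qed.

(** On a finite set, [lam f u] depends only on finitely many values of u. The argument therefore
    also covers l^oo, where density of the finitely supported functions may fail. *)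
Lemma op_le_finite_support p f A : (1 <= p)%E -> 0 <= A ->
  (forall u B, finite_support u -> 0 <= B -> pball p u B -> pball p (lam f u) (A * B)) ->
  op_le p (lam f) A.
Proof.
move=> p1 A0 fA u B B0 uB; have AB0 : 0 <= A * B by exact: mulr_ge0.
have [S fS] := cg_support f; apply: pball_of_restrict => // X.
pose Y := [fset coset_act y^-1%g c | y in S, c in X]%fset.
have uY : finite_support (restrict Y u).
  by exists Y => x /negbTE xY; rewrite /restrict xY.
have -> : restrict X (lam f u) = restrict X (lam f (restrict Y u)).
  apply/funext => c; rewrite /restrict; case: ifP => // cX.
  rewrite !(lamE _ _ fS); apply: eq_big_seq => y yS; rewrite ifT//.
  by apply/imfset2P; exists y => //; exists c.
by apply: pball_restrict => //; apply: fA => //; exact: pball_restrict.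
Qed.

End adjoints.

Section hilbert_space.
Variables (R : realType) (G : groupType) (H : groupClosed G).
Local Notation T := (cosets H).
Local Notation E := (cg R G).
Local Notation lam := (@lam R G H).
Local Notation n2 := (@onorm R G H 2%:E).
Local Notation finite_support := (@finite_support R G H).
Implicit Types (f g : E) (u v w : T -> R[i]) (X Y : {fset T}).

Lemma one_le_two : ((1 : \bar R) <= 2%:E)%E.
Proof. by rewrite lee_fin; lra. Qed.
Hint Resolve one_le_two : core.

(** The sums in this definition and the next are finite-support sums, intended for finitely
    supported functions; [op_le_finite_support] shows that these suffice. *)
Definition inner u v : R[i] := \sum_(c \in [set: T]) u c * (v c)^*.
Definition nsq u : R := \sum_(c \in [set: T]) normc (u c) ^+ 2.
Definition l2 u : R := Num.sqrt (nsq u).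

Lemma innerE X u v : supported_in X v -> inner u v = \sum_(c <- X) u c * (v c)^*.
Proof. by move=> vX; apply: fsbigTE => c /vX ->; rewrite conjC0 mulr0. Qed.

Lemma nsqE X u : supported_in X u -> nsq u = \sum_(c <- X) normc (u c) ^+ 2.
Proof. by move=> uX; apply: fsbigTE => c /uX ->; rewrite Normc.normc0 expr0n. Qed.

Lemma nsq_ge0 u : 0 <= nsq u.
Proof. by apply: fsumr_ge0 => c _; exact: sqr_ge0. Qed.

Lemma l2_ge0 u : 0 <= l2 u. Proof. exact: sqrtr_ge0. Qed.

Lemma sqr_l2 u : l2 u ^+ 2 = nsq u.
Proof. by rewrite sqr_sqrtr// nsq_ge0. Qed.

Lemma pball2P u A : finite_support u -> 0 <= A -> pball 2%:E u A <-> l2 u <= A.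
Proof.
move=> [X uX] A0; have two0 : (0 : R) < 2 by lra.
have sq a : 0 <= a -> a `^ 2 = a ^+ 2 :> R by move=> a0; rewrite -powR_mulrn.
rewrite (pball_finP _ two0 A0) sq//.
have E2 Y : \sum_(c <- Y) normc (u c) `^ 2 = \sum_(c <- Y) normc (u c) ^+ 2.
  by apply: eq_bigr => c _; rewrite sq ?normc_ge0.
rewrite -(ler_pXn2r (_ : 0 < 2)%N) ?nnegrE ?l2_ge0// sqr_l2 (nsqE uX).
split=> [/(_ X)|uA Y]; rewrite E2//; apply: le_trans uA.
apply: (@le_trans _ _ (\sum_(c <- (X `|` Y)%fset) normc (u c) ^+ 2)).
  by apply: fsum_le => c; rewrite ?sqr_ge0// => cY; rewrite inE cY orbT.
rewrite (@fsum_restrict _ _ X)// => c; first by move/uX->; rewrite Normc.normc0 expr0n.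
by move=> cX; rewrite inE cX.
Qed.

Lemma l2D u v : finite_support u -> finite_support v ->
  l2 (fun c => u c + v c) <= l2 u + l2 v.
Proof.
move=> fu fv; apply/pball2P; last first.
- by apply: pballD => //; rewrite ?l2_ge0//; apply/pball2P; rewrite ?l2_ge0.
- by rewrite addr_ge0 ?l2_ge0.
have [[X uX] [Y vY]] := (fu, fv); exists (X `|` Y)%fset => x.
by rewrite inE negb_or => /andP[/uX -> /vY ->]; rewrite addr0.
Qed.

Lemma l2_lam f u : finite_support u -> l2 (lam f u) <= n2 f * l2 u.
Proof.
move=> fu; apply/pball2P; first exact: finite_support_lam.
  by rewrite mulr_ge0 ?l2_ge0 ?onorm_ge0.
by apply: onorm_op_le; rewrite ?l2_ge0//; apply/pball2P; rewrite ?l2_ge0.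
Qed.

Lemma nsq_lam f u : finite_support u -> nsq (lam f u) <= n2 f ^+ 2 * nsq u.
Proof.
move=> fu; rewrite -!sqr_l2 -exprMn lerXn2r ?nnegrE ?l2_ge0 ?mulr_ge0 ?l2_ge0 ?onorm_ge0//.
exact: l2_lam.
Qed.

Lemma n2_le f A : 0 <= A ->
  (forall u, finite_support u -> nsq (lam f u) <= A ^+ 2 * nsq u) -> n2 f <= A.
Proof.
move=> A0 fA; apply: onorm_le => //; apply: op_le_finite_support => // u B fu B0.
move/(pball2P fu B0) => uB; apply/pball2P; [exact: finite_support_lam|exact: mulr_ge0|].
rewrite -(ler_pXn2r (_ : 0 < 2)%N) ?nnegrE ?l2_ge0 ?mulr_ge0// exprMn sqr_l2.
apply: le_trans (fA _ fu) _; rewrite ler_wpM2l ?sqr_ge0// -sqr_l2.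
by rewrite lerXn2r ?nnegrE ?l2_ge0.
Qed.

Lemma cauchy_schwarz u v : finite_support u -> finite_support v ->
  normc (inner u v) <= l2 u * l2 v.
Proof.
move=> fu fv; have [X vX] := fv; rewrite (innerE _ vX).
apply: le_trans (normc_sum _ _) _.
under eq_bigr do rewrite Normc.normcM normc_conj.
apply: (hoelder_fin _ one_le_two); rewrite ?l2_ge0//; first by apply/pball2P; rewrite ?l2_ge0.
by rewrite hoelder_conjugate2; apply/pball2P; rewrite ?l2_ge0.
Qed.

Lemma inner_adjoint f u v : finite_support v -> inner (lam (star f) u) v = inner u (lam f v).
Proof.
move=> [X vX]; have [S fS] := cg_support f.
by rewrite (innerE _ vX) (lam_adjoint _ fS vX) (innerE _ (supported_lam fS vX)).
Qed.

Lemma inner_self u : finite_support u -> inner u u = (nsq u)%:C%C.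
Proof.
move=> [X uX]; rewrite (innerE _ uX) (nsqE uX) rmorph_sum.
by apply: eq_bigr => c _; rewrite mul_conj.
Qed.

Lemma inner_lam_star_mul f u : finite_support u ->
  inner (lam (star f * f) u) u = (nsq (lam f u))%:C%C.
Proof.
by move=> fu; rewrite lamM inner_adjoint// inner_self//; exact: finite_support_lam.
Qed.

Lemma n2_star f : n2 (star f) <= n2 f.
Proof. by apply: onorm_star_le => //; rewrite hoelder_conjugate2. Qed.

Lemma sqr_normcE (z : R[i]) : normc z ^+ 2 = complex.Re z ^+ 2 + complex.Im z ^+ 2.
Proof. by case: z => a b; rewrite /Normc.normc sqr_sqrtr// addr_ge0 ?sqr_ge0. Qed.

Lemma ler_sqr_ge0 (a b : R) : 0 <= a -> a <= b -> a ^+ 2 <= b ^+ 2.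
Proof. by move=> a0 ab; rewrite lerXn2r ?nnegrE// (le_trans a0). Qed.

Lemma lower_middle_term (r a b c : R) :
  b <= r * a -> r ^+ 2 * c - 2 * r * a + b <= r ^+ 2 * c - r * a.
Proof. by lra. Qed.

Lemma sqr_dist_identity (r a b a' b' : R) :
  (r * a - 0 * b - a') ^+ 2 + (r * b + 0 * a - b') ^+ 2 =
  r ^+ 2 * (a ^+ 2 + b ^+ 2) - 2 * r * (a' * a - b' * - b) + (a' ^+ 2 + b' ^+ 2).
Proof. by ring. Qed.

Lemma nsq_sub (r : R) u v : finite_support u -> finite_support v ->
  nsq (fun c => r%:C%C * u c - v c) =
    r ^+ 2 * nsq u - 2 * r * complex.Re (inner v u) + nsq v.
Proof.
move=> [X uX] [Y vY]; pose Z := (X `|` Y)%fset.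
have uZ : supported_in Z u by move=> x; rewrite inE negb_or => /andP[/uX].
have vZ : supported_in Z v by move=> x; rewrite inE negb_or => /andP[_ /vY].
have wZ : supported_in Z (fun c => r%:C%C * u c - v c).
  by move=> x xZ; rewrite uZ// vZ// mulr0 subr0.
rewrite (innerE _ uZ) (nsqE uZ) (nsqE vZ) (nsqE wZ).
have ReE (F : T -> R[i]) : complex.Re (\sum_(c <- Z) F c) = \sum_(c <- Z) complex.Re (F c).
  elim: (enum_fset Z) => [|c s IH]; first by rewrite !big_nil.
  by rewrite !big_cons -IH; case: (F c); case: (\sum_(j <- s) F j).
rewrite ReE !mulr_sumr -sumrB -big_split; apply: eq_bigr => c _ /=.
rewrite !sqr_normcE; case: (u c) => a b; case: (v c) => a' b' /=.
exact: sqr_dist_identity.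
Qed.

(** All the uses of positivity in the C*-algebra reduce to this inequality. *)
Lemma nsq_sub_star_mul (r : R) f u : finite_support u -> n2 f ^+ 2 <= r ->
  nsq (lam (r%:C%C%:A - star f * f) u) <= r ^+ 2 * nsq u - r * nsq (lam f u).
Proof.
move=> fu fr; have r0 : 0 <= r by exact: le_trans (sqr_ge0 _) fr.
have -> : lam (r%:C%C%:A - star f * f) u = (fun c => r%:C%C * u c - lam (star f * f) u c).
  apply/funext => c; rewrite lamD lamZ lam1 -scaleN1r lamZ.
  by rewrite mulN1r.
have fl := finite_support_lam f fu.
rewrite nsq_sub//; last exact: finite_support_lam.
rewrite inner_lam_star_mul//= lamM.
have h0 := onorm_ge0 H one_le_two (star f).
have star_r : n2 (star f) ^+ 2 <= r.
  apply: (@le_trans _ _ (n2 f ^+ 2)); last exact: fr.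
  exact: (ler_sqr_ge0 h0 (n2_star f)).
(* After expanding the square, the term |f* f u|^2 is at most r |f u|^2 and absorbs half of the
   cross term. *)
have := le_trans (nsq_lam (star f) fl) (ler_wpM2r (nsq_ge0 _) star_r).
exact: lower_middle_term.
Qed.

End hilbert_space.

Section real_inequalities.
Variable R : realType.
Implicit Types a b c d r s t : R.

(** [n2_le] expects a bound of the form A^2 with A >= 0. The square root of max 0 s supplies A when
    s is not known to be nonnegative. *)
Lemma sqrt_max0_lt r s : 0 < r -> s < r ^+ 2 -> Num.sqrt (Num.max 0 s) < r.
Proof.
move=> r0 sr; rewrite -[ltRHS]ger0_norm ?ltW// -sqrtr_sqr ltr_sqrt ?exprn_gt0//.
by rewrite gt_max exprn_gt0.
Qed.

Lemma le_max0_mul s t c : 0 <= c -> t <= s * c -> t <= Num.sqrt (Num.max 0 s) ^+ 2 * c.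
Proof.
move=> c0 ts; rewrite sqr_sqrtr ?le_max ?lexx//; apply: le_trans ts _.
by rewrite ler_wpM2r// le_max lexx orbT.
Qed.

Lemma absorb_left a b c q : q < 1 -> 0 <= a -> 0 <= b -> 0 <= c ->
  c <= a * b + q * c -> ((1 - q) / (a + 1)) ^+ 2 * c ^+ 2 <= b ^+ 2.
Proof.
move=> q1 a0 b0 c0 h; have a1 : 0 < a + 1 by lra.
have q1' : 0 <= 1 - q by lra.
have d0 : 0 <= (1 - q) / (a + 1) * c.
  by apply: mulr_ge0 => //; apply: divr_ge0 => //; exact: ltW.
rewrite -exprMn lerXn2r ?nnegrE//.
by rewrite mulrAC ler_pdivrMr//; nra.
Qed.

Lemma key_lower r x y c : 0 <= r -> y * c <= x -> r ^+ 2 * c - r * x <= (r ^+ 2 - r * y) * c.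
Proof. by move=> r0 h; nra. Qed.

End real_inequalities.

Lemma complex_split (R : realType) (z : R[i]) :
  z = (complex.Re z)%:C%C + (0 +i* complex.Im z)%C.
Proof. by case: z => p q; simpc. Qed.

(** * Positivity and spectrum in the C*-algebra *)

Section cstar_facts.
Variables (R : realType) (G : groupType) (H : groupClosed G).
Local Notation T := (cosets H).
Local Notation E := (cg R G).
Local Notation lam := (@lam R G H).
Local Notation n2 := (@onorm R G H 2%:E).
Local Notation finite_support := (@finite_support R G H).
Implicit Types (a b f g d x : E) (u v w : T -> R[i]) (z : R[i]).

Lemma n2_seminorm : algebra_seminorm n2.
Proof. by apply: onorm_seminorm; exact: one_le_two. Qed.

Let n2_ge0 f : 0 <= n2 f := sn_ge0 n2_seminorm f.

Lemma n2_1 : n2 1 <= 1.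
Proof. by apply: n2_le => // u fu; rewrite lam1 expr1n mul1r. Qed.

Lemma n2_scalar (z : R[i]) : n2 z%:A <= normc z.
Proof.
rewrite (snZ n2_seminorm) -[leRHS]mulr1.
by apply: (ler_wpM2l (normc_ge0 z)); exact: n2_1.
Qed.

(** Write u = b (x u) + (1 - b x) u and absorb the last term, whose norm is a fraction of that of
    u. *)
Lemma lower_bound_of_near_inv x : near_inv n2 x ->
  exists2 e : R, 0 < e & forall u, finite_support u -> e * nsq u <= nsq (lam x u).
Proof.
move=> [b [_ bx]]; exists (((1 - n2 (b * x - 1)) / (n2 b + 1)) ^+ 2).
  by rewrite exprn_gt0// divr_gt0 ?subr_gt0// ltr_wpDl.
move=> u fu; rewrite -!sqr_l2; apply: absorb_left; rewrite ?l2_ge0//.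
have fx := finite_support_lam x fu.
have fb := finite_support_lam b fx; have fe := finite_support_lam (1 - b * x) fu.
have uE : u = fun c => lam b (lam x u) c + lam (1 - b * x) u c.
  apply/funext => c; rewrite -lamM lamD lam1 -scaleN1r lamZ mulN1r.
  by rewrite addrC subrK.
rewrite {1}uE; apply: le_trans (l2D fb fe) _; apply: lerD; first exact: l2_lam.
by rewrite (snBC n2_seminorm) l2_lam.
Qed.

Lemma n2_sub_star_mul_lt (r e : R) d : 0 < r -> 0 < e -> n2 d ^+ 2 <= r ->
  (forall u, finite_support u -> e * nsq u <= nsq (lam d u)) ->
  n2 (r%:C%C%:A - star d * d) < r.
Proof.
move=> r0 e0 dr de.
apply: (@le_lt_trans _ _ (Num.sqrt (Num.max 0 (r ^+ 2 - r * e)))); last first.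
  by apply: sqrt_max0_lt => //; rewrite gtrBl mulr_gt0.
apply: n2_le => [|u fu]; first exact: sqrtr_ge0.
apply: le_max0_mul; first exact: nsq_ge0.
apply: le_trans (nsq_sub_star_mul fu dr) _.
exact: (key_lower (ltW r0) (de u fu)).
Qed.

Lemma n2_sub_star_mul_le (r : R) d : n2 d ^+ 2 <= r -> n2 (r%:C%C%:A - star d * d) <= r.
Proof.
move=> dr; have r0 : 0 <= r := le_trans (sqr_ge0 _) dr.
apply: n2_le => // u fu; apply: le_trans (nsq_sub_star_mul fu dr) _.
by rewrite gerBl mulr_ge0// nsq_ge0.
Qed.

(** With r = (n2 d)^2, the element is s + r minus [r - star d * d], which has norm at most r < s +
    r. *)
Lemma near_inv_add_star_mul (s : R) d : 0 < s -> near_inv n2 (s%:C%C%:A + star d * d).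
Proof.
move=> s0; pose r := n2 d ^+ 2; have r0 : 0 <= r by exact: sqr_ge0.
have sr : 0 < s + r by rewrite ltr_pwDl.
have srC : (s + r)%:C%C != 0 :> R[i] by rewrite realC_eq0 gt_eqF.
have -> : s%:C%C%:A + star d * d =
    (s + r)%:C%C *: (1 - (s + r)%:C%C^-1 *: (r%:C%C%:A - star d * d)).
  rewrite scalerBr scalerA mulfV// scale1r opprB [_ * _ - _]addrC addrA.
  by rewrite (rmorphD (real_complex R)) /= scalerDl addrK.
apply: near_invZ => //; apply: (@near_inv_1sub _ _ _ n2_seminorm _ 1).
rewrite expr1 (snZ n2_seminorm) Normc.normcV normc_real (ger0_norm (ltW sr)).
rewrite ltr_pdivrMl// mulr1; apply: (@le_lt_trans _ _ r); last by rewrite ltrDr.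
exact: n2_sub_star_mul_le.
Qed.

(** For z = x + i y and w = x - a, the product of w + i y and w - i y in either order is w^2 + y^2,
    which is invertible by positivity of w^2. *)
Lemma near_inv_nonreal a z : star a = a -> z \isn't Num.real -> near_inv n2 (z%:A - a).
Proof.
move=> sa znr; pose x := complex.Re z; pose y := complex.Im z.
pose w := x%:C%C%:A - a; pose mu := (0 +i* y)%C : R[i].
have zE : z = x%:C%C + mu by exact: complex_split.
have y0 : y != 0 by apply: contra znr => /eqP y0; rewrite zE /mu y0 addr0 complex_real.
have sw : star w = w by rewrite starB star_realZ star1 sa.
have mu2 : mu ^+ 2 = - (y ^+ 2)%:C%C by rewrite /mu expr2; simpc; rewrite expr2.
have -> : z%:A - a = w + mu%:A by rewrite zE scalerDl addrAC.
have h : near_inv n2 (w ^+ 2 - (mu ^+ 2)%:A).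
  have y2 : 0 < y ^+ 2 by rewrite exprn_even_gt0.
  have := near_inv_add_star_mul w y2.
  by rewrite mu2 scaleNr opprK [w ^+ 2 + _]addrC expr2 sw.
apply: (near_inv_mul_cancel n2_seminorm (y := w - mu%:A)); last by rewrite sub_add_scalar.
by have := sub_add_scalar w (- mu); rewrite scaleNr opprK sqrrN => ->.
Qed.

Lemma near_inv_star_mul d z : ~~ (0 <= z) -> near_inv n2 (z%:A - star d * d).
Proof.
move=> z0; have [zr|] := boolP (z \is Num.real); last first.
  by apply: near_inv_nonreal; rewrite starM starK.
have [x xE] := complex_realP _ zr; rewrite xE ler0c -ltNge in z0.
rewrite xE -[_ - _](opprK) opprB addrC -scaleNr.
rewrite -(rmorphN (real_complex R)) -scaleN1r; apply: near_invZ.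
  by rewrite oppr_eq0 oner_eq0.
by apply: near_inv_add_star_mul; rewrite oppr_gt0.
Qed.

(** If neither n2 a nor its negative were in the spectrum, r - a^2 with r = (n2 a)^2 would be
    invertible, hence bounded below. This would improve the estimate of a u to one strictly below n2
    a. *)
Lemma n2_in_spectrum a : star a = a ->
  ~ (near_inv n2 ((n2 a)%:C%C%:A - a) /\ near_inv n2 ((- n2 a)%:C%C%:A - a)).
Proof.
move=> sa [h1 h2]; pose r := n2 a ^+ 2.
have r0 : 0 <= r by exact: sqr_ge0.
have {h1 h2} : near_inv n2 (r%:C%C%:A - star a * a).
  have := near_inv_mul n2_seminorm h1 h2.
  rewrite (rmorphN (real_complex R)) /= scaleNr -opprD [_%:A + a]addrC.
  rewrite -[_%:A - a]opprB mulrNN sub_add_scalar => /(near_invZ (_ : -1 != 0)).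
  rewrite oppr_eq0 oner_eq0 => /(_ isT); rewrite scaleN1r opprB.
  by rewrite -(rmorphXn (real_complex R)) expr2 sa.
move=> /lower_bound_of_near_inv[e e0 He].
have bound u : finite_support u -> r * nsq (lam a u) <= (r ^+ 2 - e) * nsq u.
  move=> fu; have := le_trans (He u fu) (nsq_sub_star_mul fu (lexx r)).
  by rewrite mulrBl lerBrDl addrC -lerBrDl.
(* For r = 0 the bound reads 0 <= - e |u|^2, which fails for a point mass u. *)
have [r_eq0|rN0] := eqVneq r 0.
  pose t : T := (\pi_(cosets H) 1%g)%qT.
  have ut : supported_in [fset t]%fset (fun c => (c == t)%:R : R[i]).
    by move=> c; rewrite inE => /negbTE ->.
  have ft : finite_support (fun c => (c == t)%:R : R[i]) by exists [fset t]%fset.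
  have := bound _ ft; rewrite (nsqE ut) big_seq_fset1 eqxx.
  by rewrite Normc.normc1 expr1n mulr1 r_eq0 mul0r expr0n/= add0r oppr_ge0 leNgt e0.
have {rN0}rp : 0 < r by rewrite lt_def rN0.
have : n2 a <= Num.sqrt (Num.max 0 (r - e / r)).
  apply: n2_le => [|u fu]; first exact: sqrtr_ge0.
  apply: le_max0_mul; first exact: nsq_ge0.
  rewrite -(ler_pM2l rp) mulrA mulrBr [r * (e / r)]mulrC divfK ?gt_eqF//.
  exact: bound.
rewrite leNgt => /negP; apply; apply: sqrt_max0_lt.
  by rewrite lt_def n2_ge0 andbT; apply: contraTneq rp => na0; rewrite /r na0 expr0n ltxx.
by rewrite -/r gtrBl divr_gt0.
Qed.

(** With d = z - a and r = 1 / eta, the element is eta times [r - star d * d]. The smallness of eta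
    gives (n2 d)^2 <= r, and d is bounded below by |z| - n2 a. *)
Lemma n2_one_sub_lt a (N : E -> R) (z eta : R) : (forall f, n2 f <= N f) -> star a = a ->
  n2 a < `|z| -> 0 < eta -> eta * (`|z| + N a) ^+ 2 <= 1 ->
  n2 (1 - eta%:C%C *: (z%:C%C%:A - a) ^+ 2) < 1.
Proof.
move=> n2N sa az eta0 etaz; pose d := z%:C%C%:A - a; pose r := eta^-1.
have r0 : 0 < r by rewrite invr_gt0.
have sd : star d = d by rewrite starB star_realZ star1 sa.
have zN : 0 <= `|z| + N a by rewrite addr_ge0// (le_trans (n2_ge0 a)).
have dr : n2 d ^+ 2 <= r.
  apply: (@le_trans _ _ ((`|z| + N a) ^+ 2)).
    apply: ler_sqr_ge0; first exact: n2_ge0.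
    apply: le_trans (snB n2_seminorm _ _) _; apply: lerD; last exact: n2N.
    by apply: le_trans (n2_scalar _) _; rewrite normc_real.
  by rewrite -[r]mulr1 ler_pdivlMl.
have t0 : 0 < (`|z| - n2 a) ^+ 2 by rewrite exprn_gt0// subr_gt0.
have low u : finite_support u -> (`|z| - n2 a) ^+ 2 * nsq u <= nsq (lam d u).
  move=> fu; rewrite -!sqr_l2 -exprMn; apply: ler_sqr_ge0.
    by rewrite mulr_ge0 ?l2_ge0// subr_ge0 ltW.
  rewrite mulrBl lerBlDr.
  have fd := finite_support_lam d fu; have fa := finite_support_lam a fu.
  have zuE : (fun c => z%:C%C * u c) = (fun c => lam d u c + lam a u c).
    apply/funext => c; rewrite [lam d u]lamD lamZ lam1 -scaleN1r lamZ mulN1r.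
    by rewrite subrK.
  have -> : `|z| * l2 u = l2 (fun c => z%:C%C * u c).
    have [X uX] := fu.
    have zuX : supported_in X (fun c => z%:C%C * u c) by move=> c /uX ->; rewrite mulr0.
    rewrite /l2 (nsqE uX) (nsqE zuX).
    under [in RHS]eq_bigr do rewrite Normc.normcM normc_real exprMn.
    by rewrite -mulr_sumr sqrtrM ?sqr_ge0// sqrtr_sqr normr_id.
  rewrite zuE; apply: le_trans (l2D fd fa) _; apply: lerD; first exact: lexx.
  exact: l2_lam.
have := n2_sub_star_mul_lt r0 t0 dr low.
have etaC : eta%:C%C * r%:C%C = 1 :> R[i].
  by rewrite -(rmorphM (real_complex R)) /= mulfV// gt_eqF.
have -> : 1 - eta%:C%C *: d ^+ 2 = eta%:C%C *: (r%:C%C%:A - star d * d).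
  by rewrite scalerBr scalerA etaC scale1r sd expr2.
rewrite (snZ n2_seminorm) normc_real (ger0_norm (ltW eta0)) => h.
by rewrite -ltr_pdivlMl// mulr1.
Qed.

End cstar_facts.

(** The ratios of a log-convex sequence increase, so y m >= y 0 c^m with c = y 1 / y 0. Comparing
    growth rates gives c <= A, whatever the constant C. *)
Lemma log_convex_bound (R : realType) (y : nat -> R) (A C : R) : 0 <= A ->
  (forall m, 0 <= y m) -> (forall m, y m.+1 ^+ 2 <= y m.+2 * y m) ->
  (forall m, y m ^+ 2 <= C * (A ^+ 2) ^+ m) -> y 1%N <= A * y 0%N.
Proof.
move=> A0 y0 ycv yC.
have [y00|y0N] := eqVneq (y 0%N) 0.
  have := ycv 0%N; rewrite y00 mulr0 => h.
  have /eqP : y 1%N ^+ 2 == 0 by rewrite eq_le h sqr_ge0.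
  by move/eqP; rewrite sqrf_eq0 => /eqP ->; rewrite mulr0.
have {y0N}y0p : 0 < y 0%N by rewrite lt_def y0N y0.
have [y10|y1N] := eqVneq (y 1%N) 0; first by rewrite y10 mulr_ge0.
have {y1N}y1p : 0 < y 1%N by rewrite lt_def y1N y0.
pose c := y 1%N / y 0%N.
have c0 : 0 < c by rewrite divr_gt0.
have step m : 0 < y m /\ c * y m <= y m.+1.
  elim: m => [|m [ym IH]]; first by rewrite divfK ?gt_eqF.
  have ym1 : 0 < y m.+1 by apply: lt_le_trans IH; rewrite mulr_gt0.
  split=> //; rewrite -(ler_pM2r ym); apply: le_trans (ycv m).
  by rewrite mulrAC expr2 ler_wpM2r.
have ycm m : y 0%N * c ^+ m <= y m.
  elim: m => [|m IH]; first by rewrite expr0 mulr1.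
  apply: le_trans (step m).2; rewrite exprS mulrCA ler_wpM2l//; exact: ltW.
have ycm2 m : y 0%N ^+ 2 * (c ^+ 2) ^+ m <= C * (A ^+ 2) ^+ m.
  apply: le_trans (yC m); rewrite -exprM mulnC exprM -exprMn.
  by apply: ler_sqr_ge0 => //; rewrite mulr_ge0// exprn_ge0// ltW.
suff cA : c <= A by rewrite -ler_pdivrMr.
have [A_eq0|AN0] := eqVneq A 0.
  have := ycm2 1%N; rewrite A_eq0 expr0n /= expr1 mulr0 => h.
  by have := lt_le_trans (mulr_gt0 (exprn_gt0 2 y0p) (exprn_gt0 2 c0)) h; rewrite ltxx.
have Ap : 0 < A by rewrite lt_def AN0.
have A2 : 0 < A ^+ 2 by rewrite exprn_gt0.
have q0 : 0 <= c ^+ 2 / A ^+ 2 by rewrite divr_ge0// ?sqr_ge0.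
have := @le_of_expr_bound R _ (y 0%N ^+ 2) C q0 (exprn_gt0 2 y0p).
rewrite ler_pdivrMr// mul1r ler_pXn2r ?nnegrE ?(ltW c0)//; apply => n.
rewrite exprMn exprVn mulrA ler_pdivrMr ?exprn_gt0//; exact: ycm2.
Qed.

(** * Comparison of the norms *)

Section norm_comparison.
Variables (R : realType) (G : groupType) (H : groupClosed G).
Local Notation T := (cosets H).
Local Notation E := (cg R G).
Local Notation lam := (@lam R G H).
Local Notation onorm := (@onorm R G H).
Local Notation n2 := (onorm 2%:E).
Local Notation finite_support := (@finite_support R G H).
Implicit Types (a b f g : E) (p q : \bar R) (u v w : T -> R[i]) (X Y : {fset T}).

Lemma inner_lam_selfadjoint a u v : star a = a -> finite_support v ->
  inner (lam a u) v = inner u (lam a v).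
Proof. by move=> sa fv; rewrite -inner_adjoint// sa. Qed.

Lemma l2_log_convex a u : star a = a -> finite_support u ->
  l2 (lam a u) ^+ 2 <= l2 (lam a (lam a u)) * l2 u.
Proof.
move=> sa fu; have fau := finite_support_lam a fu.
have faau := finite_support_lam a fau.
apply: le_trans (cauchy_schwarz faau fu); rewrite inner_lam_selfadjoint//.
by rewrite inner_self// normc_real sqr_l2 ger0_norm ?nsq_ge0.
Qed.

Lemma pball_lamX p a u B n : (1 <= p)%E -> 0 <= B -> pball p u B ->
  pball p (lam (a ^+ n) u) (onorm p a ^+ n * B).
Proof.
move=> p1 B0 uB; have a0 := onorm_ge0 H p1 a.
elim: n => [|n IH]; first by rewrite !expr0 lam1 mul1r.
rewrite exprS lamM [onorm p a ^+ n.+1]exprS -mulrA; apply: onorm_op_le => //.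
by rewrite mulr_ge0// exprn_ge0.
Qed.

(** The square of the l^2 norm of a^m u is the inner product of a^(2m) u with u. Hoelder's
    inequality bounds it by a constant times the 2m-th power of the l^p norm of a, and log-convexity
    in m removes the constant. *)
Lemma n2_le_onorm_selfadjoint p a : (1 <= p)%E -> (1 <= hoelder_conjugate p)%E ->
  star a = a -> n2 a <= onorm p a.
Proof.
move=> p1 q1 sa; have A0 := onorm_ge0 H p1 a.
apply: n2_le => // u fu; have [X uX] := fu.
have uB := pball_finite_support p1 uX; have uB' := pball_finite_support q1 uX.
set B := \sum_(d <- X) normc (u d) in uB uB'.
have B0 : 0 <= B by apply: sumr_ge0 => d _; exact: normc_ge0.
rewrite -!sqr_l2 -exprMn; apply: ler_sqr_ge0; first exact: l2_ge0.
have fX n : finite_support (lam (a ^+ n) u) by exact: finite_support_lam.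
have := @log_convex_bound R (fun m => l2 (lam (a ^+ m) u)) (onorm p a) (B * B) A0.
rewrite expr0 lam1 expr1; apply.
- by move=> m; exact: l2_ge0.
- by move=> m; rewrite [a ^+ m.+2]exprS [a ^+ m.+1]exprS !lamM; apply: l2_log_convex.
move=> m; have sam : star (a ^+ m) = a ^+ m by rewrite starX sa.
have -> : l2 (lam (a ^+ m) u) ^+ 2 = normc (inner (lam (a ^+ (m + m)) u) u).
  have -> : inner (lam (a ^+ (m + m)) u) u = (nsq (lam (a ^+ m) u))%:C%C.
    by rewrite -(inner_lam_star_mul (a ^+ m) fu) sam exprD.
  by rewrite normc_real sqr_l2 ger0_norm// nsq_ge0.
rewrite (innerE _ uX); apply: le_trans (normc_sum _ _) _.
under eq_bigr do rewrite Normc.normcM normc_conj.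
rewrite -exprM mul2n -addnn [B * B * _]mulrC mulrA.
apply: (hoelder_fin _ p1) => //; first by rewrite mulr_ge0// exprn_ge0.
exact: pball_lamX.
Qed.

Section schur_test.
Variables (f : E) (A : R).
Hypotheses (A0 : 0 < A) (f1 : op_le 1%E (lam f) A) (fy : op_le +oo%E (lam f) A).

Local Notation delta := (fun d (c : T) => (c == d)%:R : R[i]).

Lemma lam_expand Y u c : supported_in Y u ->
  lam f u c = \sum_(d <- Y) lam f (delta d) c * u d.
Proof.
move=> uY; have [S fS] := cg_support f.
rewrite (lamE _ _ fS); under [RHS]eq_bigr do rewrite (lamE _ _ fS) mulr_suml.
rewrite exchange_big /=; apply: eq_bigr => y _.
under [RHS]eq_bigr do rewrite -mulrA; rewrite -mulr_sumr; congr (_ * _).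
set c' := coset_act _ c.
rewrite (@eq_fsum_support _ _ Y [fset c']%fset) ?big_seq_fset1 ?eqxx ?mul1r//.
  by move=> d /uY ->; rewrite mulr0.
by move=> d; rewrite inE eq_sym => /negbTE ->; rewrite mul0r.
Qed.

Lemma schur_column X d : \sum_(c <- X) normc (lam f (delta d) c) <= A.
Proof.
have := f1 ler01 (pball_delta (lexx _) d); rewrite mulr1.
by move/(pball1P _ (ltW A0)); exact.
Qed.

(** The l^oo bound is tested on the conjugate phases of the row. *)
Lemma schur_row Y c : \sum_(d <- Y) normc (lam f (delta d) c) <= A.
Proof.
pose v := restrict Y (fun d => (phase (lam f (delta d) c))^*).
have vY : supported_in Y v by move=> d /negbTE dY; rewrite /v /restrict dY.
have v1 : pball +oo%E v 1.
  apply/pball_inftyP => d; rewrite /v /restrict; case: ifP => _.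
    by rewrite normc_conj normc_phase_le.
  by rewrite Normc.normc0 ler01.
have := fy ler01 v1; rewrite mulr1 => /pball_inftyP/(_ c).
rewrite (lam_expand _ vY).
have -> : \sum_(d <- Y) lam f (delta d) c * v d =
    (\sum_(d <- Y) normc (lam f (delta d) c))%:C%C.
  rewrite rmorph_sum; apply: eq_big_seq => d dY.
  by rewrite /v /restrict dY mul_conj_phase.
by rewrite normc_real; apply: le_trans; exact: ler_norm.
Qed.

(** Jensen's inequality is applied in each row, whose entries have total mass at most A, and the
    result is summed along the columns. *)
Lemma schur_test p : (1 <= p)%E -> op_le p (lam f) A.
Proof.
move=> p1; case: (exponent_cases p1) => [[r r1 ->]|->//].
apply: op_le_finite_support; [by rewrite lee_fin|exact: ltW|].
move=> u B [Y uY] B0.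
have r0 : 0 < r by exact: lt_le_trans r1.
move=> /(pball_finP _ r0 B0) uB; apply/(pball_finP _ r0) => [|X].
  by rewrite mulr_ge0// ltW.
apply: (@le_trans _ _ (\sum_(c <- X)
    A `^ (r - 1) * \sum_(d <- Y) normc (lam f (delta d) c) * normc (u d) `^ r)).
  apply: ler_sum => c _; rewrite (lam_expand _ uY).
  have := @powR_jensen R _ (enum_fset Y) (fun d => normc (lam f (delta d) c))
    (fun d => normc (u d)) A r r1 A0 (fun d => normc_ge0 _) (fun d => normc_ge0 _)
    (schur_row Y c).
  apply: le_trans; apply: ge0_ler_powR; rewrite ?nnegrE ?normc_ge0 ?(ltW r0)//.
    by apply: sumr_ge0 => d _; rewrite mulr_ge0 ?normc_ge0.
  apply: le_trans (normc_sum _ _) _.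
  by rewrite le_eqVlt; apply/orP; left; apply/eqP/eq_bigr => d _; rewrite Normc.normcM.
rewrite -mulr_sumr exchange_big /=.
have -> : (A * B) `^ r = A `^ (r - 1) * (A * B `^ r).
  rewrite powRM ?(ltW A0)// mulrA -[X in _ * X * _]powRr1 ?(ltW A0)//.
  by rewrite -powRD ?(gt_eqF A0) ?implybT// subrK.
rewrite ler_wpM2l ?powR_ge0//.
apply: (@le_trans _ _ (\sum_(d <- Y) A * normc (u d) `^ r)).
  apply: ler_sum => d _; rewrite -mulr_suml ler_wpM2r ?powR_ge0//.
  exact: schur_column.
by rewrite -mulr_sumr; apply: (ler_wpM2l (ltW A0)); exact: uB.
Qed.

End schur_test.

Lemma onorm_le_max p f : (1 <= p)%E ->
  onorm p f <= Num.max (onorm 1%E f) (onorm +oo%E f).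
Proof.
move=> p1; set M := Num.max _ _.
have y1 : ((1 : \bar R) <= +oo)%E by rewrite leey.
have M0 : 0 <= M by rewrite le_max (onorm_ge0 H (lexx 1%E)).
(* The Schur test asks for a positive bound, and the maximum may be 0. *)
apply/ler_addgt0Pr => e e0; have Me : 0 < M + e by rewrite ltr_wpDl.
have mono q : (1 <= q)%E -> onorm q f <= M -> op_le q (lam f) (M + e).
  move=> q1 qM u B B0 uB; apply: pball_le (onorm_op_le q1 f B0 uB).
  by apply: ler_wpM2r => //; apply: le_trans qM _; rewrite lerDl ltW.
apply: onorm_le => //; first exact: ltW.
apply: schur_test => //.
  by apply: mono; rewrite ?lexx// le_max lexx.
by apply: mono => //; rewrite le_max lexx orbT.
Qed.

Lemma onorm1_le_columns f A : 0 <= A ->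
  (forall d, pball 1%E (lam f (fun c => (c == d)%:R)) A) -> onorm 1%E f <= A.
Proof.
move=> A0 fA; apply: onorm_le => //; apply: op_le_finite_support => // u B [Y uY] B0.
have one1 : ((1 : \bar R) <= 1)%E by [].
move=> /(pball1P _ B0)/(_ Y) uB.
rewrite (_ : lam f u = fun c => \sum_(d <- Y) u d * lam f (fun c => (c == d)%:R) c).
  apply: pball_le (pball_sum one1 _ (A := fun d => normc (u d) * A) _ _).
  - by rewrite -mulr_suml mulrC; exact: ler_wpM2l.
  - by move=> d; rewrite mulr_ge0 ?normc_ge0.
  - by move=> d; apply: pballZ => //; exact: fA.
by apply/funext => c; rewrite (lam_expand _ _ uY); apply: eq_bigr => d _; rewrite mulrC.
Qed.

End norm_comparison.

Lemma max_seminorm (R : realType) (E : algType R[i]) (N N' : E -> R) :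
  algebra_seminorm N -> algebra_seminorm N' ->
  algebra_seminorm (fun x => Num.max (N x) (N' x)).
Proof.
move=> sN sN'; have N0 := sn_ge0 sN; have N'0 := sn_ge0 sN'.
have m1 x : N x <= Num.max (N x) (N' x) by rewrite le_max lexx.
have m2 x : N' x <= Num.max (N x) (N' x) by rewrite le_max lexx orbT.
split=> [x y|z x|x y].
- rewrite ge_max (le_trans (snD sN _ _) (lerD (m1 x) (m1 y))).
  exact: le_trans (snD sN' _ _) (lerD (m2 x) (m2 y)).
- by rewrite (snZ sN) (snZ sN') maxr_pMr// normc_ge0.
- rewrite ge_max (le_trans (snM sN _ _) (ler_pM (N0 x) (N0 y) (m1 x) (m1 y))).
  exact: le_trans (snM sN' _ _) (ler_pM (N'0 x) (N'0 y) (m2 x) (m2 y)).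
Qed.

Lemma one_le_hoelder_conjugate (R : realType) (p : R) : 1 <= p ->
  ((1 : \bar R) <= hoelder_conjugate p%:E)%E.
Proof.
rewrite le_eqVlt => /orP[/eqP<-|p1]; first by rewrite hoelder_conjugate1 leey.
rewrite hoelder_conjugate_fin// lee_fin ler_pdivlMr ?subr_gt0// mul1r.
by rewrite gerBl ler01.
Qed.

(** * The norms of the pseudofunction algebras *)

Section pseudofunction_norms.
Variables (R : realType) (G : groupType) (H : groupClosed G).
Local Notation T := (cosets H).
Local Notation E := (cg R G).
Local Notation lam := (@lam R G H).
Local Notation onorm := (@onorm R G H).
Local Notation n2 := (onorm 2%:E).
Implicit Types (a b f g : E) (p : R) (u v w : T -> R[i]) (X Y : {fset T}).

Definition pfnorm p f := Num.max (onorm p%:E f) (onorm (hoelder_conjugate p%:E) f).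

Lemma PFnormE p f : 1 <= p -> PFnorm H p f = (pfnorm p f)%:E.
Proof.
move=> p1; have q1 := one_le_hoelder_conjugate p1.
have p1' : ((1 : \bar R) <= p%:E)%E by rewrite lee_fin.
by rewrite /PFnorm (opnorm_lamE H p1' f) (opnorm_lamE H q1 f) -EFin_max.
Qed.

Lemma pfnorm_seminorm p : 1 <= p -> algebra_seminorm (pfnorm p).
Proof.
move=> p1; apply: max_seminorm; apply: onorm_seminorm; first by rewrite lee_fin.
exact: one_le_hoelder_conjugate.
Qed.

Lemma pfnorm_le1 p f : 1 <= p -> pfnorm p f <= pfnorm 1 f.
Proof.
move=> p1; rewrite {2}/pfnorm hoelder_conjugate1 ge_max !onorm_le_max//.
exact: one_le_hoelder_conjugate.
Qed.

Lemma pfnorm2 f : pfnorm 2 f = n2 f.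
Proof. by rewrite /pfnorm hoelder_conjugate2 maxxx. Qed.

Lemma n2_sqr_le f : n2 f ^+ 2 <= n2 (star f * f).
Proof.
have s0 : 0 <= n2 (star f * f) by apply: onorm_ge0; exact: one_le_two.
suff : n2 f <= Num.sqrt (n2 (star f * f)).
  move=> h; rewrite -[leRHS]sqr_sqrtr//; apply: ler_sqr_ge0 h.
  by apply: onorm_ge0; exact: one_le_two.
apply: n2_le => [|u fu]; first exact: sqrtr_ge0.
rewrite sqr_sqrtr//.
have -> : nsq (lam f u) = normc (inner (lam (star f * f) u) u).
  by rewrite inner_lam_star_mul// normc_real ger0_norm// nsq_ge0.
apply: le_trans (cauchy_schwarz (finite_support_lam _ fu) fu) _.
by rewrite -sqr_l2 expr2 mulrA; apply: ler_wpM2r; [exact: l2_ge0|exact: l2_lam].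
Qed.

(** The self-adjoint case is applied to [star f * f], and the square is recovered from the
    C*-inequality; [star f] on l^p costs the norm of f on the dual space, which is why both
    exponents enter. *)
Lemma n2_le_pfnorm p f : 1 <= p -> n2 f <= pfnorm p f.
Proof.
move=> p1; have q1 := one_le_hoelder_conjugate p1.
have p1' : ((1 : \bar R) <= p%:E)%E by rewrite lee_fin.
have P0 := onorm_ge0 H p1' f; have Q0 := onorm_ge0 H q1 f.
have M0 : 0 <= pfnorm p f by rewrite le_max P0.
have sf : onorm p%:E (star f) <= pfnorm p f.
  apply: (@le_trans _ _ (onorm (hoelder_conjugate p%:E) f)).
    exact: onorm_star_le.
  by rewrite le_max lexx orbT.
have ff : n2 f ^+ 2 <= pfnorm p f ^+ 2.
  apply: le_trans (n2_sqr_le f) _.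
  have ss : star (star f * f) = star f * f by rewrite starM starK.
  have h := n2_le_onorm_selfadjoint H p1' q1 ss.
  apply: le_trans h _.
  apply: le_trans (snM (onorm_seminorm H p1') _ _) _.
  have pf : onorm p%:E f <= pfnorm p f by rewrite le_max lexx.
  rewrite expr2; exact: (ler_pM (onorm_ge0 H p1' (star f)) P0 sf pf).
have N0 : 0 <= n2 f by apply: onorm_ge0; exact: one_le_two.
by move: ff; rewrite ler_pXn2r// nnegrE.
Qed.

Lemma lam_sum (s : seq E) u c : lam (\sum_(g <- s) g) u c = \sum_(g <- s) lam g u c.
Proof.
elim: s => [|g s IH]; last by rewrite !big_cons lamD IH.
by rewrite !big_nil -(scale0r 0) lamZ mul0r.
Qed.

Lemma geometric_mean_le (x y z th : R) : 0 < th < 1 -> 0 <= x -> x <= y -> x <= z ->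
  x <= y `^ (1 - th) * z `^ th.
Proof.
move=> th01 x0 xy xz; have /andP[th0 th1] := th01.
have h1 : 0 <= 1 - th by rewrite subr_ge0 ltW.
rewrite -{1}(powR_split th01 x0); apply: ler_pM; rewrite ?powR_ge0//.
  by apply: ge0_ler_powR; rewrite ?nnegrE// (le_trans x0 xy).
by apply: ge0_ler_powR; rewrite ?nnegrE ?(ltW th0)// (le_trans x0 xz).
Qed.

(** On m points the l^1 norm of a column of g is at most n_1 g, and by Cauchy-Schwarz against the
    indicator of Z at most sqrt m times n_2 g. The weighted geometric mean of both bounds is
    taken. *)
Lemma l1_column_le (Z : {fset T}) (m : nat) g d th : 0 < th < 1 -> (#|` Z| <= m)%N ->
  \sum_(c <- Z) normc (lam g (fun c => (c == d)%:R) c) <=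
  Num.sqrt m%:R `^ th * log_mean (pfnorm 1) n2 th g.
Proof.
move=> th01 Zm; set x := \sum_(c <- Z) _.
have one1 : ((1 : \bar R) <= 1)%E by [].
have n20 : 0 <= n2 g by apply: onorm_ge0; exact: one_le_two.
have pf0 : 0 <= pfnorm 1 g := sn_ge0 (pfnorm_seminorm (lexx 1)) g.
have x0 : 0 <= x by apply: sumr_ge0 => c _; exact: normc_ge0.
have x1 : x <= pfnorm 1 g.
  have := onorm_op_le one1 g ler01 (pball_delta one1 d); rewrite mulr1.
  move/(pball1P _ (onorm_ge0 H one1 g))/(_ Z) => h; apply: le_trans h _.
  by rewrite le_max lexx.
have x2 : x <= Num.sqrt m%:R * n2 g.
  pose i := restrict Z (fun=> 1 : R[i]).
  have iZ : supported_in Z i by move=> c /negbTE cZ; rewrite /i /restrict cZ.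
  have li : l2 i <= Num.sqrt m%:R.
    rewrite /l2 (nsqE iZ); apply: ler_wsqrtr.
    have -> : \sum_(c <- Z) normc (i c) ^+ 2 = \sum_(c <- Z) 1.
      by apply: eq_big_seq => c cZ; rewrite /i /restrict cZ Normc.normc1 expr1n.
    by rewrite big_const_seq count_predT iter_addr_0 ler_nat.
  have iB : pball 2%:E i (Num.sqrt m%:R).
    by apply/pball2P; rewrite ?sqrtr_ge0//; exists Z.
  have := onorm_op_le (one_le_two R) g ler01 (pball_delta (one_le_two R) d).
  rewrite mulr1 => gB; rewrite -hoelder_conjugate2 in iB.
  have := hoelder_fin Z (one_le_two R) n20 (sqrtr_ge0 _) gB iB.
  rewrite mulrC; apply: le_trans; rewrite le_eqVlt; apply/orP; left; apply/eqP.
  by apply: eq_big_seq => c cZ; rewrite /i /restrict cZ Normc.normc1 mulr1.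
rewrite /log_mean mulrCA -powRM ?sqrtr_ge0//.
exact: geometric_mean_le.
Qed.

(** The pieces g of a decomposition of b may have arbitrary supports. Only their values on Z matter,
    the at most [#|S|] cosets that carry the column of b. *)
Lemma pfnorm1_le_interpolated (S : {fset G}) b th : 0 < th < 1 ->
  supported_in S (b : G -> R[i]) -> star b = b ->
  pfnorm 1 b <= Num.sqrt #|` S|%:R `^ th * interpolated (pfnorm 1) n2 th b.
Proof.
move=> th01 bS sb; set k := Num.sqrt _ `^ th; have k0 : 0 <= k by exact: powR_ge0.
have one1 : ((1 : \bar R) <= 1)%E by [].
have y1 : ((1 : \bar R) <= +oo)%E by rewrite leey.
have s1 := pfnorm_seminorm (lexx 1).
apply/ler_addgt0Pr => e e0; have k1 : 0 < k + 1 by rewrite ltr_wpDl.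
have [s [sE se]] := interpolated_decomposition (pfnorm 1) n2 th b (divr_gt0 e0 k1).
have L0 := sum_log_mean_ge0 (pfnorm 1) n2 th s.
apply: (@le_trans _ _ (k * \sum_(g <- s) log_mean (pfnorm 1) n2 th g)); last first.
  apply: le_trans (ler_wpM2l k0 (ltW se)) _.
  rewrite mulrDr lerD2l mulrCA ler_piMr ?(ltW e0)// ler_pdivrMr// mul1r lerDl.
  exact: ler01.
have b1 : onorm 1%E b <= k * \sum_(g <- s) log_mean (pfnorm 1) n2 th g.
  apply: onorm1_le_columns => [|d]; first exact: mulr_ge0.
  apply/pball1P => [|X]; first exact: mulr_ge0.
  pose Z := [fset coset_act y c | y in S, c in [fset d]]%fset.
  have dZ : supported_in Z (lam b (fun c => (c == d)%:R)).
    by apply: supported_lam bS _ => c; rewrite inE => /negbTE ->.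
  have Z0 c : 0 <= normc (lam b (fun c => (c == d)%:R) c) by exact: normc_ge0.
  apply: (@le_trans _ _ (\sum_(c <- Z) normc (lam b (fun c => (c == d)%:R) c))).
    rewrite -(@fsum_restrict _ _ Z (X `|` Z)%fset).
    - by apply: fsum_le => // c cX; rewrite inE cX.
    - by move=> c /dZ ->; rewrite Normc.normc0.
    - by move=> c cZ; rewrite inE cZ orbT.
  apply: (@le_trans _ _ (\sum_(c <- Z) \sum_(g <- s) normc (lam g (fun c => (c == d)%:R) c))).
    by apply: ler_sum => c _; rewrite -sE lam_sum; exact: normc_sum.
  rewrite exchange_big /= mulr_sumr; apply: ler_sum => g _.
  by apply: l1_column_le => //; exact: card_cosets_fset.
rewrite [leLHS]/pfnorm hoelder_conjugate1 ge_max b1 /=.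
apply: le_trans b1.
by rewrite -{1}sb; apply: onorm_star_le; rewrite ?hoelder_conjugatey.
Qed.

Lemma card_support_expr (S : {fset G}) a n : supported_in S (a : G -> R[i]) ->
  exists2 K : {fset G}, supported_in K (a ^+ n : G -> R[i]) & (#|` K| <= #|` S| ^ n)%N.
Proof.
move=> aS; elim: n => [|n [K aK Kn]].
  exists [fset 1%g]%fset; last by rewrite expn0 cardfs1.
  by move=> x; rewrite inE expr0 => /negbTE /= x1; rewrite /delta1 x1.
exists [fset (y * w)%g | y in S, w in K]%fset.
  by rewrite exprS; exact: supported_convolution.
apply: (@leq_trans (size [seq (y * t)%g | y <- enum_fset S, t <- enum_fset K])).
  apply: uniq_leq_size; first exact: fset_uniq.
  by move=> x /imfset2P[y yS [w wK ->]]; apply/allpairsP; exists (y, w).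
by rewrite size_allpairs expnS leq_mul2l Kn orbT.
Qed.

(** Quasi-Hermitianity of a single self-adjoint element already determines its
    spectral radius; finite support enters through the polynomial growth factor
    [#|S| ^ n], whose [th]-th power becomes harmless as [th] tends to 0. *)
Lemma near_inv_pfnorm1 a : star a = a ->
  (forall z : R[i], z \isn't Num.real -> near_inv (pfnorm 1) (z%:A - a)) ->
  forall z : R[i], n2 a < normc z -> near_inv (pfnorm 1) (z%:A - a).
Proof.
move=> sa Hnr; have [S aS] := cg_support a.
(* Adding 1 ensures K >= 1 even when S is empty. *)
pose K := Num.sqrt (#|` S|%:R + 1) : R.
have K1 : 1 <= K.
  by rewrite -[leLHS]sqrtr1; apply: ler_wsqrtr; rewrite lerDr.
have n21 f : n2 f <= pfnorm 1 f by exact: n2_le_pfnorm.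
refine (near_inv_of_real_spectrum (pfnorm_seminorm (lexx 1)) (n2_seminorm R H) n21 K1 Hnr _ _).
- by move=> z eta; apply: n2_one_sub_lt => // f; exact: n2_le_pfnorm.
move=> th n th01; have [Sn aSn cSn] := card_support_expr n aS.
have san : star (a ^+ n) = a ^+ n by rewrite starX sa.
apply: le_trans (pfnorm1_le_interpolated th01 aSn san) _.
apply: ler_wpM2r.
  exact: (interpolated_ge0 (pfnorm 1) n2).
have K0 : 0 <= K by exact: le_trans ler01 K1.
rewrite -powRX//; have /andP[th0 _] := th01.
apply: ge0_ler_powR; rewrite ?nnegrE ?(ltW th0) ?exprn_ge0 ?sqrtr_ge0//.
rewrite -(ler_pXn2r (_ : 0 < 2)%N) ?nnegrE ?sqrtr_ge0 ?exprn_ge0// sqr_sqrtr//.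
rewrite exprAC sqr_sqrtr ?addr_ge0//.
apply: (@le_trans _ _ (#|` S|%:R ^+ n)); first by rewrite -natrX ler_nat.
by rewrite lerXn2r ?nnegrE ?addr_ge0// lerDl.
Qed.

End pseudofunction_norms.

(** * Spectra in the completions *)

Section absolutely_summable_convolution.
Variables (R : realType) (G : groupType) (H : groupClosed G).
Local Notation T := (cosets H).
Local Notation E := (cg R G).
Local Notation lam := (@lam R G H).
Local Notation onorm := (@onorm R G H).
Implicit Types (p : \bar R) (A B : R) (f k : E) (v w : G -> R[i]) (u : T -> R[i]).

Lemma lpP (X : choiceType) (x0 : X) p (g : X -> R[i]) : (1 <= p)%E ->
  lp p g <-> exists2 B, 0 <= B & pball p g B.
Proof.
move=> p1; have := lnorm_ge0 x0 g p1; rewrite /lp /pball /=.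
case: (lnorm p g) => [s||]//.
- by rewrite lee_fin => s0; split=> _; [exists s; rewrite ?lee_fin|rewrite ltry].
- by move=> _; split=> // -[B _]; rewrite leye_eq.
Qed.

Lemma l1_truncation v A e : 0 <= A -> pball 1%E v A -> 0 < e ->
  exists X : {fset G}, pball 1%E (fun y => v y - restrict X v y) e.
Proof.
move=> A0 /(pball1P _ A0) vA e0.
pose S := range (fun X : {fset G} => \sum_(x <- X) normc (v x)).
have hS : has_sup S.
  split; first by exists (\sum_(x <- fset0) normc (v x)), fset0.
  by exists A => _ [X _ <-].
have [_ [X _ <-] Xs] := sup_adherent e0 hS.
exists X; apply/pball1P => [|Y]; first exact: ltW.
have wE x : normc (v x) = normc (restrict X v x) + normc (v x - restrict X v x).
  rewrite /restrict; case: ifP => _; first by rewrite subrr Normc.normc0 addr0.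
  by rewrite Normc.normc0 subr0 add0r.
have YXY : {subset Y <= (X `|` Y)%fset} by move=> x xY; rewrite inE xY orbT.
have XXY : {subset X <= (X `|` Y)%fset} by move=> x xX; rewrite inE xX.
apply: le_trans (fsum_le (F := fun x => normc (v x - restrict X v x)) _ YXY) _.
  by move=> x; exact: normc_ge0.
have : \sum_(x <- (X `|` Y)%fset) normc (v x) <= sup S.
  by apply: ub_le_sup; [case: hS|exists (X `|` Y)%fset].
rewrite (eq_bigr _ (fun x _ => wE x)) big_split /=.
rewrite (fsum_restrict (F := fun x => normc (restrict X v x)) _ XXY); last first.
  by move=> x /negbTE xX; rewrite /restrict xX Normc.normc0.
have -> : \sum_(x <- X) normc (restrict X v x) = \sum_(x <- X) normc (v x).
  by apply: eq_big_seq => x xX; rewrite /restrict xX.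
by move: Xs; clear; lra.
Qed.

Lemma pball1_mul_bounded (s : G -> T) v A u B : 0 <= A -> 0 <= B -> pball 1%E v A ->
  (forall c, normc (u c) <= B) -> pball 1%E (fun y => v y * u (s y)) (A * B).
Proof.
move=> A0 B0 /(pball1P _ A0) vA uB; apply/pball1P => [|X]; first exact: mulr_ge0.
apply: (@le_trans _ _ (\sum_(y <- X) normc (v y) * B)).
  by apply: ler_sum => y _; rewrite Normc.normcM ler_wpM2l ?normc_ge0.
by rewrite -mulr_suml ler_wpM2r.
Qed.

Lemma lambdaD v w A A' u B : 0 <= A -> 0 <= A' -> 0 <= B -> pball 1%E v A ->
  pball 1%E w A' -> (forall c, normc (u c) <= B) ->
  lambda H (fun y => v y + w y) u = (fun c => lambda H v u c + lambda H w u c).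
Proof.
move=> A0 A'0 B0 vA wA uB; apply/funext => c; rewrite /lambda.
under [X in csum X]funext do rewrite mulrDl.
pose s y := (\pi_(cosets H) (y^-1 * repr c)%g)%qT.
apply: csumD (mulr_ge0 A0 B0) (mulr_ge0 A'0 B0) _ _.
  exact: (pball1_mul_bounded s A0 B0 vA uB).
exact: (pball1_mul_bounded s A'0 B0 wA uB).
Qed.

Lemma finsupp_restrict (X : {fset G}) v : restrict X v \in @finsupp R G.
Proof.
apply/finsuppP/finitely_supportedP; exists X => x /negbTE xX.
by rewrite /restrict xX.
Qed.

Definition truncation X v : E := CG (finsupp_restrict X v).

Lemma op_le_lambda p v A : (1 <= p)%E -> 0 <= A -> pball 1%E v A ->
  op_le p (lambda H v) A.
Proof.
move=> p1 A0 vA u B B0 uB; apply: pball_close => // [|e e0]; first exact: mulr_ge0.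
have uB' c : normc (u c) <= B by exact: pball_pointwise uB.
have D0 : 0 < 2 * B + 1 by rewrite ltr_wpDl// mulr_ge0.
have [X vX] := l1_truncation A0 vA (divr_gt0 e0 D0).
set w := (fun y => v y - restrict X v y) in vX.
have e'0 : 0 <= e / (2 * B + 1) by rewrite divr_ge0// ltW.
have one1 : ((1 : \bar R) <= 1)%E by [].
exists (lambda H (restrict X v) u).
  have rX : supported_in X (restrict X v) by move=> x /negbTE xX; rewrite /restrict xX.
  have := pball_conv_act p1 (@coset_act_bij G H) rX B0 uB; apply: pball_le.
  apply: ler_wpM2r => //; have /(pball1P _ A0)/(_ X) := vA; apply: le_trans.
  by rewrite le_eqVlt; apply/orP; left; apply/eqP/eq_big_seq => x xX; rewrite /restrict xX.
move=> c; have -> : lambda H v u c = lambda H (restrict X v) u c + lambda H w u c.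
  rewrite -[RHS]/((fun c => lambda H (restrict X v) u c + lambda H w u c) c).
  rewrite -(lambdaD A0 e'0 B0 (pball_restrict one1 X A0 vA) vX uB').
  by congr (lambda H _ u c); apply/funext => y; rewrite /w addrC subrK.
rewrite addrC addKr.
pose s y := (\pi_(cosets H) (y^-1 * repr c)%g)%qT.
apply: le_trans (normc_csum_le _ (pball1_mul_bounded s e'0 B0 vX uB')) _.
  exact: mulr_ge0.
have -> : 2 * (e / (2 * B + 1) * B) = e * ((2 * B) / (2 * B + 1)) by ring.
by rewrite ler_piMr ?(ltW e0)// ler_pdivrMr// mul1r lerDl ler01.
Qed.

(** Here w is typically a product with an l^1 factor, which need not have finite support, and s the
    l^1 error made by truncating this factor. *)
Lemma onorm_le_perturbation p f s w (c e : R) : (1 <= p)%E -> 0 <= c -> 0 <= e ->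
  (forall y, w y = f y + s y) -> pball 1%E s e -> (opnorm p (lambda H w) <= c%:E)%E ->
  onorm p f <= c + e.
Proof.
move=> p1 c0 e0 wE se wc; rewrite -lee_fin -opnorm_lamE//.
apply: ge_ereal_sup => _ [u u1 <-].
have [S fS] := cg_support f.
have one1 : ((1 : \bar R) <= 1)%E by [].
have fA := pball_finite_support one1 fS.
set A := \sum_(d <- S) _ in fA.
have A0 : 0 <= A by apply: sumr_ge0 => y _; exact: normc_ge0.
have Ns : pball 1%E (fun y => - s y) e.
  by apply: pball_dominated se => // y; rewrite normcN.
have wA : pball 1%E w (A + e).
  by rewrite (_ : w = fun y => f y + s y); [exact: pballD|apply/funext].
have uB c' : normc (u c') <= 1 by apply: (pball_pointwise p1) u1; exact: ler01.
have -> : lam f u = fun c => lambda H w u c + lambda H (fun y => - s y) u c.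
  rewrite -(lambdaD _ e0 ler01 wA Ns uB) ?addr_ge0//.
  by congr (lambda H _ u); apply/funext => y; rewrite wE addrK.
apply: pballD => //.
  by apply: le_trans wc; apply: ereal_sup_ubound; exists u.
by rewrite -[e]mulr1; apply: op_le_lambda => //; exact: ler01.
Qed.

Lemma convolution_right (S : {fset G}) w (f : G -> R[i]) x : supported_in S f ->
  convolution w f x = \sum_(y <- S) f y * w (x * y^-1)%g.
Proof.
move=> fS; pose F y := f (y^-1 * x)%g * w y.
have bij : bijective (fun y => x * y^-1)%g.
  by exists (fun y => y^-1 * x)%g => y; rewrite /= invgM invgK ?mulgVK ?mulVKg.
have FE y : F (x * y^-1)%g = f y * w (x * y^-1)%g by rewrite /F invgM invgK mulgVK.
have FS : supported_in S (F \o (fun y => x * y^-1)%g).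
  by move=> y yS; rewrite /= FE fS// mul0r.
have FS' : supported_in [fset (x * y^-1)%g | y in S]%fset F.
  move=> y yS; rewrite /F fS ?mul0r//; apply: contra yS => yS.
  by apply/imfsetP; exists (y^-1 * x)%g; rewrite // invgM invgK mulVKg.
rewrite /convolution (@csum_finite_support _ _ [fset (x * y^-1)%g | y in S]%fset).
  rewrite (eq_bigr F); last by move=> y _; rewrite /F mulrC.
  by rewrite -(fsum_reindex bij FS FS'); apply: eq_bigr => y _; rewrite FE.
by move=> y /FS'; rewrite /F mulrC.
Qed.

End absolutely_summable_convolution.

(** * Limits at the explicit rate 1 / (n + 1) *)

Section inverse_sequences.
Variable R : realType.

Lemma rate_gt0 n : 0 < n.+1%:R^-1 :> R.
Proof. by rewrite invr_gt0 ltr0n. Qed.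

Lemma rate_le m n : (m <= n)%N -> n.+1%:R^-1 <= m.+1%:R^-1 :> R.
Proof. by move=> mn; rewrite lef_pV2 ?posrE ?ltr0n// ler_nat. Qed.

Lemma rate_small (e : R) : 0 < e -> exists n, n.+1%:R^-1 < e.
Proof.
move=> e0; exists (Num.bound e^-1); rewrite invf_plt ?posrE ?ltr0n//.
apply: lt_le_trans (archi_boundP _) _; first by rewrite invr_ge0 ltW.
by rewrite ler_nat.
Qed.

Lemma rate_small_mul (K e : R) : 0 <= K -> 0 < e -> exists n, K * n.+1%:R^-1 < e.
Proof.
move=> K0 e0; have K1 : 0 < K + 1 by rewrite ltr_wpDl.
have [n Hn] := rate_small (divr_gt0 e0 K1); exists n.
apply: (@le_lt_trans _ _ ((K + 1) * n.+1%:R^-1)).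
  by rewrite ler_wpM2r ?(ltW (rate_gt0 n))// lerDl.
by rewrite mulrC -ltr_pdivlMr.
Qed.

Lemma eq0_of_rate (K r : R) : 0 <= K -> 0 <= r -> (forall n, r <= K * n.+1%:R^-1) -> r = 0.
Proof.
move=> K0 r0 H; apply/eqP; rewrite eq_le r0 andbT leNgt; apply/negP => rp.
by have [n] := rate_small_mul K0 rp; rewrite ltNge H.
Qed.

Lemma real_limit (w : nat -> R) (K : R) :
  (forall m n, `|w m - w n| <= K * (m.+1%:R^-1 + n.+1%:R^-1)) ->
  exists l, forall n, `|l - w n| <= K * n.+1%:R^-1.
Proof.
move=> wK; pose S := range (fun n => w n - K * n.+1%:R^-1).
have ub n : ubound S (w n + K * n.+1%:R^-1).
  move=> _ [m _ <-]; have := wK m n; rewrite mulrDr ler_norml.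
  by move: (K * m.+1%:R^-1) (K * n.+1%:R^-1) => a b; lra.
exists (sup S) => n.
have h1 : w n - K * n.+1%:R^-1 <= sup S.
  by apply: ub_le_sup; [exists (w 0%N + K * 1%:R^-1); exact: (ub 0%N)|exists n].
have h2 : sup S <= w n + K * n.+1%:R^-1.
  by apply: ge_sup => //; exists (w 0%N - K * 1%:R^-1), 0%N.
by move: h1 h2; rewrite ler_norml; move: (K * n.+1%:R^-1) => b; lra.
Qed.

Lemma complex_limit (w : nat -> R[i]) (K : R) : 0 <= K ->
  (forall m n, normc (w m - w n) <= K * (m.+1%:R^-1 + n.+1%:R^-1)) ->
  exists l, forall n, normc (l - w n) <= 2 * K * n.+1%:R^-1.
Proof.
move=> K0 wK.
have ReB (z z' : R[i]) : complex.Re (z - z') = complex.Re z - complex.Re z'.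
  by case: z; case: z'.
have ImB (z z' : R[i]) : complex.Im (z - z') = complex.Im z - complex.Im z'.
  by case: z; case: z'.
have [|a Ha] := @real_limit (fun n => complex.Re (w n)) K.
  by move=> m n; rewrite -ReB; apply: le_trans (wK m n); have [] := abs_le_normc (w m - w n).
have [|b Hb] := @real_limit (fun n => complex.Im (w n)) K.
  by move=> m n; rewrite -ImB; apply: le_trans (wK m n); have [] := abs_le_normc (w m - w n).
exists (a +i* b)%C => n.
have -> : (a +i* b)%C - w n = ((a - complex.Re (w n)) +i* (b - complex.Im (w n)))%C.
  by case: (w n) => c d; simpc.
apply: le_trans (normc_le_abs _ _) _.
by have := lerD (Ha n) (Hb n); rewrite -mulrA; move: (K * _) => c; lra.
Qed.

Lemma near_inv_sequence (E : algType R[i]) (N : E -> R) x : algebra_seminorm N ->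
  near_inv N x -> exists M, 0 <= M /\ exists b : nat -> E,
  [/\ forall n, N (x * b n - 1) <= n.+1%:R^-1, forall n, N (b n * x - 1) <= n.+1%:R^-1 &
      forall m n, N (b m - b n) <= M * (m.+1%:R^-1 + n.+1%:R^-1)].
Proof.
move=> sN /(near_inv_refine sN)[M M0 HM]; exists M; split=> //.
have [b Hb] := choice (fun n => HM _ (rate_gt0 n)); exists b.
split=> [n|n|m n]; [by have [] := Hb n|by have [] := Hb n|].
have [bm _ bmx] := Hb m; have [bn xbn _] := Hb n.
(* Two approximate inverses differ by little because b_m x b_n is close to both. *)
have -> : b m - b n = - (b m * (x * b n - 1)) + (b m * x - 1) * b n.
  by rewrite mulrBr mulr1 mulrBl mul1r opprB mulrA addrA subrK.
apply: le_trans (snD sN _ _) _; rewrite (snN sN) [leRHS]mulrDr [leRHS]addrC.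
apply: lerD; apply: le_trans (snM sN _ _) _.
  by apply: ler_pM => //; exact: sn_ge0.
by rewrite [leRHS]mulrC; apply: ler_pM => //; exact: sn_ge0.
Qed.

End inverse_sequences.

Section spectra.
Variables (R : realType) (G : groupType) (H : groupClosed G).
Local Notation T := (cosets H).
Local Notation E := (cg R G).
Local Notation lam := (@lam R G H).
Local Notation onorm := (@onorm R G H).
Local Notation n2 := (onorm 2%:E).
Local Notation pfnorm := (@pfnorm R G H).
Implicit Types (f x : E) (z : R[i]) (u g : T -> R[i]) (p : R).

Lemma ell1_cg f : ell1 (f : G -> R[i]).
Proof.
have [S fS] := cg_support f; have one1 : ((1 : \bar R) <= 1)%E by [].
apply/(lpP 1%g _ one1); exists (\sum_(d <- S) normc (f d)).
  by apply: sumr_ge0 => d _; exact: normc_ge0.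
exact: pball_finite_support.
Qed.

Lemma PF_null_rate p (u : nat -> E) : 1 <= p ->
  (forall n, pfnorm p (u n) <= n.+1%:R^-1) -> PF_null H p (fun n => (u n : G -> R[i])).
Proof.
move=> p1 uE; rewrite /PF_null /=.
under eq_fun do rewrite PFnormE//.
apply: cvg_EFin; first by apply: nearW.
apply: (@squeeze_cvgr _ _ _ _ (fun=> 0) harmonic); [|exact: cvg_cst|exact: cvg_harmonic].
by apply: nearW => n /=; rewrite (sn_ge0 (pfnorm_seminorm H p1)) uE.
Qed.

Lemma PF_null_lt p (u v : nat -> G -> R[i]) (e : R) : 0 < e -> PF_null H p u -> PF_null H p v ->
  exists n, (PFnorm H p (u n) <= e%:E)%E /\ (PFnorm H p (v n) <= e%:E)%E.
Proof.
move=> e0 u0 v0.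
have nb : nbhs (0 : \bar R)%E [set y | (y < e%:E)%E].
  by apply: open_nbhs_nbhs; split; [exact: open_ereal_lt_ereal|rewrite /= lte_fin].
have [n1 _ Hn1] := u0 _ nb; have [n2' _ Hn2] := v0 _ nb.
exists (maxn n1 n2'); split; apply: ltW.
  by apply: Hn1; rewrite /= leq_maxl.
by apply: Hn2; rewrite /= leq_maxr.
Qed.

Lemma maxe_le (a b c : \bar R) : (Order.max a b <= c)%E -> (a <= c)%E /\ (b <= c)%E.
Proof. by rewrite ge_max => /andP. Qed.

(** Replaces an [l^1] factor by a finitely supported one. *)
Lemma pfnorm_truncation p x (h : G -> R[i]) (c e : R) : 1 <= p -> 0 <= c -> 0 < e -> ell1 h ->
  (PFnorm H p (convolution x h - @delta1 R G)%R <= c%:E)%E ->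
  (PFnorm H p (convolution h x - @delta1 R G)%R <= c%:E)%E ->
  exists b : E, pfnorm p (x * b - 1) <= c + e /\ pfnorm p (b * x - 1) <= c + e.
Proof.
move=> p1 c0 e0 /(lpP 1%g)[//|A A0 hA] c1 c2.
have one1 : ((1 : \bar R) <= 1)%E by [].
have [S xS] := cg_support x; pose K := \sum_(y <- S) normc (x y).
have K0 : 0 <= K by apply: sumr_ge0 => y _; exact: normc_ge0.
have K1 : 0 < K + 1 by rewrite ltr_wpDl.
have [X hX] := l1_truncation A0 hA (divr_gt0 e0 K1).
pose r y := h y - restrict X h y; pose e' := e / (K + 1).
have e'0 : 0 <= e' by rewrite divr_ge0// ltW.
have Ke : K * e' <= e.
  by rewrite /e' mulrCA ler_piMr ?(ltW e0)// ler_pdivrMr// mul1r lerDl ler01.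
exists (truncation X h).
have mulg_b (y : G) : bijective (fun t => y * t)%g by exact: mulg_bij.
have s1 : pball 1%E (convolution x r) e.
  have := pball_conv_act one1 mulg_b xS e'0 hX; exact: pball_le.
have s2 : pball 1%E (convolution r x) e.
  apply: (pball_le Ke).
  rewrite (_ : convolution r x = fun t => \sum_(y <- S) x y * r (t * y^-1)%g); last first.
    by apply/funext => t; exact: convolution_right.
  rewrite /K mulr_suml; apply: (pball_sum one1 _ (F := fun y t => x y * r (t * y^-1)%g)) => y.
    by rewrite mulr_ge0// normc_ge0.
  apply: pballZ => //; apply: (pball_reindex one1 e'0) hX.
  by exists (fun t => t * y)%g => t; rewrite /= ?mulgK ?mulgVK.
have w1 t : (convolution x h - @delta1 R G) t = (x * truncation X h - 1) t + convolution x r t.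
  rewrite -[LHS]/(convolution x h t - delta1 R t).
  rewrite -[Y in _ = Y + _]/(convolution x (truncation X h) t - delta1 R t) addrAC; congr (_ - _).
  rewrite !convolution_conv_act !(conv_actE _ _ _ xS) -big_split; apply: eq_bigr => y _ /=.
  by rewrite -mulrDr /r addrC subrK.
have w2 t : (convolution h x - @delta1 R G) t = (truncation X h * x - 1) t + convolution r x t.
  rewrite -[LHS]/(convolution h x t - delta1 R t).
  rewrite -[Y in _ = Y + _]/(convolution (truncation X h) x t - delta1 R t) addrAC; congr (_ - _).
  rewrite !(convolution_right _ _ xS) -big_split; apply: eq_bigr => y _ /=.
  by rewrite -mulrDr /r addrC subrK.
have q1 := one_le_hoelder_conjugate p1.
have p1' : ((1 : \bar R) <= p%:E)%E by rewrite lee_fin.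
have [{}c1 c1'] := maxe_le c1; have [{}c2 c2'] := maxe_le c2.
have e0' := ltW e0.
split; rewrite /pfnorm ge_max; apply/andP; split.
- exact: (onorm_le_perturbation p1' c0 e0' w1 s1 c1).
- exact: (onorm_le_perturbation q1 c0 e0' w1 s1 c1').
- exact: (onorm_le_perturbation p1' c0 e0' w2 s2 c2).
- exact: (onorm_le_perturbation q1 c0 e0' w2 s2 c2').
Qed.

(** A Cauchy sequence that inverts x has a late term that is an approximate inverse, and truncating
    it brings it into CG. Conversely, refined approximate inverses form a Cauchy sequence. *)
Lemma Sp_PFE p f z : 1 <= p ->
  Sp (PF_class H p f) z <-> ~ near_inv (pfnorm p) (z%:A - f).
Proof.
move=> p1; set x := z%:A - f.
have sN := pfnorm_seminorm H p1.
have xE : alg_scalar (PF H p) z - PF_class H p f = fun n => (x : G -> R[i]) by [].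
have oneE : alg_scalar (PF H p) 1 = fun n => @delta1 R G.
  by apply/funext => n; apply/funext => t /=; rewrite mul1r.
rewrite /Sp /=; split=> nb h; apply: nb; last first.
  have [b [b1 _] [xb bx]] := h.
  rewrite xE in xb bx; rewrite oneE in xb bx.
  (* 1/4 for the null sequences and 1/4 for the truncation add up to less than 1. *)
  have e4 : (0 : R) < 1 / 4 by lra.
  have [n [xbn bxn]] := PF_null_lt e4 xb bx.
  have [c [xc cx]] := pfnorm_truncation p1 (ltW e4) e4 (b1 n) xbn bxn.
  by exists c; split; [apply: le_lt_trans xc _|apply: le_lt_trans cx _]; lra.
have [M [M0 [b [xb bx bb]]]] := near_inv_sequence sN h.
exists (fun n => (b n : G -> R[i])).
  split=> [n|e e0]; first exact: ell1_cg.
  have [k Hk] := rate_small_mul (mulr_ge0 (ler0n R 2) M0) e0.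
  exists k => m n km kn.
  rewrite -[_ - _]/((b m - b n : E) : G -> R[i]) PFnormE// lte_fin.
  apply: le_lt_trans (bb m n) _; apply: le_lt_trans Hk.
  rewrite [2 * M]mulrC -mulrA; apply: ler_wpM2l => //.
  by rewrite mulr_natl mulr2n; apply: lerD; exact: rate_le.
rewrite /inverse_in xE oneE; split.
  change (PF_null H p (fun n => ((x * b n - 1 : E) : G -> R[i]))).
  exact: (PF_null_rate p1 xb).
change (PF_null H p (fun n => ((b n * x - 1 : E) : G -> R[i]))).
exact: (PF_null_rate p1 bx).
Qed.

End spectra.

(** * The spectrum in the C*-algebra *)

Section cstar_spectrum.
Variables (R : realType) (G : groupType) (H : groupClosed G).
Local Notation T := (cosets H).
Local Notation E := (cg R G).
Local Notation lam := (@lam R G H).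
Local Notation onorm := (@onorm R G H).
Local Notation n2 := (onorm 2%:E).
Implicit Types (f x : E) (z : R[i]) (u g h : T -> R[i]).

Let t0 : T := (\pi_(cosets H) 1%g)%qT.
Let le12 := one_le_two R.
Let n2_ge0 f : 0 <= n2 f := onorm_ge0 H le12 f.

Lemma lp2P g : lp 2%:E g <-> exists2 B, 0 <= B & pball 2%:E g B.
Proof. exact: lpP t0 _ _ le12. Qed.

Lemma n2_le_unit f A : 0 <= A -> (forall u, pball 2%:E u 1 -> pball 2%:E (lam f u) A) ->
  n2 f <= A.
Proof.
move=> A0 fA; rewrite -lee_fin -opnorm_lamE//.
by apply: ge_ereal_sup => _ [u u1 <-]; exact: fA.
Qed.

Lemma lam_sub f u v c : lam f (fun c => u c - v c) c = lam f u c - lam f v c.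
Proof.
have := lam_linear f (-1) v u => /(congr1 (fun F => F c)) /=.
rewrite mulN1r addrC => <-; congr (lam f _ c).
by apply/funext => d; rewrite mulN1r addrC.
Qed.

Lemma lamB f f' u c : lam (f - f') u c = lam f u c - lam f' u c.
Proof.
have -> : lam (f - f') u = (fun c => lam f u c + lam (- f') u c) by exact: lamD.
by rewrite -[- f']scaleN1r lamZ mulN1r.
Qed.

Lemma near_inv_of_Cstar x (b : (T -> R[i]) -> (T -> R[i])) : Cstar_elt b ->
  (forall g, lp 2%:E g -> lam x (b g) = g) -> (forall g, lp 2%:E g -> b (lam x g) = g) ->
  near_inv n2 x.
Proof.
move=> [_ bapp] xb bx.
pose K := n2 x + 1; have K0 : 0 < K by rewrite ltr_wpDl.
(* The errors from density of l^1(G) and from truncation add up to 2 e, and multiplication by x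
   costs K more: 2 e K = 1/4. *)
pose e := (8 * K)^-1; have e0 : 0 < e by rewrite invr_gt0 mulr_gt0.
have [h h1 bh] := bapp e e0.
have one1 : ((1 : \bar R) <= 1)%E by [].
have [A A0 hA] := (lpP 1%g h one1).1 h1.
have [X hX] := l1_truncation A0 hA e0.
pose c := truncation X h; pose r y := h y - restrict X h y.
have close u : pball 2%:E u 1 -> pball 2%:E (fun d => b u d - lam c u d) (e + e).
  move=> u1; have uB d : normc (u d) <= 1 by apply: (pball_pointwise le12) u1.
  have -> : (fun d => b u d - lam c u d) =
      (fun d => (b - lambda H h) u d + lambda H r u d).
    apply/funext => d; rewrite -[(b - lambda H h) u d]/(b u d - lambda H h u d).
    have -> : lambda H h u d = lam c u d + lambda H r u d.
      rewrite -[RHS]/((fun d => lambda H (restrict X h) u d + lambda H r u d) d).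
      rewrite -(lambdaD A0 (ltW e0) ler01 (pball_restrict one1 X A0 hA) hX uB).
      by congr (lambda H _ u d); apply/funext => y; rewrite /r addrC subrK.
    by rewrite opprD addrA addrNK.
  apply: pballD => //; try exact: ltW.
    by apply: le_trans (ltW bh); apply: ereal_sup_ubound; exists u.
  by rewrite -[X in pball _ _ X]mulr1; apply: op_le_lambda => //; exact: ltW.
have e20 : 0 <= e + e by rewrite addr_ge0// ltW.
have eK : (e + e) * K = 1 / 4.
  rewrite /e; have KN : K != 0 by rewrite gt_eqF.
  by clearbody K; field.
exists c; split.
  apply: (@le_lt_trans _ _ (K * (e + e))); last by rewrite mulrC eK; lra.
  apply: n2_le_unit => [|u u1]; first by rewrite mulr_ge0// ltW.
  have lu : lp 2%:E u by apply/lp2P; exists 1.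
  have -> : lam (x * c - 1) u = lam x (fun d => - (b u d - lam c u d)).
    apply/funext => d; rewrite [in LHS]lamD lamM -scaleN1r lamZ lam1 mulN1r.
    have -> : (fun d => - (b u d - lam c u d)) = (fun d => lam c u d - b u d).
      by apply/funext => d'; rewrite opprB.
    by rewrite lam_sub xb.
  have h2 : pball 2%:E (fun d => - (b u d - lam c u d)) (e + e).
    by apply: pball_dominated (close u u1) => // d; rewrite normcN.
  apply: pball_le (onorm_op_le le12 x e20 h2).
  by apply: ler_wpM2r => //; rewrite lerDl.
apply: (@le_lt_trans _ _ (K * (e + e))); last by rewrite mulrC eK; lra.
apply: n2_le_unit => [|u u1]; first by rewrite mulr_ge0// ltW.
have KC : K%:C%C != 0 :> R[i] by rewrite realC_eq0 gt_eqF.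
(* [close] only applies on the unit ball, so u is scaled down until [lam x v] lies in it. *)
pose v d := K%:C%C^-1 * u d.
have nK : normc K%:C%C^-1 = K^-1 by rewrite Normc.normcV normc_real ger0_norm// ltW.
have vK : pball 2%:E v K^-1.
  by rewrite -nK -[normc _]mulr1; apply: pballZ.
have lv : lp 2%:E v by apply/lp2P; exists K^-1 => //; rewrite invr_ge0 ltW.
have xv1 : pball 2%:E (lam x v) 1.
  have Ki0 : 0 <= K^-1 by rewrite invr_ge0 ltW.
  apply: pball_le (onorm_op_le le12 x Ki0 vK).
  by rewrite ler_pdivrMr// mul1r lerDl.
have -> : lam (c * x - 1) u = fun d => (- K%:C%C) * (b (lam x v) d - lam c (lam x v) d).
  apply/funext => d; rewrite bx// -lamM /v lam_scale [in LHS]lamD -scaleN1r lamZ lam1.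
  by rewrite mulrBr !mulrA !mulNr mulfV// !mul1r opprK addrC.
have -> : K * (e + e) = normc (- K%:C%C) * (e + e).
  by rewrite normcN normc_real (ger0_norm (ltW K0)).
by apply: pballZ => //; exact: close.
Qed.

Lemma Cstar_of_near_inv x : near_inv n2 x -> exists2 b, Cstar_elt b &
  (forall g, lp 2%:E g -> lam x (b g) = g) /\ (forall g, lp 2%:E g -> b (lam x g) = g).
Proof.
have sN := n2_seminorm R H.
move=> /(near_inv_sequence sN)[M [M0 [b [xb bx bb]]]].
have cauchy g B : 0 <= B -> pball 2%:E g B -> forall m n,
    pball 2%:E (fun c => lam (b m) g c - lam (b n) g c) (M * B * (m.+1%:R^-1 + n.+1%:R^-1)).
  move=> B0 gB m n.
  have -> : (fun c => lam (b m) g c - lam (b n) g c) = lam (b m - b n) g.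
    by apply/funext => c; rewrite lamB.
  apply: pball_le (onorm_op_le le12 _ B0 gB).
  by rewrite mulrAC; apply: ler_wpM2r => //; exact: bb.
have rate0 n : 0 <= n.+1%:R^-1 :> R by exact: ltW (rate_gt0 R n).
(* [S g] is the coordinatewise limit of [lam (b n) g], and 0 off l^2. The estimate is demanded for
   every bound B of g, so that a single choice also yields the operator norm bounds. *)
have /choice[S HS] : forall g, exists s : T -> R[i], forall B, 0 <= B -> pball 2%:E g B ->
    forall n, pball 2%:E (fun c => s c - lam (b n) g c) (2 * (M * B) * n.+1%:R^-1).
  move=> g; have [lg|nlg] := pselect (lp 2%:E g); last first.
    by exists (fun=> 0) => B B0 gB; exfalso; apply: nlg; apply/lp2P; exists B.
  have [B B0 gB] := (lp2P g).1 lg.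
  have MB0 : 0 <= M * B by exact: mulr_ge0.
  have /choice[s Hs] : forall c, exists l, forall n,
      normc (l - lam (b n) g c) <= 2 * (M * B) * n.+1%:R^-1.
    move=> c; apply: complex_limit => // m n.
    have K0 : 0 <= M * B * (m.+1%:R^-1 + n.+1%:R^-1) by rewrite mulr_ge0// addr_ge0.
    exact: (pball_pointwise le12 c K0 (cauchy g B B0 gB m n)).
  exists s => B' B'0 gB' n; have MB'0 : 0 <= M * B' by exact: mulr_ge0.
  apply: pball_close => // [|e e0]; first by rewrite !mulr_ge0.
  have [k Hk] := rate_small_mul (mulr_ge0 (ler0n R 2) MB0) e0.
  pose m := maxn n k.
  exists (fun c => lam (b m) g c - lam (b n) g c).
    apply: pball_le (cauchy g B' B'0 gB' m n).
    rewrite [2 * _]mulrC -[leRHS]mulrA; apply: ler_wpM2l => //.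
    rewrite mulr_natl mulr2n; apply: lerD => //; apply: rate_le; exact: leq_maxl.
  move=> c; rewrite opprB addrA subrK.
  apply: le_trans (Hs c m) _; apply: le_trans (ltW Hk).
  apply: ler_wpM2l; first by rewrite mulr_ge0.
  by apply: rate_le; exact: leq_maxr.
have pw g B c n : 0 <= B -> pball 2%:E g B ->
    normc (S g c - lam (b n) g c) <= 2 * (M * B) * n.+1%:R^-1.
  move=> B0 gB; have K0 : 0 <= 2 * (M * B) * n.+1%:R^-1 by rewrite !mulr_ge0.
  exact: (pball_pointwise le12 c K0 (HS g B B0 gB n)).
exists S; last split.
- split; first split.
  + move=> a g h /lp2P[B B0 gB] /lp2P[D D0 hD].
    have aB0 : 0 <= normc a * B by rewrite mulr_ge0 ?normc_ge0.
    have ghB : pball 2%:E (fun c => a * g c + h c) (normc a * B + D).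
      by apply: pballD => //; exact: pballZ.
    have aBD0 : 0 <= normc a * B + D by rewrite addr_ge0.
    apply/funext => c; apply/eqP; rewrite -subr_eq0 -normc_eq0; apply/eqP.
    (* The limits were chosen separately for each function; linearity is recovered because the
       defect is at most a constant over n + 1 for every n. *)
    apply: (@eq0_of_rate _ (2 * (M * (normc a * B + D)) + normc a * (2 * (M * B)) + 2 * (M * D))).
    * by rewrite !addr_ge0// !mulr_ge0 ?normc_ge0.
    * exact: normc_ge0.
    move=> n; set w := S _ c.
    have -> : w - (a * S g c + S h c) = (w - lam (b n) (fun c => a * g c + h c) c)
        + (- a * (S g c - lam (b n) g c) + - (S h c - lam (b n) h c)).
      by rewrite lam_linear; ring.
    apply: le_trans (le_normcD _ _) _; rewrite -addrA mulrDl; apply: lerD.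
      exact: pw ghB.
    apply: le_trans (le_normcD _ _) _; rewrite mulrDl; apply: lerD.
      by rewrite Normc.normcM normcN -mulrA; apply: ler_wpM2l; [exact: normc_ge0|exact: pw].
    by rewrite normcN; exact: pw.
  + apply: (@le_lt_trans _ _ (2 * M * 1%:R^-1 + n2 (b 0%N))%:E); last by rewrite ltry.
    apply: ge_ereal_sup => _ [g g1 <-].
    rewrite (_ : S g = fun c => (S g c - lam (b 0%N) g c) + lam (b 0%N) g c); last first.
      by apply/funext => c; rewrite subrK.
    apply: pballD => //; first by rewrite !mulr_ge0.
      by have := HS g 1 ler01 g1 0%N; rewrite mulr1.
    by rewrite -[n2 _]mulr1; apply: onorm_op_le => //; exact: ler01.
  + move=> e e0; have [n Hn] := rate_small_mul (mulr_ge0 (ler0n R 2) M0) e0.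
    exists (b n); first exact: ell1_cg.
    apply: (@le_lt_trans _ _ (2 * M * n.+1%:R^-1)%:E); last by rewrite lte_fin.
    apply: ge_ereal_sup => _ [g g1 <-].
    by have := HS g 1 ler01 g1 n; rewrite mulr1.
- move=> g /lp2P[B B0 gB]; apply/funext => c; apply/eqP; rewrite -subr_eq0 -normc_eq0; apply/eqP.
  apply: (@eq0_of_rate _ (n2 x * (2 * (M * B)) + B)); first by rewrite addr_ge0// !mulr_ge0.
    exact: normc_ge0.
  move=> n; have -> : lam x (S g) c - g c =
      lam x (fun c => S g c - lam (b n) g c) c + lam (x * b n - 1) g c.
    by rewrite lam_sub lamB lamM lam1 addrA subrK.
  apply: le_trans (le_normcD _ _) _; rewrite mulrDl; apply: lerD.
    have D0 : 0 <= 2 * (M * B) * n.+1%:R^-1 by rewrite !mulr_ge0.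
    rewrite -mulrA; apply: (pball_pointwise le12); first by rewrite mulr_ge0.
    by apply: onorm_op_le => //; exact: HS.
  apply: (pball_pointwise le12); first by rewrite mulr_ge0.
  apply: pball_le (onorm_op_le le12 (x * b n - 1) B0 gB).
  by rewrite mulrC; apply: ler_wpM2l => //; exact: xb.
- move=> g /lp2P[B B0 gB]; apply/funext => c; apply/eqP; rewrite -subr_eq0 -normc_eq0; apply/eqP.
  have xB0 : 0 <= n2 x * B by exact: mulr_ge0.
  have xgB := onorm_op_le le12 x B0 gB.
  apply: (@eq0_of_rate _ (2 * (M * (n2 x * B)) + B)); first by rewrite addr_ge0// !mulr_ge0.
    exact: normc_ge0.
  move=> n; have -> : S (lam x g) c - g c =
      (S (lam x g) c - lam (b n) (lam x g) c) + lam (b n * x - 1) g c.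
    by rewrite lamB lamM lam1 addrA subrK.
  apply: le_trans (le_normcD _ _) _; rewrite mulrDl; apply: lerD; first exact: pw xgB.
  apply: (pball_pointwise le12); first by rewrite mulr_ge0.
  apply: pball_le (onorm_op_le le12 (b n * x - 1) B0 gB).
  by rewrite mulrC; apply: ler_wpM2l => //; exact: bx.
Qed.

Lemma Sp_CstarE f z : Sp (Cstar_class H f) z <-> ~ near_inv n2 (z%:A - f).
Proof.
set x := z%:A - f.
have xE : alg_scalar (Cstar R H) z - Cstar_class H f = lam x.
  apply/funext => u; apply/funext => c.
  by rewrite -[LHS]/(z * u c - lam f u c) /x lamB lamZ lam1.
have oneE g : alg_scalar (Cstar R H) 1 g = g by apply/funext => c /=; rewrite mul1r.
rewrite /Sp /=; split=> nb h; apply: nb; last first.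
  have [b bC [xb bx]] := h; rewrite xE in xb bx.
  apply: (near_inv_of_Cstar bC) => g lg.
    by have := xb g lg; rewrite oneE.
  by have := bx g lg; rewrite oneE.
have [b bC [xb bx]] := Cstar_of_near_inv h.
exists b => //; rewrite /inverse_in xE; split=> g lg; rewrite oneE.
  exact: xb.
exact: bx.
Qed.

End cstar_spectrum.

(** * The equivalences *)

Section equivalences.
Variables (R : realType) (G : groupType) (H : groupClosed G).
Local Notation E := (cg R G).
Local Notation n2 := (@onorm R G H 2%:E).
Local Notation pfnorm := (@pfnorm R G H).
Implicit Types (f x : E) (z : R[i]) (p : R).

Lemma near_inv_pfnorm_le1 p x : 1 <= p -> near_inv (pfnorm 1) x -> near_inv (pfnorm p) x.
Proof. by move=> p1; apply: near_inv_le => f; exact: pfnorm_le1. Qed.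

Lemma near_inv_n2_of_pfnorm p x : 1 <= p -> near_inv (pfnorm p) x -> near_inv n2 x.
Proof. by move=> p1; apply: near_inv_le => f; exact: n2_le_pfnorm. Qed.

Lemma near_inv_pfnorm2 x : near_inv (pfnorm 2) x <-> near_inv n2 x.
Proof. by split; apply: near_inv_le => f; rewrite pfnorm2. Qed.

(** n2 f or its negative lies in the C*-spectrum, which is contained in the spectrum in every
    completion. *)
Lemma spectral_radius_ge p f : 1 <= p -> star f = f ->
  ((n2 f)%:E <= spectral_radius (PF_class H p f))%E.
Proof.
move=> p1 sf; have n0 : 0 <= n2 f := sn_ge0 (n2_seminorm R H) f.
have [z zn nz] : exists2 z : R[i], normc z = n2 f & ~ near_inv (pfnorm p) (z%:A - f).
  have [h1|h1] := pselect (near_inv (pfnorm p) ((n2 f)%:C%C%:A - f)); last first.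
    by exists (n2 f)%:C%C => //; rewrite normc_real ger0_norm.
  exists (- n2 f)%:C%C => [|h2]; first by rewrite normc_real normrN ger0_norm.
  apply: (n2_in_spectrum sf); split; first exact: (near_inv_n2_of_pfnorm p1 h1).
  exact: (near_inv_n2_of_pfnorm p1 h2).
by apply: ereal_sup_ubound; exists z; [apply/Sp_PFE|rewrite zn].
Qed.

Lemma spectral_radius_eq p f : 1 <= p -> star f = f ->
  (forall z, n2 f < normc z -> near_inv (pfnorm p) (z%:A - f)) ->
  spectral_radius (PF_class H p f) = (n2 f)%:E.
Proof.
move=> p1 sf nf; apply/eqP; rewrite eq_le spectral_radius_ge// andbT.
apply: ge_ereal_sup => _ [z /(Sp_PFE _ _ _ p1) nz <-]; rewrite lee_fin leNgt.
by apply/negP => /nf.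
Qed.

Lemma near_inv_gt_spectral_radius p f z : 1 <= p ->
  (spectral_radius (PF_class H p f) < (normc z)%:E)%E -> near_inv (pfnorm p) (z%:A - f).
Proof.
move=> p1 rz; apply: contrapT => nz; move: rz; apply/negP; rewrite -leNgt.
by apply: ereal_sup_ubound; exists z => //; apply/Sp_PFE.
Qed.

Lemma pair_quasi_symmetricP : pair_quasi_symmetric R H <->
  forall f z, ~~ (0 <= z) -> near_inv (pfnorm 1) (z%:A - star f * f).
Proof.
split=> [qs f z z0|qs _ [f /finsuppP hf <-] z].
  apply: contrapT => nz; move/negP: z0; apply.
  apply: (qs (PF_class H 1 f)); first by exists (f : G -> R[i]) => //; exact: cg_fin.
  exact/(Sp_PFE H (star f * f) z (lexx 1)).
move=> /(Sp_PFE H (star (CG hf) * CG hf) z (lexx 1)) nz /=.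
by apply: contrapT => /negP z0; apply: nz; exact: qs.
Qed.

(** Self-adjointness of the class of f only says that f and [star f] agree modulo the kernel, hence
    the vanishing seminorm. *)
Lemma pair_quasi_hermitianP : pair_quasi_hermitian R H <->
  forall f z, pfnorm 1 (star f - f) = 0 -> z \isn't Num.real -> near_inv (pfnorm 1) (z%:A - f).
Proof.
have sN : algebra_seminorm (pfnorm 1) by exact: pfnorm_seminorm.
split=> [qh f z sf zr|qh _ [f /finsuppP hf <-] sf z].
  apply: contrapT => nz; move/negP: zr; apply.
  apply: (qh (PF_class H 1 f)); first by exists (f : G -> R[i]) => //; exact: cg_fin.
    change (PF_null H 1 (fun n => ((star f - f : E) : G -> R[i]))).
    by apply: PF_null_rate => // n; rewrite sf ltW// rate_gt0.
  exact/(Sp_PFE H f z (lexx 1)).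
move=> /(Sp_PFE H (CG hf) z (lexx 1)) nz /=.
apply: contrapT => /negP zr; apply: nz; apply: qh => //.
have {}sf : PF_null H 1 (fun n => ((star (CG hf) - CG hf : E) : G -> R[i])) by exact: sf.
apply/eqP; rewrite eq_le (sn_ge0 sN) andbT; apply/ler_addgt0Pr => e e0; rewrite add0r.
have [n [+ _]] := PF_null_lt e0 sf sf.
by rewrite PFnormE// lee_fin.
Qed.

(** The square of a nonreal z is not a nonnegative real. As f is self-adjoint only modulo the
    kernel, f f is first exchanged for [star f * f]. *)
Lemma quasi_hermitian_of_symmetric :
  (forall f z, ~~ (0 <= z) -> near_inv (pfnorm 1) (z%:A - star f * f)) ->
  forall f z, pfnorm 1 (star f - f) = 0 -> z \isn't Num.real -> near_inv (pfnorm 1) (z%:A - f).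
Proof.
have sN : algebra_seminorm (pfnorm 1) by exact: pfnorm_seminorm.
move=> qs f z sf zr.
have z2 : ~~ (0 <= z ^+ 2).
  by apply: contra zr => z20; rewrite realEsqr.
have h1 : near_inv (pfnorm 1) ((z ^+ 2)%:A - f * f).
  apply: (near_inv_eq sN) (qs f _ z2).
  have -> : (z ^+ 2)%:A - star f * f - ((z ^+ 2)%:A - f * f) = - ((star f - f) * f).
    by rewrite mulrBl !opprB addrC addrA subrK.
  apply/eqP; rewrite (snN sN) eq_le (sn_ge0 sN) andbT.
  by apply: le_trans (snM sN _ _) _; rewrite sf mul0r.
have e1 : (z%:A - f) * (z%:A + f) = (z ^+ 2)%:A - f * f.
  by rewrite -opprB mulNr [z%:A + f]addrC sub_add_scalar opprB expr2.
have e2 : (z%:A + f) * (z%:A - f) = (z ^+ 2)%:A - f * f.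
  have := sub_add_scalar f (- z); rewrite sqrrN scaleNr opprK => e.
  by rewrite -[z%:A - f]opprB mulrN [z%:A + f]addrC e opprB expr2.
by apply: (near_inv_mul_cancel sN (y := z%:A + f)); rewrite ?e1 ?e2.
Qed.

Lemma near_inv_star x : near_inv n2 x -> near_inv n2 (star x).
Proof.
move=> [b [xb bx]]; exists (star b); split.
  by rewrite -starM -(star1 R G) -starB; apply: le_lt_trans (n2_star _ _) bx.
by rewrite -starM -(star1 R G) -starB; apply: le_lt_trans (n2_star _ _) xb.
Qed.

(** Barnes' argument: for [x] invertible in the C*-algebra, [r - x^* x] has
    spectral radius less than [r] for large [r], hence so it has in [PF_1^*]. *)
Lemma near_inv_of_spectral_radius :
  (forall f z, star f = f -> n2 f < normc z -> near_inv (pfnorm 1) (z%:A - f)) ->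
  forall x, near_inv n2 x -> near_inv (pfnorm 1) x.
Proof.
have sN : algebra_seminorm (pfnorm 1) by exact: pfnorm_seminorm.
move=> rad; have star_mul x : near_inv n2 x -> near_inv (pfnorm 1) (star x * x).
  move=> /lower_bound_of_near_inv[e e0 He]; pose r := n2 x ^+ 2 + 1.
  have r0 : 0 < r by rewrite ltr_wpDl// sqr_ge0.
  have xr : n2 x ^+ 2 <= r by rewrite lerDl.
  have := n2_sub_star_mul_lt r0 e0 xr He; set y := r%:C%C%:A - star x * x => yr.
  have sy : star y = y by rewrite starB star_realZ star1 starM starK.
  have := rad y r%:C%C sy; rewrite normc_real (ger0_norm (ltW r0)) => /(_ yr).
  by rewrite /y opprB addrC subrK.
move=> x ix; apply: (near_inv_mul_cancel sN (y := star x)); last exact: star_mul.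
by rewrite -{1}(starK x); apply: star_mul; exact: near_inv_star.
Qed.

End equivalences.

Theorem theorem10 (R : realType) (G : groupType) (H : groupClosed G) :
  [<->
    (* (i) *)
    pair_quasi_symmetric R H;
    (* (ii) *)
    pair_quasi_hermitian R H;
    (* (iii) *)
    forall f : G -> R[i], finitely_supported f -> involution f = f ->
      spectral_radius (PF_class H 1 f) = opnorm 2%:E (lambda H f);
    (* (iv) *)
    forall f : G -> R[i], finitely_supported f -> involution f = f ->
      forall p p' : R, 1 <= p <= 2 -> 1 <= p' <= 2 ->
        spectral_radius (PF_class H p f) = spectral_radius (PF_class H p' f);
    (* (v) *)
    forall f : G -> R[i], finitely_supported f ->
      Sp (PF_class H 1 f) = Sp (Cstar_class H f);
    (* (vi) *)
    forall f : G -> R[i], finitely_supported f ->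
      forall p p' : R, 1 <= p <= 2 -> 1 <= p' <= 2 ->
        Sp (PF_class H p f) = Sp (PF_class H p' f)].
Proof.
have p1P (p : R) : 1 <= p <= 2 -> 1 <= p by case/andP.
have le12 : 1 <= (2 : R) by rewrite ler1n.
have p11 : 1 <= (1 : R) <= 2 by rewrite lexx.
have p22 : 1 <= (2 : R) <= 2 by rewrite lexx andbT.
have CGP (f : G -> R[i]) : finitely_supported f -> exists F : cg R G, f = F.
  by move=> hf; exists (CG (introT (finsuppP f) hf)).
have starP (F : cg R G) : involution F = F -> star F = F.
  by move=> sF; apply: val_inj.
have radP (F : cg R G) : star F = F ->
    (forall p : R, 1 <= p <= 2 ->
       spectral_radius (PF_class H p F) = spectral_radius (PF_class H 1 F)) ->
    forall z, onorm H 2%:E F < normc z -> near_inv (pfnorm H 1) (z%:A - F).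
  move=> sF e z nz; apply: near_inv_gt_spectral_radius => //.
  (* At p = 2 the norm is n2 itself, and no spectrum lies beyond the norm. *)
  rewrite -(e 2)// spectral_radius_eq//.
  move=> w nw; apply/near_inv_pfnorm2.
  exact: (near_inv_gt_norm (n2_seminorm R H) nw).
tfae.
- move=> /pair_quasi_symmetricP qs; apply/pair_quasi_hermitianP.
  exact: quasi_hermitian_of_symmetric.
- move=> /pair_quasi_hermitianP qh _ /CGP[F ->] /starP sF.
  rewrite (opnorm_lamE H (one_le_two R)); apply: spectral_radius_eq => //.
  apply: near_inv_pfnorm1 => // z; apply: qh.
  by rewrite sF subrr (sn0 (pfnorm_seminorm _ _)).
- move=> rad _ /CGP[F ->] sF p p' /p1P p1 /p1P p1'.
  (* The common value is n2 F: the C*-spectrum bounds the radius from below, and (iii), through the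
     largest norm, bounds it from above. *)
  suff r q : 1 <= q -> spectral_radius (PF_class H q F) = (onorm H 2%:E F)%:E.
    by rewrite !r.
  move=> q1; apply: spectral_radius_eq => //; first exact: starP.
  move=> z nz; apply: near_inv_pfnorm_le1 => //.
  apply: near_inv_gt_spectral_radius => //.
  by rewrite rad ?(opnorm_lamE H (one_le_two R)) ?lte_fin//; exact: cg_fin.
- move=> rad _ /CGP[F ->]; apply/seteqP; split=> z.
    move=> /(Sp_PFE H F z (lexx 1)) nz; apply/Sp_CstarE => iz; apply: nz.
    apply: near_inv_of_spectral_radius iz => f w sf.
    apply: radP => // p pb; apply: rad => //; first exact: cg_fin.
    by rewrite -[RHS](congr1 (@cgval R G) sf).
  move=> /Sp_CstarE nz; apply/(Sp_PFE H F z (lexx 1)) => iz; apply: nz.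
  exact: near_inv_n2_of_pfnorm iz.
- move=> sp _ /CGP[F ->] p p' /p1P p1 /p1P p1'.
  (* The spectrum for q lies between the C*-spectrum and the one for p = 1, which coincide by
     (v). *)
  suff spC q : 1 <= q -> Sp (PF_class H q F) = Sp (Cstar_class H F).
    by rewrite !spC.
  move=> q1; apply/seteqP; split=> z.
    rewrite -sp; last exact: cg_fin.
    move=> /(Sp_PFE H F z q1) nz; apply/(Sp_PFE H F z (lexx 1)) => iz.
    by apply: nz; exact: near_inv_pfnorm_le1.
  move=> /Sp_CstarE nz; apply/(Sp_PFE H F z q1) => iz; apply: nz.
  exact: near_inv_n2_of_pfnorm iz.
- move=> sp; apply/pair_quasi_symmetricP => f z z0.
  have e := sp _ (cg_fin (star f * f)) 1 2 p11 p22.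
  apply: contrapT => /(Sp_PFE H (star f * f) z (lexx 1)).
  rewrite e => /(Sp_PFE H (star f * f) z le12); apply.
  by apply/near_inv_pfnorm2; exact: near_inv_star_mul.
Qed.
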